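(* Let $\mu \in \mathscr{W}(\mathbb{R}^n)$ with distribution function $f$. Let $U \subset \mathbb{R}^n$ be an open set with Lipschitz boundary. For any sequence of functions $h_j \in BV_{\mu}(U)$ such that $$\sup_j \|Dh_j\|(U) <\infty, \quad \sup_j \|h_j\|_{\infty}<\infty,$$ there is a subsequence $\{h_{j'}\}_{j'}$ and a function $h_{\infty} \in BV_{\mu}(U) \cap L^{\infty}(U)$ such that $$h_{j'} \rightarrow h_{\infty} \text{ in } L^1_{\mathrm{loc}}(\mu,U),\quad \|Dh_{\infty}\|(U) \le \liminf_{j\to \infty} \|Dh_{j}\|(U).$$ In particular, for any sequence of sets $E_j$ of finite $\mu$-perimeter in $U$ such that $$\sup_j \operatorname{Per}_\mu(E_j ; U)<\infty,$$ there exists a subsequence $\{E_{j'}\}_{j'}$ and a set of finite $\mu$-perimeter $E_\infty$ such that $$\chi_{E_{j'}} \rightarrow \chi_{E_\infty} \text{ in } L^1_{\mathrm{loc}}(\mu,U), \quad \operatorname{Per}_\mu(E_\infty ; U) \leq \liminf_{j \rightarrow \infty} \operatorname{Per}_\mu(E_{j} ; U).$$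
   Context: $\mathscr{W}(\mathbb{R}^n)$ is the class of measures $\mu=f\mathcal{L}^n$ whose distribution function (density) $f$ is non-negative and in $L^1(\mathbb{R}^n)\cap W^{1,1}_{\mathrm{loc}}(\mathbb{R}^n)$; $f$ is always taken to be its precise representative. $L^1(\mu,U)$ is the $L^1$ space on $U$ with respect to $\mu$, and $L^1_{\mathrm{loc}}(\mu,U)$ its local version; $\|\cdot\|_\infty$ is the $L^\infty$-norm with respect to Lebesgue measure. For a function $g$ and open $U$, $$\|g\|_{BV_\mu(U)}:=\sup\left\{\int_{U}g\big(\operatorname{div}(\phi)f+\phi\cdot\nabla f\big)\,dx:\ \phi\in C^1_c(U;\mathbb{R}^n),\ \|\phi\|_\infty\le 1\right\}\in[0,\infty],$$ and $g\in BV_\mu(U)$ iff this quantity is finite. $\|Dg\|(U)$ denotes $\|g\|_{BV_\mu(U)}$ (it is the total mass on $U$ of the variation measure $\|Dg\|_\mu$ of $g$). A measurable set $E\subset\mathbb{R}^n$ has finite $\mu$-perimeter in $U$ iff $\chi_E\in BV_\mu(U)$, and then $\operatorname{Per}_\mu(E;U):=\|\chi_E\|_{BV_\mu(U)}$. *)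

(* Defs.v *)
From HB Require Import structures.
From mathcomp Require Import all_boot all_order all_algebra.
From mathcomp Require Import all_classical all_reals all_analysis.

Set Implicit Arguments.
Unset Strict Implicit.
Unset Printing Implicit Defensive.

Import Order.TTheory GRing.Theory Num.Theory.
Import numFieldNormedType.Exports.

Local Open Scope classical_set_scope.
Local Open Scope ring_scope.

(* R^n, n >= 1, is ['rV[R]_n.+1] with n shifted by one. Its library norm is the
   sup norm (which only matters for the topology); Euclidean norms are written
   with [enorm] below. *)

(* Lebesgue outer measure: infimum of the total volume of countable covers by
   half-open boxes. A box with b_i <= a_i for some i is empty and has volume
   0. *)
Section lebesgue_outer.
Context {R : realType} {n : nat}.
Implicit Types (a b : 'rV[R]_n.+1) (A : set 'rV[R]_n.+1).

Definition box a b : set 'rV[R]_n.+1 :=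
  [set x | forall i, a 0 i < x 0 i <= b 0 i].

Definition box_volume a b : R := \prod_i Num.max 0 (b 0 i - a 0 i).

Definition box_cover A (ab : nat -> 'rV[R]_n.+1 * 'rV[R]_n.+1) :=
  A `<=` \bigcup_k box (ab k).1 (ab k).2.

Definition lebesgue_outer A : \bar R :=
  ereal_inf [set (\sum_(k <oo) (box_volume (ab k).1 (ab k).2)%:E)%E
            | ab in box_cover A].

Let vol (p : 'rV[R]_n.+1 * 'rV[R]_n.+1) : \bar R := (box_volume p.1 p.2)%:E.

Let vol_ge0 p : (0 <= vol p)%E.
Proof. by rewrite lee_fin prodr_ge0// => i _; rewrite le_max lexx. Qed.

Let outer_ge0 A : (0 <= lebesgue_outer A)%E.
Proof.
apply: le_ereal_inf_tmp => _ [ab _ <-]; apply: nneseries_ge0 => k _ _.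
exact: (vol_ge0 (ab k)).
Qed.

Let outer0 : lebesgue_outer set0 = 0%E.
Proof.
apply/eqP; rewrite eq_le outer_ge0 andbT.
apply: ereal_inf_lbound; exists (fun=> (0, 0)); first by move=> x.
apply: eseries0 => k _ _; rewrite /box_volume (bigD1 ord0)//=.
by rewrite !mxE subrr maxxx mul0r.
Qed.

Let le_outer : {homo lebesgue_outer : A B / A `<=` B >-> (A <= B)%E}.
Proof.
move=> A B AB; apply/ereal_inf_le_tmp => _ [ab Bab <-].
by exists ab => //; exact: subset_trans Bab.
Qed.

Let outer_sigma_subadditive : sigma_subadditive lebesgue_outer.
Proof.
move=> A; have [[i ioo]|] := pselect (exists i, lebesgue_outer (A i) = +oo%E).
  rewrite (eseries_pinfty _ _ ioo) ?leey// => k _.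
  by rewrite -ltNye (lt_le_trans _ (outer_ge0 _)).
rewrite -forallNE => Aoo.
apply/lee_addgt0Pr => e e0.
rewrite (le_trans _ (epsilon_trick _ _ (ltW e0)))//.
pose P k (G : nat -> 'rV[R]_n.+1 * 'rV[R]_n.+1) := box_cover (A k) G /\
  (\sum_(j <oo) vol (G j) <= lebesgue_outer (A k) + (e / (2 ^ k.+1)%:R)%:E)%E.
have [G PG] : {G & forall k, P k (G k)}.
  apply: (@choice _ _ P) => k.
  have ek : 0 < e / (2 ^ k.+1)%:R by rewrite divr_gt0// ltr0n expn_gt0.
  have fk : lebesgue_outer (A k) \is a fin_num.
    by rewrite ge0_fin_numE// ltey; apply/eqP/Aoo.
  have [_ [ab Aab <-] /ltW abe] := lb_ereal_inf_adherent ek fk.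
  by exists ab.
pose GG := uncurry G.
have GG_ge0 p : (0 <= (vol \o GG) p)%E by exact: vol_ge0.
apply: (@le_trans _ _ (\esum_(p in [set: nat * nat]) (vol \o GG) p)%E).
  have /card_esym/ppcard_eqP[f] := card_nat2.
  apply: ereal_inf_lbound; exists (GG \o f).
    move=> x [k _ /(PG k).1[j _ xj]].
    by exists (f^-1%FUN (k, j)) => //=; rewrite invK ?inE.
  by rewrite -(esum_pred_image (vol \o GG) _ xpredT) ?[fun=> _]set_true// image_eq.
rewrite (_ : esum _ _ = (\sum_(k <oo) \sum_(j <oo) vol (G k j))%E); last first.
  pose J k : set (nat * nat) := [set (k, j) | j in setT].
  rewrite (_ : setT = \bigcup_k J k); last first.
    by rewrite predeqE => -[a b]; split => // _; exists a => //; exists b.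
  rewrite esum_bigcupT//=; last first.
    apply/trivIsetP => i j _ _ ij.
    rewrite predeqE => -[k m] /=; split => //= -[] [_] _ [<-{k} _].
    by move=> [m' _] [] /esym/eqP; rewrite (negbTE ij).
  rewrite -(image_id [set: nat]) -fun_true esum_pred_image//; last first.
    by move=> k _; exact: esum_ge0.
  apply: eq_eseriesr => /= k _.
  rewrite -(esum_pred_image (vol \o GG) (pair k) predT)//=; last first.
    by move=> ? ? _ _; exact: (@can_inj _ _ _ snd).
  by congr esum; rewrite predeqE => -[a b]; split; move=> [i _ <-]; exists i.
apply: lee_nneseries => k *; first exact: nneseries_ge0.
exact: (PG k).2.
Qed.

HB.instance Definition _ := isOuterMeasure.Build R 'rV[R]_n.+1 lebesgue_outer
  outer0 outer_ge0 le_outer outer_sigma_subadditive.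

End lebesgue_outer.

(* R^n is equipped with the (complete) sigma-algebra of Lebesgue measurable
   sets, i.e. the Caratheodory sets of the Lebesgue outer measure. *)
HB.instance Definition _ (R : realType) (n : nat) :=
  Measurable.copy 'rV[R]_n.+1
    (caratheodory_type (@lebesgue_outer R n : set _ -> \bar R)).

Definition leb {R : realType} {n : nat} : set 'rV[R]_n.+1 -> \bar R :=
  @lebesgue_outer R n.

HB.instance Definition _ (R : realType) (n : nat) :=
  isMeasure.Build _ 'rV[R]_n.+1 R (@leb R n)
    (@caratheodory_measure0 R _ (@lebesgue_outer R n))
    (@caratheodory_measure_ge0 R _ (@lebesgue_outer R n))
    (@caratheodory_measure_sigma_additive R _ (@lebesgue_outer R n)).

Section definitions.
Context {R : realType} {n : nat}.
Local Notation Rn := ('rV[R]_n.+1).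
Implicit Types (U K : set Rn) (f : Rn -> R) (G : Rn -> Rn).

Definition edot (v w : Rn) : R := \sum_i v 0 i * w 0 i.

Definition enorm (v : Rn) : R := Num.sqrt (edot v v).

Definition eball (x : Rn) (r : R) : set Rn := [set y | enorm (y - x) < r].

Definition evec (i : 'I_n.+1) : Rn := delta_mx 0 i.

Definition Linfnorm U (g : Rn -> R) : \bar R :=
  'N[leb]_+oo [EFin \o (\1_U \* g)%R]%E.

Definition Linfty U (g : Rn -> R) :=
  measurable_fun U g /\ (Linfnorm U g < +oo)%E.

Definition L1loc (mu : {measure set Rn -> \bar R}) U (g : Rn -> R) :=
  forall K, compact K -> K `<=` U -> mu.-integrable K (EFin \o g).

Definition cvg_L1loc (mu : {measure set Rn -> \bar R}) U
    (g_ : nat -> Rn -> R) (g : Rn -> R) :=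
  [/\ forall j, L1loc mu U (g_ j), L1loc mu U g &
    forall K, compact K -> K `<=` U ->
      (\int[mu]_(x in K) `|g_ j x - g x|%:E)%E @[j --> \oo] --> 0%E].

Definition C1c (W : normedModType R) U (phi : Rn -> W) :=
  [/\ forall x, differentiable phi x,
      forall v, continuous ('D_v phi),
      compact (closure [set x | phi x != 0]) &
      closure [set x | phi x != 0] `<=` U].

Definition div (phi : Rn -> Rn) (x : Rn) : R :=
  \sum_i ('D_(evec i) phi x) 0 i.

Definition weak_gradient f G :=
  (forall i, L1loc leb setT (fun x => G x 0 i)) /\
  forall phi : Rn -> R, C1c setT phi -> forall i,
    \int[leb]_x (f x * 'D_(evec i) phi x) = - \int[leb]_x (G x 0 i * phi x).

Definition W11loc f := L1loc leb setT f /\ exists G, weak_gradient f G.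

(* The weak gradient of f, unique up to Lebesgue-null sets. *)
Definition grad f : Rn -> Rn := xget (fun=> 0) [set G | weak_gradient f G].

Definition average f (x : Rn) (r : R) : R :=
  (\int[leb]_(y in eball x r) f y) / fine (leb (eball x r)).

Definition precise_representative f (x : Rn) : R :=
  if `[< cvg (average f x r @[r --> 0^'+]) >]
  then lim (average f x r @[r --> 0^'+]) else 0.

(* mu = f L^n belongs to the class W(R^n), with distribution function f. *)
Definition classW (mu : {measure set Rn -> \bar R}) f :=
  [/\ forall x, 0 <= f x,
      leb.-integrable setT (EFin \o f),
      W11loc f,
      f = precise_representative f &
      forall A, measurable A -> mu A = (\int[leb]_(x in A) (f x)%:E)%E].

(* ||g||_{BV_mu(U)} = ||Dg||(U), for mu = f L^n. The integrand is integrable as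
   soon as g is measurable and essentially bounded on U. *)
Definition BVnorm f U (g : Rn -> R) : \bar R :=
  ereal_sup [set (\int[leb]_(x in U)
      (g x * (div phi x * f x + edot (phi x) (grad f x)))%:E)%E
    | phi in [set phi : Rn -> Rn |
        C1c U phi /\ (Linfnorm setT (enorm \o phi) <= 1)%E]].

Definition BV f U (g : Rn -> R) :=
  measurable_fun U g /\ (BVnorm f U g < +oo)%E.

Definition finite_perimeter f U (E : set Rn) := measurable E /\ BV f U \1_E.

Definition Per f U (E : set Rn) : \bar R := BVnorm f U \1_E.

(* Near every boundary point, in suitable orthonormal coordinates (given by the
   orthogonal matrix Q), U is the epigraph of a Lipschitz function of the first
   n-1 coordinates. *)
Definition lipschitz_boundary U :=
  forall x, (closure U `\` interior U) x ->
    exists (r : R) (Q : 'M[R]_n.+1) (gamma : 'rV[R]_n -> R),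
      [/\ 0 < r, Q *m Q^T = 1%:M, lipschitz gamma &
        forall y, ball x r y ->
          U y <-> gamma (col' ord_max (y *m Q)) < (y *m Q) 0 ord_max].

End definitions.

(* Main.v *)
Require Import Defs.
From mathcomp Require Import all_boot all_order all_algebra.
From mathcomp Require Import all_classical all_reals all_analysis.
From mathcomp Require Import finmap measurable_realfun ess_sup_inf ring lra.

(** The space is split into two regimes by the density [f]. Where [f = 0] the
    weighted measure vanishes and so does the gradient of [f] ([gradient_zero]);
    hence neither the variation nor the convergence in mean sees what a function
    does there. It is therefore enough to find a subsequence along which [h_k f]
    converges almost everywhere on [U] ([selection]): on [f > 0] this is
    convergence of [h_k] itself, and everything else follows by dominated
    convergence ([BVnorm_lsc] for the variation, which is a supremum of integrals
    of [h] against fixed integrable functions, and [cvg_L1loc_of_ae]).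

    The product [h f] has bounded variation in the plain sense on a box whose
    closure lies in [U]: the variation of [h] weighted by [f] controls
    [h (div phi f + phi . grad f)], and the second term is bounded since [h] is.
    Compactness of such products is obtained directly in terms of the Haar
    basis. Choosing as test field a signed sum of tents over the boxes of a tiling
    shows that the sum over the tiles of the differences between the integrals
    of [h f] over the two halves of a tile is at most a constant times the side
    of the tiles ([haar_estimate]). Refining dyadically, the average of [h f]
    over the boxes of side [2^-k] is within [D / 2^k] of [h f] in mean,
    with [D] the same for all [h] of the sequence ([averaging_error_boxes]). So
    convergence of the integrals over countably many boxes, which bounded
    sequences of numbers have along a subsequence, makes [h_k f] a Cauchy
    sequence in mean, at a rate that can be made summable.

    That the gradient of [f] vanishes on [f = 0] is the chain rule for the
    bounded increasing function [t |-> e t / (e + t)]. It is proved for averages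
    of [f] over the cells of a grid, where it is an algebraic identity
    ([slope_sat]) and the integral of the derivative is a telescoping sum
    ([Int_weighted_tents]). Passing to the limit in the grid needs that averages
    over fine cells, possibly shifted by one cell, converge in mean
    ([step_cvg_L1]), which is also the last step in the estimate of [h f].

    Lebesgue measure is the outer measure generated by boxes. Three facts about it
    suffice: a box has at most its volume, translates of a box have the same
    measure, and sets of finite measure can be approximated from outside by open
    sets. *)

Set Implicit Arguments.
Unset Strict Implicit.
Unset Printing Implicit Defensive.

Import Order.TTheory GRing.Theory Num.Theory.
Import numFieldNormedType.Exports.

Local Open Scope classical_set_scope.
Local Open Scope ring_scope.

(** * Boxes and Lebesgue measure *)

Section lebesgue.
Context {R : realType} {n : nat}.
Local Notation Rn := ('rV[R]_n.+1).
Implicit Types (a b x y : Rn) (A B U : set Rn) (i j : 'I_n.+1).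

Definition upd a i (c : R) : Rn := \row_j (if j == i then c else a 0 j).

Lemma updE a i c j : upd a i c 0 j = if j == i then c else a 0 j.
Proof. by rewrite mxE. Qed.

Lemma upd_same a i c : upd a i c 0 i = c.
Proof. by rewrite updE eqxx. Qed.

Lemma upd_other a i c j : j != i -> upd a i c 0 j = a 0 j.
Proof. by rewrite updE => /negPf ->. Qed.

Definition valid (p : Rn * Rn) := forall i, p.1 0 i < p.2 0 i.

Definition cbox a b : set Rn := [set x | forall i, a 0 i <= x 0 i <= b 0 i].

Lemma box_sub_cbox a b : box a b `<=` cbox a b.
Proof. by move=> x xab i; have /andP[/ltW -> ->] := xab i. Qed.

Lemma ball_coord x (r : R) y : 0 < r ->
  ball x r y <-> forall i, `|x 0 i - y 0 i| < r.
Proof.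
move=> r0; split.
  by move=> [_ xy] i; have := xy 0 i.
by move=> xy; split => // i' j; rewrite (ord1 i'); exact: xy.
Qed.

Lemma compact_cbox a b : compact (cbox a b).
Proof.
have -> : cbox a b =
    [set v : Rn | forall j, [set t : R | a 0 j <= t <= b 0 j] (v ord0 j)] by [].
apply: (@rV_compact _ _ (fun j => [set t | a 0 j <= t <= b 0 j])) => j.
rewrite (_ : [set t | _] = `[a 0 j, b 0 j]%classic); first exact: segment_compact.
by apply/seteqP; split=> t /=; rewrite in_itv.
Qed.

Lemma box_volumeD1 a b i : box_volume a b =
  Num.max 0 (b 0 i - a 0 i) * \prod_(j | j != i) Num.max 0 (b 0 j - a 0 j).
Proof. by rewrite /box_volume (bigD1 i). Qed.

Lemma box_volume_ge0 a b : 0 <= box_volume a b.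
Proof. by rewrite prodr_ge0// => i _; rewrite le_max lexx. Qed.

Lemma leb_le_cover A (ab : nat -> Rn * Rn) : box_cover A ab ->
  (leb A <= \sum_(k <oo) (box_volume (ab k).1 (ab k).2)%:E)%E.
Proof. by move=> Aab; apply: ereal_inf_lbound; exists ab. Qed.

Lemma leb_box_le a b : (leb (box a b) <= (box_volume a b)%:E)%E.
Proof.
pose ab (k : nat) : Rn * Rn := if k == 0%N then (a, b) else (0, 0).
have /leb_le_cover/le_trans -> // : box_cover (box a b) ab.
  by move=> x xab; exists 0%N.
rewrite nneseries_recl//=; last by move=> k _; rewrite lee_fin box_volume_ge0.
rewrite eseries_cond eseries0 ?adde0// => -[|k]// _ _.
by rewrite /ab /= (box_volumeD1 _ _ ord0) !mxE subrr maxxx mul0r.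
Qed.

Lemma le_leb A B : A `<=` B -> (leb A <= leb B)%E.
Proof. exact: le_outer_measure. Qed.

(** A hyperplane parallel to a coordinate hyperplane cuts every box into two
    boxes whose volumes add up, so it splits every cover without loss. *)
Lemma measurable_halfspace i (c : R) : measurable [set x : Rn | x 0 i <= c].
Proof.
apply: (@le_caratheodory_measurable R Rn (@lebesgue_outer R n)) => X.
apply: le_ereal_inf_tmp => _ [ab Xab <-].
pose lo (k : nat) := ((ab k).1, upd (ab k).2 i (Num.min ((ab k).2 0 i) c)).
pose hi (k : nat) := (upd (ab k).1 i (Num.max ((ab k).1 0 i) c), (ab k).2).
have volE k : box_volume (ab k).1 (ab k).2 =
    box_volume (lo k).1 (lo k).2 + box_volume (hi k).1 (hi k).2.
  rewrite !(box_volumeD1 _ _ i) /lo /hi /= !upd_same.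
  rewrite [X in _ = _ * X + _](_ : _ =
    \prod_(j | j != i) Num.max 0 ((ab k).2 0 j - (ab k).1 0 j)); last first.
    by apply: eq_bigr => j ji; rewrite upd_other.
  rewrite [X in _ = _ + _ * X](_ : _ =
    \prod_(j | j != i) Num.max 0 ((ab k).2 0 j - (ab k).1 0 j)); last first.
    by apply: eq_bigr => j ji; rewrite upd_other.
  rewrite -mulrDl; congr (_ * _).
  move: ((ab k).1 0 i) ((ab k).2 0 i) => u v; rewrite !maxEle !minEle.
  by do ![case: ifP => /=]; lra.
under eq_eseriesr do rewrite volE EFinD.
rewrite nneseriesD; [|by move=> k _ _; rewrite lee_fin box_volume_ge0..].
apply: leeD; apply: leb_le_cover.
- move=> x [Xx xc]; have [k _ xk] := Xab x Xx; exists k => // j /=.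
  rewrite updE; case: eqP => [->|_]; last exact: xk.
  by have /andP[-> xk2] := xk i; rewrite le_min xk2.
- move=> x [Xx /= /negP]; rewrite -ltNge => xc; have [k _ xk] := Xab x Xx.
  exists k => // j /=; rewrite updE; case: eqP => [->|_]; last exact: xk.
  by have /andP[xk1 ->] := xk i; rewrite gt_max xk1 xc.
Qed.

Lemma measurable_box a b : measurable (box a b).
Proof.
have -> : box a b = \big[setI/setT]_(i < n.+1)
    ([set x : Rn | x 0 i <= b 0 i] `\` [set x : Rn | x 0 i <= a 0 i]).
  apply/seteqP; split => x.
    move=> xab; elim/big_rec: _ => // i A _ Ax; split => //=.
    by have /andP[xa ->] := xab i; split => //; apply/negP; rewrite -ltNge.
  move=> H i; move: H; rewrite (bigD1 i)//= => -[[-> /negP]].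
  by rewrite -ltNge => ->.
apply: bigsetI_measurable => i _.
by apply: measurableD; exact: measurable_halfspace.
Qed.

(** The closed box stays inside [U], so that fields supported in it are
    admissible test fields on [U]. *)
Lemma rational_box U x : open U -> U x ->
  exists p : {ffun 'I_n.+1 -> rat} * {ffun 'I_n.+1 -> rat},
  let a := \row_j ratr (p.1 j) in let b := \row_j ratr (p.2 j) in
  [/\ valid (a, b), box a b x & cbox a b `<=` U].
Proof.
move=> oU Ux.
have /nbhs_ballP[r /= r0 xrU] : nbhs x U by exact: open_nbhs_nbhs.
have [p hp] : {p : 'I_n.+1 -> rat & forall j, x 0 j - r < ratr (p j) < x 0 j}.
  apply: (@choice _ _ (fun j q => x 0 j - r < ratr q < x 0 j)) => j.
  have /rat_in_itvoo[q] : x 0 j - r < x 0 j by rewrite ltrBlDr ltrDl.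
  by rewrite in_itv /= => hq; exists q.
have [q hq] : {q : 'I_n.+1 -> rat & forall j, x 0 j < ratr (q j) < x 0 j + r}.
  apply: (@choice _ _ (fun j q => x 0 j < ratr q < x 0 j + r)) => j.
  have /rat_in_itvoo[q] : x 0 j < x 0 j + r by rewrite ltrDl.
  by rewrite in_itv /= => hq; exists q.
exists ([ffun j => p j], [ffun j => q j]) => /=; split.
- move=> j; rewrite /= !mxE !ffunE.
  by have /andP[_ h1] := hp j; have /andP[h2 _] := hq j; exact: lt_trans h1 h2.
- move=> j; rewrite !mxE !ffunE.
  by have /andP[_ ->] := hp j; have /andP[/ltW -> _] := hq j.
- move=> y yab; apply: xrU; apply/ball_coord => // j.
  have := yab j; rewrite !mxE !ffunE => /andP[h1 h2].
  have /andP[h3 _] := hp j; have /andP[_ h4] := hq j.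
  by rewrite ltr_norml; apply/andP; split; lra.
Qed.

Lemma measurable_open U : open U -> measurable U.
Proof.
move=> oU.
pose rb (p : {ffun 'I_n.+1 -> rat} * {ffun 'I_n.+1 -> rat}) : Rn * Rn :=
  (\row_j ratr (p.1 j), \row_j ratr (p.2 j)).
pose F p := if `[< box (rb p).1 (rb p).2 `<=` U >] then
  box (rb p).1 (rb p).2 else set0.
have -> : U = \bigcup_p F p.
  apply/seteqP; split => x.
    move=> Ux; have [p [_ xp pU]] := rational_box oU Ux.
    exists p => //; rewrite /F; case: asboolP => // -[].
    by apply: subset_trans pU; exact: box_sub_cbox.
  by move=> [p _]; rewrite /F; case: asboolP => [bU /bU//|_ []].
apply: countable_bigcupT_measurable; first exact: countableP.
by move=> p; rewrite /F; case: ifP => _; [exact: measurable_box|exact: measurable0].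
Qed.

Lemma measurable_closed U : closed U -> measurable U.
Proof.
by move=> cU; rewrite -(setCK U); apply/measurableC/measurable_open/closed_openC.
Qed.

Lemma measurable_compact U : compact U -> measurable U.
Proof.
by move=> cU; apply: measurable_closed; apply: compact_closed cU; exact: norm_hausdorff.
Qed.

Lemma continuous_measurable (g : Rn -> R) : continuous g -> measurable_fun setT g.
Proof.
move=> cg; apply: (measurability _ (@RGenOpens.measurableE R)).
move=> _ [_ [a [b ->] <-]]; rewrite setTI; apply: measurable_open.
by apply: open_comp => // x _; exact: cg.
Qed.

Definition cube (r : R) : Rn * Rn := (const_mx (- r), const_mx r).

Lemma compact_sub_cube (K : set Rn) : compact K -> exists2 r : R, 0 < r &
  K `<=` box (cube r).1 (cube r).2.
Proof.
move=> /compact_bounded[M [Mr HM]].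
exists (Num.max M 0 + 2) => [|x Kx i].
  by rewrite ltr_wpDl// le_max lexx orbT.
have M1 : M < Num.max M 0 + 1 by rewrite ltr_pwDr// le_max lexx.
have := HM _ M1 x Kx => /= xM.
have xi : `|x 0 i| <= Num.max M 0 + 1.
  apply: le_trans xM; rewrite /Num.norm/= mx_normrE.
  by rewrite (le_bigmax _ _ (0, i)).
rewrite !mxE; move: xi; rewrite ler_norml => /andP[h1 h2].
by apply/andP; split; [apply: lt_le_trans h1|apply: le_trans h2 _]; lra.
Qed.

(** Inside a cube, a hyperplane lies in slabs of arbitrarily small volume. *)
Lemma leb_hyperplane i (c : R) : leb [set x : Rn | x 0 i = c] = 0%E.
Proof.
set H := [set x : Rn | _].
pose Hm (m : nat) := H `&` box (cube m%:R).1 (cube m%:R).2.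
have Hm0 m : leb (Hm m) = 0%E.
  apply/eqP; rewrite eq_le outer_measure_ge0 andbT.
  apply/lee_addgt0Pr => e e0; rewrite add0e.
  pose V : R := \prod_(j < n.+1 | j != i) Num.max 0 (m%:R - - m%:R).
  have V0 : 0 <= V by rewrite prodr_ge0// => j _; rewrite le_max lexx.
  pose d := e / (V + 1).
  have d0 : 0 < d by rewrite divr_gt0// ltr_wpDl.
  apply: (@le_trans _ _ (leb (box (upd (cube m%:R).1 i (c - d))
                                  (upd (cube m%:R).2 i c)))).
    apply: le_leb => x [xc xm] j; rewrite !updE; case: eqP => [->|_].
      by rewrite xc lexx andbT ltrBlDr ltrDl.
    exact: xm.
  apply: le_trans (leb_box_le _ _) _; rewrite lee_fin (box_volumeD1 _ _ i).
  rewrite !upd_same [X in _ * X](_ : _ = V); last first.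
    by apply: eq_bigr => j ji; rewrite !upd_other// !mxE.
  have -> : c - (c - d) = d by ring.
  rewrite (max_idPr (ltW d0)) /d mulrAC ler_pdivrMr ?ltr_wpDl//.
  by rewrite ler_pM2l// lerDl.
apply/eqP; rewrite eq_le outer_measure_ge0 andbT.
have HU : H `<=` \bigcup_m Hm m.
  move=> x Hx; have [r r0 /(_ x erefl) xr] := compact_sub_cube (@compact_set1 Rn x).
  exists (Num.truncn r).+1 => //; split => // j.
  have rt : r <= (Num.truncn r).+1%:R by apply/ltW/truncnS_gt.
  have := xr j; rewrite !mxE => /andP[h1 h2].
  by apply/andP; split; [apply: le_lt_trans h1; rewrite lerN2|exact: le_trans rt].
apply: le_trans (le_leb HU) _.
apply: le_trans (outer_measure_sigma_subadditive (@lebesgue_outer R n) Hm) _.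
by rewrite eseries0// => m _ _; exact: Hm0.
Qed.

Lemma ae_coord_neq i (c : R) : {ae leb, forall x : Rn, x 0 i != c}.
Proof.
exists [set x : Rn | x 0 i = c]; split; last 2 first.
- exact: leb_hyperplane.
- by move=> x /= /negP; rewrite negbK => /eqP.
rewrite (_ : [set x : Rn | _] = (fun x : Rn => x 0 i) @^-1` [set c]); last by [].
rewrite -[X in measurable X]setTI; apply: continuous_measurable => //.
exact: coord_continuous.
Qed.

Let leb_box_shift_le a b (v : Rn) :
  (leb (box (a + v) (b + v)) <= leb (box a b))%E.
Proof.
apply: le_ereal_inf_tmp => _ [ab abE <-].
pose ab' k : Rn * Rn := ((ab k).1 + v, (ab k).2 + v).
rewrite [leRHS](_ : _ =
    \sum_(k <oo) (box_volume (ab' k).1 (ab' k).2)%:E)%E; last first.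
  apply: eq_eseriesr => k _; congr EFin; apply: eq_bigr => j _.
  by rewrite !mxE; congr Num.max; ring.
apply: leb_le_cover => x xab.
have /abE[k _ xk] : box a b (x - v).
  by move=> j; have := xab j; rewrite !mxE ltrBrDr lerBlDr.
by exists k => // j; have := xk j; rewrite !mxE ltrBrDr lerBlDr.
Qed.

(** Translating a cover does not change its total volume. *)
Lemma leb_box_shift a b (v : Rn) : leb (box (a + v) (b + v)) = leb (box a b).
Proof.
apply/eqP; rewrite eq_le leb_box_shift_le/=.
by have := leb_box_shift_le (a + v) (b + v) (- v); rewrite !addrK.
Qed.

Lemma open_obox a b : open [set x : Rn | forall j, a 0 j < x 0 j < b 0 j].
Proof.
have -> : [set x : Rn | forall j, a 0 j < x 0 j < b 0 j] = \big[setI/setT]_(j < n.+1)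
    ((fun x : Rn => x 0 j) @^-1` `]a 0 j, b 0 j[).
  apply/seteqP; split => x.
    move=> xab; elim/big_rec: _ => // i A _ Ax; split => //=.
    by rewrite in_itv /=; exact: xab.
  by move=> H i; move: H; rewrite (bigD1 i)//= => -[+ _]; rewrite in_itv.
elim/big_rec: _ => [|j A _ oA]; first exact: openT.
apply: openI => //; apply: open_comp; last exact: interval_open.
by move=> x _; exact: coord_continuous.
Qed.

Let box_volume_cvg a b :
  box_volume a (b + const_mx d) @[d --> 0^'+] --> box_volume a b.
Proof.
rewrite /box_volume; elim: (index_enum _) => [|j s IH].
  by rewrite big_nil; under eq_fun do rewrite big_nil; exact: cvg_cst.
rewrite big_cons; under eq_fun do rewrite big_cons.
apply: cvgM => //; apply: cvg_at_right_filter.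
have -> : (fun d : R => Num.max 0 ((b + const_mx d) 0 j - a 0 j)) =
    (fun d => Num.max 0 (d + (b 0 j - a 0 j))).
  by apply/funext => d; rewrite !mxE; congr Num.max; ring.
have : Num.max 0 (d + (b 0 j - a 0 j)) @[d --> (0:R)] -->
    Num.max 0 (0 + (b 0 j - a 0 j)).
  apply: (@continuous_max _ _ (cst 0) (fun d : R => d + (b 0 j - a 0 j)) 0).
    exact: cvg_cst.
  by apply: cvgD; [exact: cvg_id|exact: cvg_cst].
by rewrite add0r.
Qed.

(** The half-open boxes of an efficient cover are enlarged to open ones at an
    arbitrarily small cost. *)
Lemma outer_regular A (e : R) : 0 < e -> (leb A < +oo)%E ->
  exists2 C, open C & A `<=` C /\ (leb C <= leb A + e%:E)%E.
Proof.
move=> e0 Aoo; have e2 : 0 < e / 2 by rewrite divr_gt0.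
have fA : leb A \is a fin_num by rewrite ge0_fin_numE// outer_measure_ge0.
have [_ [ab Aab <-] /ltW abe] := lb_ereal_inf_adherent e2 fA.
have [d hd] : {d : nat -> R & forall k, 0 < d k /\
    box_volume (ab k).1 ((ab k).2 + const_mx (d k)) <=
    box_volume (ab k).1 (ab k).2 + e / 2 / (2 ^ k.+1)%:R}.
  apply: (@choice _ _ (fun k d => 0 < d /\
    box_volume (ab k).1 ((ab k).2 + const_mx d) <=
    box_volume (ab k).1 (ab k).2 + e / 2 / (2 ^ k.+1)%:R)) => k.
  have ek : 0 < e / 2 / (2 ^ k.+1)%:R by rewrite divr_gt0// ltr0n expn_gt0.
  have [d [d0 hd]] : exists d : R, 0 < d /\
     `|box_volume (ab k).1 (ab k).2 -
       box_volume (ab k).1 ((ab k).2 + const_mx d)| < e / 2 / (2 ^ k.+1)%:R.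
    have cvg_ab := box_volume_cvg (a := (ab k).1) (b := (ab k).2).
    have /cvgrPdist_lt/(_ _ ek) := cvg_ab.
    move=> H; near (0:R)^'+ => d; exists d; split; first by near: d; exact: nbhs_right_gt.
    by near: d.
  exists d; split => //; move: hd; rewrite ltr_norml => /andP[+ _]; lra.
pose O k := [set x : Rn | forall j, (ab k).1 0 j < x 0 j <
                                    ((ab k).2 + const_mx (d k)) 0 j].
exists (\bigcup_k O k); first by apply: bigcup_open => k _; exact: open_obox.
split.
  move=> x /Aab[k _ xk]; exists k => // j; rewrite !mxE.
  have /andP[-> xk2] := xk j; rewrite (le_lt_trans xk2)// ltrDl.
  exact: (hd k).1.
apply: le_trans (outer_measure_sigma_subadditive (@lebesgue_outer R n) O) _.
apply: (@le_trans _ _ (\sum_(k <oo) ((box_volume (ab k).1 (ab k).2)%:E +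
                                      (e / 2 / (2 ^ k.+1)%:R)%:E))%E).
  apply: lee_nneseries => [k _ _|k _]; first exact: outer_measure_ge0.
  apply: (@le_trans _ _ (leb (box (ab k).1 ((ab k).2 + const_mx (d k))))).
    by apply: le_leb => x xO j; have /andP[-> /ltW ->] := xO j.
  by apply: le_trans (leb_box_le _ _) _; rewrite -EFinD lee_fin; exact: (hd k).2.
apply: le_trans (epsilon_trick _ _ (ltW e2)) _.
  by move=> k; rewrite lee_fin box_volume_ge0.
by rewrite [e in leRHS]splitr EFinD addeA leeD2r.
Unshelve. all: by end_near. Qed.

End lebesgue.

(** * Real integrals and convergence *)

Section real_integral.
Context d {T : measurableType d} {R : realType}
  (mu : {measure set T -> \bar R}).
Implicit Types (u v w : T -> R) (c : R) (A : set T).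

(** Integrals extend over the whole space; restrictions are written as products
    with indicators, so that linearity needs no side conditions on domains. *)
Definition L1 v := mu.-integrable setT (EFin \o v).

Definition Int v : R := \int[mu]_x v x.

Lemma L1_measurable v : L1 v -> measurable_fun setT v.
Proof. by move=> /measurable_int/measurable_EFinP. Qed.

Lemma L1_0 : L1 (fun=> 0).
Proof. exact: integrable0. Qed.

Lemma L1D u v : L1 u -> L1 v -> L1 (fun x => u x + v x).
Proof.
move=> Lu Lv; rewrite /L1 (_ : _ \o _ = (EFin \o u) \+ (EFin \o v))%E//.
exact: integrableD.
Qed.

Lemma L1Z c v : L1 v -> L1 (fun x => c * v x).
Proof.
move=> Lv; rewrite /L1 (_ : _ \o _ = (fun x => c%:E * (EFin \o v) x)%E)//.
exact: integrableZl.
Qed.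

Lemma L1N v : L1 v -> L1 (fun x => - v x).
Proof.
by move=> /(L1Z (-1)); rewrite (_ : (fun _ => _) = fun x => - v x)//;
   apply/funext => x; rewrite mulN1r.
Qed.

Lemma L1B u v : L1 u -> L1 v -> L1 (fun x => u x - v x).
Proof. by move=> Lu Lv; apply: L1D => //; exact: L1N. Qed.

Lemma L1_norm v : L1 v -> L1 (fun x => `|v x|).
Proof. exact: integrable_norm. Qed.

Lemma L1_sum (J : Type) (s : seq J) (v : J -> T -> R) :
  (forall j, L1 (v j)) -> L1 (fun x => \sum_(j <- s) v j x).
Proof.
move=> Lv; elim: s => [|j s IH].
  by under eq_fun do rewrite big_nil; exact: L1_0.
by under eq_fun do rewrite big_cons; exact: L1D.
Qed.

Lemma L1_dom v w : measurable_fun setT v -> L1 w ->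
  (forall x, `|v x| <= w x) -> L1 v.
Proof.
move=> mv Lw vw; apply: (le_integrable _ _ _ Lw) => //.
  exact/measurable_EFinP.
by move=> x _; rewrite lee_fin (le_trans (vw x))// ler_norm.
Qed.

Lemma L1_mulbdd u v c : measurable_fun setT u -> (forall x, `|u x| <= c) ->
  L1 v -> L1 (fun x => u x * v x).
Proof.
move=> mu_ uc Lv; apply: (@L1_dom _ (fun x => c * `|v x|)).
- by apply: measurable_funM => //; exact: L1_measurable.
- exact/L1Z/L1_norm.
- by move=> x; rewrite normrM ler_wpM2r.
Qed.

Lemma indic_norm_le1 A x : `|\1_A x : R| <= 1.
Proof. by rewrite indicE; case: (_ \in _) => /=; rewrite ?normr1 ?normr0. Qed.

Lemma indic_in A x : A x -> \1_A x = 1 :> R.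
Proof. by move=> Ax; rewrite indicE mem_set. Qed.

Lemma indic_out A x : ~ A x -> \1_A x = 0 :> R.
Proof. by move=> Ax; rewrite indicE memNset. Qed.

Lemma indic_le1 A x : \1_A x <= 1 :> R.
Proof. by apply: le_trans (indic_norm_le1 A x); exact: ler_norm. Qed.

Lemma indic_ge0 A x : 0 <= \1_A x :> R.
Proof. by rewrite indicE. Qed.

Lemma L1_indicM A v : measurable A -> L1 v -> L1 (fun x => \1_A x * v x).
Proof.
move=> mA; apply: (@L1_mulbdd _ _ 1); first exact: measurable_indic.
by move=> x; exact: indic_norm_le1.
Qed.

Lemma measurable_indicM A v : measurable A -> measurable_fun A v ->
  measurable_fun setT (fun x => \1_A x * v x).
Proof.
move=> mA /(measurable_restrictT _ mA).
rewrite (_ : v \_ A = (fun x => \1_A x * v x))//.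
apply/funext => x; rewrite patchE indicE.
by case: (x \in A); rewrite ?mul1r ?mul0r.
Qed.

Lemma integrable_L1 A v : measurable A ->
  mu.-integrable A (EFin \o v) <-> L1 (fun x => \1_A x * v x).
Proof.
move=> mA; rewrite integrable_mkcond// /L1.
rewrite (_ : (EFin \o v) \_ A = EFin \o (fun x => \1_A x * v x))//.
apply/funext => x; rewrite patchE /= indicE.
by case: (x \in A); rewrite ?mul1r ?mul0r.
Qed.

Lemma Int_restrict A v : \int[mu]_(x in A) v x = Int (fun x => \1_A x * v x).
Proof.
rewrite Rintegral_mkcond; congr (Rintegral _ _ _).
by apply/funext => x; rewrite patchE indicE; case: ifP => _; rewrite ?mul1r ?mul0r.
Qed.

Lemma L1_indic A : measurable A -> (mu A < +oo)%E -> L1 \1_A.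
Proof.
move=> mA Aoo; apply/integrableP; split; first exact/measurable_EFinP.
under eq_integral do rewrite /= (ger0_norm _)//.
by rewrite integral_indic// setIT.
Qed.

Lemma Int_indic A : measurable A -> Int \1_A = fine (mu A).
Proof. by move=> mA; rewrite /Int /Rintegral integral_indic// setIT. Qed.

Lemma EFin_Int v : L1 v -> (Int v)%:E = (\int[mu]_x (v x)%:E)%E.
Proof. by move=> Lv; rewrite /Int /Rintegral fineK//; exact: integrable_fin_num Lv. Qed.

Lemma IntE v : Int v = \int[mu]_x v x.
Proof. by []. Qed.

Lemma L1P v : L1 v <-> mu.-integrable setT (EFin \o v).
Proof. by []. Qed.

Lemma IntD u v : L1 u -> L1 v -> Int (fun x => u x + v x) = Int u + Int v.
Proof. by move=> Lu Lv; rewrite /Int RintegralD. Qed.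

Lemma IntB u v : L1 u -> L1 v -> Int (fun x => u x - v x) = Int u - Int v.
Proof. by move=> Lu Lv; rewrite /Int RintegralB. Qed.

Lemma IntZ c v : L1 v -> Int (fun x => c * v x) = c * Int v.
Proof. by move=> Lv; rewrite /Int RintegralZl. Qed.

Lemma Int0 : Int (fun=> 0) = 0.
Proof. by rewrite /Int /Rintegral integral0. Qed.

Lemma Int_sum (J : Type) (s : seq J) (v : J -> T -> R) :
  (forall j, L1 (v j)) ->
  Int (fun x => \sum_(j <- s) v j x) = \sum_(j <- s) Int (v j).
Proof.
move=> Lv; elim: s => [|j s IH].
  by rewrite big_nil; under eq_fun do rewrite big_nil; exact: Int0.
rewrite big_cons -IH -IntD//; last exact: L1_sum.
by congr Int; apply/funext => x; rewrite big_cons.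
Qed.

Lemma Int_le u v : L1 u -> L1 v -> (forall x, u x <= v x) -> Int u <= Int v.
Proof. by move=> Lu Lv uv; apply: le_Rintegral => // x _; exact: uv. Qed.

Lemma Int_ge0 v : (forall x, 0 <= v x) -> 0 <= Int v.
Proof. by move=> v0; apply: Rintegral_ge0 => x _; exact: v0. Qed.

Lemma Int_abs v : L1 v -> `|Int v| <= Int (fun x => `|v x|).
Proof. by move=> Lv; exact: le_normr_Rintegral. Qed.

Lemma eq_Int u v : u =1 v -> Int u = Int v.
Proof. by move=> /funext ->. Qed.

Lemma ae_eq_Int u v : measurable_fun setT u -> measurable_fun setT v ->
  {ae mu, forall x, u x = v x} -> Int u = Int v.
Proof.
move=> mu_ mv uv; congr fine; apply: ae_eq_integral => //; try exact/measurable_EFinP.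
by apply: filterS uv => x -> _.
Qed.

Lemma Int_null v : L1 v -> Int (fun x => `|v x|) = 0 -> {ae mu, forall x, v x = 0}.
Proof.
move=> Lv v0.
have : (\int[mu]_(x in setT) `|(EFin \o v) x| = 0)%E.
  rewrite -[LHS]fineK; last exact: integrable_fin_num (integrable_abse Lv).
  by move: v0; rewrite /Int /Rintegral => /= ->.
have mv : measurable_fun setT (EFin \o v) by exact/measurable_EFinP/L1_measurable.
move/(ae_eq_integral_abs mu measurableT mv); apply: filterS => x /(_ I).
by move=> [].
Qed.

Lemma Int_dct (v_ : nat -> T -> R) v g :
  (forall k, measurable_fun setT (v_ k)) -> measurable_fun setT v ->
  {ae mu, forall x, v_ k x @[k --> \oo] --> v x} -> L1 g ->
  (forall k, {ae mu, forall x, `|v_ k x| <= g x}) ->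
  [/\ L1 v, Int (v_ k) @[k --> \oo] --> Int v &
      Int (fun x => `|v_ k x - v x|) @[k --> \oo] --> 0].
Proof.
move=> mv_ mv v_v Lg v_g.
have [] := @dominated_convergence _ _ _ mu _ measurableT (fun k => EFin \o v_ k)
  (EFin \o v) (EFin \o g).
- by move=> k; exact/measurable_EFinP.
- exact/measurable_EFinP.
- by apply: filterS v_v => x vx _; apply: cvg_EFin => //; exact: nearW.
- by [].
- have /ae_foralln : forall k, {ae mu, forall x, (`|(EFin \o v_ k) x| <= (EFin \o g) x)%E}.
    by move=> k; apply: filterS (v_g k) => x; rewrite lee_fin.
  by apply: filterS => x Hx k _; exact: Hx.
move=> Lv c0 cv; split => //.
- by apply: fine_cvg; rewrite fineK//; exact: integrable_fin_num.
- by apply: fine_cvg; exact: c0.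
Qed.

Lemma Int_cvg (v_ : nat -> T -> R) v g :
  (forall k, measurable_fun setT (v_ k)) -> measurable_fun setT v ->
  {ae mu, forall x, v_ k x @[k --> \oo] --> v x} -> L1 g ->
  (forall k x, `|v_ k x| <= g x) -> Int (v_ k) @[k --> \oo] --> Int v.
Proof.
move=> mv_ mv v_v Lg v_g; have [] // := @Int_dct v_ v g mv_ mv v_v Lg.
by move=> k; apply: aeW.
Qed.

Lemma L1_dom_ae v w : measurable_fun setT v -> L1 w ->
  {ae mu, forall x, `|v x| <= w x} -> L1 v.
Proof.
move=> mv Lw vw; have [] // := @Int_dct (fun=> v) v w.
by apply: aeW => x; exact: cvg_cst.
Qed.

Lemma EFin_Int_restrict A v : measurable A -> L1 (fun x => \1_A x * v x) ->
  (\int[mu]_(x in A) (v x)%:E)%E = (Int (fun x => \1_A x * v x))%:E.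
Proof.
move=> mA Lv; rewrite -Int_restrict /Rintegral fineK//.
by apply: integrable_fin_num => //; apply/integrable_L1.
Qed.

Lemma Int_dct0 (v_ : nat -> T -> R) g :
  (forall k, L1 (v_ k)) -> {ae mu, forall x, v_ k x @[k --> \oo] --> 0} ->
  L1 g -> (forall k x, `|v_ k x| <= g x) -> Int (v_ k) @[k --> \oo] --> 0.
Proof.
move=> Lv v0 Lg vg; rewrite -[X in _ --> X]Int0.
have [] // := @Int_dct v_ (fun=> 0) g.
- by move=> k; exact: L1_measurable.
- by move=> k; apply: aeW.
Qed.

(** Monotone convergence bounds the integral of the series of the [`|v_ k|], so
    that series is finite almost everywhere. *)
Lemma ae_summable (v_ : nat -> T -> R) C :
  (forall k, L1 (v_ k)) ->
  (forall N, \sum_(0 <= k < N) Int (fun x => `|v_ k x|) <= C) ->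
  {ae mu, forall x, cvgn [normed series (fun k => v_ k x)]}.
Proof.
move=> Lv vC.
have mv k : measurable_fun setT (fun x => (`|v_ k x|)%:E).
  by apply/measurable_EFinP; apply: measurableT_comp => //; exact: L1_measurable.
pose S x := (\sum_(k <oo) `|v_ k x|%:E)%E.
have mS : measurable_fun setT S.
  by apply: ge0_emeasurable_sum => // k x _ _; rewrite lee_fin.
have S0 x : (0 <= S x)%E by apply: nneseries_ge0 => k _ _; rewrite lee_fin.
have iS : mu.-integrable setT S.
  apply/integrableP; split => //.
  under eq_integral do rewrite gee0_abs//.
  rewrite /S integral_nneseries//.
  apply: (@le_lt_trans _ _ C%:E); last by rewrite ltry.
  apply: lime_le; first by apply: is_cvg_nneseries => k _ _; exact: integral_ge0.
  apply: nearW => N; apply: le_trans (_ : (\sum_(0 <= k < N) Int (fun x => `|v_ k x|))%:E <= _)%E.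
    rewrite -sumEFin; apply: lee_sum => k _.
    rewrite /Int /Rintegral fineK//.
    exact: integrable_fin_num (L1_norm (Lv k)).
  by rewrite lee_fin.
have := integrable_ae measurableT iS; apply: filterS => x /(_ I) Sx.
suff : cvgn (series (fun k => `|v_ k x|)) by [].
apply: nondecreasing_is_cvgn.
  by apply/nondecreasing_seqP => N; rewrite seriesSr lerDl.
exists (fine (S x)) => _ [N _ <-].
rewrite -lee_fin fineK// /series/= -sumEFin.
exact: (nneseries_lim_ge (P := xpredT)).
Qed.

Lemma geometric_half_le (C : R) N : 0 <= C -> \sum_(0 <= k < N) C / 2 ^+ k <= 2 * C.
Proof.
move=> C0; have -> : \sum_(0 <= k < N) C / 2 ^+ k = 2 * C - 2 * C / 2 ^+ N.
  elim: N => [|N IH]; first by rewrite big_geq// expr0 divr1 subrr.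
  rewrite big_nat_recr//= IH exprS.
  have : (2 : R) ^+ N != 0 by rewrite expf_neq0.
  by move=> h; field.
by rewrite lerBlDr lerDl divr_ge0// ?exprn_ge0// mulr_ge0.
Qed.

Lemma ae_cvg0_fast (v_ : nat -> T -> R) C :
  (forall k, L1 (v_ k)) ->
  (forall k, Int (fun x => `|v_ k x|) <= C / 2 ^+ k) ->
  {ae mu, forall x, v_ k x @[k --> \oo] --> 0}.
Proof.
move=> Lv vC.
have C0 : 0 <= C.
  have := vC 0%N; rewrite expr0 divr1; apply: le_trans.
  by apply: Int_ge0 => x.
apply: filterS (@ae_summable _ (2 * C) Lv _) => [x|N].
  by move=> /normed_cvg/cvg_series_cvg_0.
by apply: le_trans (geometric_half_le N C0); apply: ler_sum => k _; exact: vC.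
Qed.

(** The increments are almost everywhere the terms of an absolutely convergent
    series, by [ae_summable]. *)
Lemma ae_cvg_fast (u_ : nat -> T -> R) C :
  (forall k, L1 (u_ k)) ->
  (forall k, Int (fun x => `|u_ k.+1 x - u_ k x|) <= C / 2 ^+ k) ->
  {ae mu, forall x, cvgn (fun k => u_ k x)}.
Proof.
move=> Lu uC.
have C0 : 0 <= C.
  have := uC 0%N; rewrite expr0 divr1; apply: le_trans.
  by apply: Int_ge0 => x.
apply: filterS (@ae_summable (fun k x => u_ k.+1 x - u_ k x) (2 * C) _ _) =>
    [x /normed_cvg|k|N].
- rewrite -/(telescope (fun k => u_ k x)) telescopeK => cu.
  rewrite (_ : (fun k => u_ k x) = (fun k => u_ k x - u_ 0%N x + u_ 0%N x)).
    by apply: is_cvgD => //; exact: is_cvg_cst.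
  by apply/funext => k; rewrite subrK.
- exact: L1B.
- by apply: le_trans (geometric_half_le N C0); apply: ler_sum => k _; exact: uC.
Qed.

End real_integral.

Lemma exists_increasing (P : nat -> nat -> Prop) :
  (forall k N, exists2 m, (N <= m)%N & P k m) ->
  exists2 s : nat -> nat, {homo s : i j / (i < j)%N} & forall k, P k (s k).
Proof.
move=> HP.
have [g hg] : {g : nat * nat -> nat & forall p, (p.2 <= g p)%N /\ P p.1 (g p)}.
  apply: (@choice _ _ (fun p m => (p.2 <= m)%N /\ P p.1 m)) => -[k N].
  by have [m Nm Pm] := HP k N; exists m.
pose s := fix s k := if k is k'.+1 then g (k, (s k').+1) else g (0%N, 0%N).
exists s; first by apply: homo_ltn => [|k]; [exact: ltn_trans|exact: (hg (k.+1, (s k).+1)).1].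
by case=> [|k]; [exact: (hg (0%N, 0%N)).2|exact: (hg (k.+1, (s k).+1)).2].
Qed.

Lemma fast_subsequence (R : realType) (a : nat -> R) : a k @[k --> \oo] --> 0 ->
  exists2 s : nat -> nat, {homo s : i j / (i < j)%N} &
    forall k, `|a (s k)| <= 1 / 2 ^+ k.
Proof.
move=> a0; apply: exists_increasing (fun k m => `|a m| <= 1 / 2 ^+ k) _ => k N.
have e0 : (0 : R) < 1 / 2 ^+ k by rewrite divr_gt0// exprn_gt0.
have /cvgrPdist_le/(_ _ e0)[M _ HM] := a0.
exists (maxn N M); first by rewrite leq_maxl.
by have := HM _ (leq_maxr N M); rewrite sub0r normrN.
Qed.

Lemma cvg0_leP (R : realType) (a : nat -> R) : (forall k, 0 <= a k) ->
  a k @[k --> \oo] --> 0 <-> forall e, 0 < e -> \forall k \near \oo, a k <= e.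
Proof.
move=> a0; split=> [/cvgrPdist_le|] H.
  move=> e /H; apply: filterS => k; rewrite sub0r normrN.
  by rewrite ger0_norm.
apply/cvgrPdist_le => e /H; apply: filterS => k.
by rewrite sub0r normrN ger0_norm.
Qed.

Section cvg_to_0.
Context {R : realType}.
Implicit Types a b : nat -> R.

Lemma cvg0_le a b : (forall k, 0 <= a k) -> (forall k, a k <= b k) ->
  b k @[k --> \oo] --> 0 -> a k @[k --> \oo] --> 0.
Proof.
move=> a0 ab b0; apply: squeeze_cvgr (cvg_cst _) b0.
by apply: nearW => k; rewrite a0 ab.
Qed.

Lemma cvg0D a b : a k @[k --> \oo] --> 0 -> b k @[k --> \oo] --> 0 ->
  a k + b k @[k --> \oo] --> 0.
Proof. by move=> a0 b0; rewrite -[X in _ --> X](addr0 0); exact: cvgD. Qed.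

Lemma cvg0Z c a : a k @[k --> \oo] --> 0 -> c * a k @[k --> \oo] --> 0.
Proof.
by move=> a0; rewrite -[X in _ --> X](mulr0 c); apply: cvgM => //; exact: cvg_cst.
Qed.

Lemma cvg_norm_le a (l C : R) : a k @[k --> \oo] --> l ->
  (forall k, `|a k| <= C) -> `|l| <= C.
Proof.
move=> al aC; apply/ler_addgt0Pr => e e0.
have /cvgrPdist_le/(_ _ e0)[N _ /(_ N (leqnn N)) h] := al.
rewrite -(subrK (a N) l) addrC; apply: le_trans (ler_normD _ _) _.
by apply: lerD => //; exact: aC.
Qed.

End cvg_to_0.

Opaque Int L1.

(** * Averages over fine tilings converge in mean *)

Section averaging.
Context {R : realType} {n : nat}.
Local Notation Rn := ('rV[R]_n.+1).
Local Notation L1 := (L1 (@leb R n)).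
Local Notation Int := (Int (@leb R n)).
Implicit Types (p : Rn * Rn) (q : (Rn * Rn) * (Rn * Rn)) (l : seq ((Rn * Rn) * (Rn * Rn))).
Implicit Types (u v w : Rn -> R) (A C Q : set Rn).

Definition bset p : set Rn := box p.1 p.2.

Definition msr p : R := fine (leb (bset p)).

Definition avg p v : R := Int (fun x => \1_(bset p) x * v x) / msr p.

(** A step function built on the boxes [q.1], with the averages over the
    companion boxes [q.2]: the conditional expectation when [q.2 = q.1], and a
    translate of it when [q.2] is a translate of [q.1]. *)
Definition step l v (x : Rn) : R := \sum_(q <- l) \1_(bset q.1) x * avg q.2 v.

Lemma msrE p : msr p = fine (leb (bset p)).
Proof. by []. Qed.

Lemma avgE p v : avg p v = Int (fun x => \1_(bset p) x * v x) / msr p.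
Proof. by []. Qed.

Lemma stepE l v x : step l v x = \sum_(q <- l) \1_(bset q.1) x * avg q.2 v.
Proof. by []. Qed.

Lemma measurable_bset p : measurable (bset p).
Proof. exact: measurable_box. Qed.
Hint Resolve measurable_bset : core.

Lemma leb_bset_fin p : (leb (bset p) < +oo)%E.
Proof. by apply: le_lt_trans (leb_box_le _ _) _; rewrite ltry. Qed.

Lemma L1_bset p : L1 \1_(bset p).
Proof. by apply: L1_indic => //; exact: leb_bset_fin. Qed.
Hint Resolve L1_bset : core.

Lemma Int_bset p : Int \1_(bset p) = msr p.
Proof. by rewrite Int_indic. Qed.

Lemma msr_ge0 p : 0 <= msr p.
Proof. by rewrite -Int_bset; apply: Int_ge0 => x. Qed.

Lemma msr_eq0_Int p v c : msr p = 0 -> measurable_fun setT v ->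
  (forall x, `|v x| <= c) -> Int (fun x => \1_(bset p) x * v x) = 0.
Proof.
move=> p0 mv vc; apply/eqP; rewrite -normr_le0.
have Lpv : L1 (fun x => \1_(bset p) x * v x).
  under eq_fun do rewrite mulrC; exact: L1_mulbdd vc _.
apply: le_trans (Int_abs Lpv) _.
apply: (@le_trans _ _ (Int (fun x => c * \1_(bset p) x))).
  apply: Int_le; [exact: L1_norm|exact: L1Z|].
  by move=> x; rewrite normrM (ger0_norm (_ : 0 <= \1_(bset p) x))// mulrC ler_wpM2r.
by rewrite IntZ// Int_bset p0 mulr0.
Qed.

Lemma msr_eq0_L1 p v : msr p = 0 -> L1 v ->
  Int (fun x => \1_(bset p) x * v x) = 0.
Proof.
move=> p0 Lv; rewrite -[RHS](Int0 (@leb R n)); apply: ae_eq_Int.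
- by apply: (@L1_measurable _ _ _ leb); exact: L1_indicM.
- exact: measurable_cst.
have lp0 : leb (bset p) = 0%E.
  by rewrite -[LHS]fineK ?ge0_fin_numE ?leb_bset_fin//; congr EFin.
exists (bset p); split; [exact: measurable_bset|exact: lp0|move=> x /= /eqP]; rewrite mulf_eq0 negb_or => /andP[+ _].
by rewrite indicE; case: (boolP (x \in bset p)) => [/set_mem//|_]; rewrite eqxx.
Qed.

Lemma msr_avg p (q : Rn * Rn) v : L1 v -> leb (bset p) = leb (bset q) ->
  msr p * avg q v = Int (fun x => \1_(bset q) x * v x).
Proof.
move=> Lv pq; have -> : msr p = msr q by rewrite /msr pq.
have [q0|q0] := eqVneq (msr q) 0; first by rewrite q0 mul0r msr_eq0_L1.
by rewrite /avg mulrC divfK.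
Qed.

Lemma avgB p u v : L1 u -> L1 v -> avg p (fun x => u x - v x) = avg p u - avg p v.
Proof.
move=> Lu Lv; rewrite /avg -mulrBl -IntB; [|exact: L1_indicM..].
by congr (_ / _); apply: eq_Int => x; rewrite mulrBr.
Qed.

Lemma avgZ p c v : L1 v -> avg p (fun x => c * v x) = c * avg p v.
Proof.
move=> Lv; rewrite /avg mulrA -IntZ; last exact: L1_indicM.
by congr (_ / _); apply: eq_Int => x; rewrite mulrCA.
Qed.

Lemma L1_step l v : L1 (step l v).
Proof.
rewrite /step; apply: L1_sum => q.
by under eq_fun do rewrite mulrC; apply: L1Z.
Qed.
Hint Resolve L1_step : core.

Lemma stepB l u v x : L1 u -> L1 v ->
  step l (fun x => u x - v x) x = step l u x - step l v x.
Proof.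
move=> Lu Lv; rewrite /step -sumrB; apply: eq_bigr => q _.
by rewrite avgB// mulrBr.
Qed.

Lemma Int_step l v : (forall q, q \in l -> leb (bset q.1) = leb (bset q.2)) ->
  L1 v -> Int (step l v) = Int (fun x => (\sum_(q <- l) \1_(bset q.2) x) * v x).
Proof.
move=> lE Lv; rewrite /step Int_sum; last first.
  by move=> q; under eq_fun do rewrite mulrC; apply: L1Z.
under [in RHS]eq_Int do rewrite mulr_suml.
rewrite Int_sum; last by move=> q; exact: L1_indicM.
apply: eq_big_seq => q ql; rewrite -(msr_avg Lv (lE q ql)) -Int_bset mulrC -IntZ//.
by apply: eq_Int => x; rewrite mulrC.
Qed.

Lemma L1_smul l v : (forall x, \sum_(q <- l) \1_(bset q.2) x <= 1 :> R) ->
  L1 v -> L1 (fun x => (\sum_(q <- l) \1_(bset q.2) x) * v x).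
Proof.
move=> l1 Lv; apply: (@L1_mulbdd _ _ _ _ _ _ 1); last exact: Lv.
  by apply: measurable_sum => q; exact: measurable_indic.
by move=> x; rewrite ger0_norm// sumr_ge0.
Qed.

(** Averaging over a box contracts the norm, and the boxes [q.2] that carry
    the averages are disjoint. *)
Lemma step_contraction l v :
  (forall q, q \in l -> leb (bset q.1) = leb (bset q.2)) ->
  (forall x, \sum_(q <- l) \1_(bset q.2) x <= 1 :> R) ->
  L1 v -> Int (fun x => `|step l v x|) <= Int (fun x => `|v x|).
Proof.
move=> lE l1 Lv.
apply: (@le_trans _ _ (Int (step l (fun x => `|v x|)))).
  apply: Int_le; [exact: L1_norm|exact: L1_step|] => x.
  apply: le_trans (ler_norm_sum _ _ _) _; apply: ler_sum => q _.
  rewrite normrM (ger0_norm (_ : 0 <= \1_(bset q.1) x))// ler_wpM2l//.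
  rewrite /avg normrM normfV (ger0_norm (msr_ge0 _)) ler_wpM2r ?invr_ge0 ?msr_ge0//.
  apply: le_trans (Int_abs (L1_indicM (measurable_bset _) Lv)) _.
  rewrite le_eqVlt; apply/orP; left; apply/eqP/eq_Int => y.
  by rewrite normrM (ger0_norm (_ : 0 <= \1_(bset q.2) y)).
rewrite Int_step//; last exact: L1_norm.
apply: Int_le; [by apply: L1_smul => //; exact: L1_norm|exact: L1_norm|].
by move=> x; rewrite ler_piMl.
Qed.

(** The companion boxes may leave [Q], but a point outside [Q] is eventually not
    covered by them; for shifted grids this fails on faces of [Q], whence the
    almost everywhere clause. *)
Record averaging_net Q (l : nat -> seq ((Rn * Rn) * (Rn * Rn))) := AveragingNet {
  net_tiles : forall k x, \sum_(q <- l k) \1_(bset q.1) x = \1_Q x :> R;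
  net_disjoint : forall k x, \sum_(q <- l k) \1_(bset q.2) x <= 1 :> R;
  net_same_measure : forall k q, q \in l k -> leb (bset q.1) = leb (bset q.2);
  net_leaves : {ae leb, forall x, ~ Q x ->
    \forall k \near \oo, \sum_(q <- l k) \1_(bset q.2) x = 0 :> R};
  net_close : forall e : R, 0 < e -> \forall k \near \oo,
    forall q, q \in l k -> forall x y, bset q.1 x -> bset q.2 y -> ball x e y }.

Section convergence.
Variables (Q : set Rn) (l : nat -> seq ((Rn * Rn) * (Rn * Rn))).
Hypothesis (mQ : measurable Q) (netl : averaging_net Q l).

Let err k v := Int (fun x => `|\1_Q x * v x - step (l k) v x|).

Let good v := L1 v /\ err k v @[k --> \oo] --> 0.

Let L1err k v : L1 v -> L1 (fun x => \1_Q x * v x - step (l k) v x).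
Proof. by move=> Lv; apply: L1B => //; exact: L1_indicM. Qed.

Let err_ge0 k v : 0 <= err k v.
Proof. exact: Int_ge0. Qed.

(** By the contraction property, averaging errors depend continuously on the
    function, uniformly in [k]. *)
Let err_perturb k u v : L1 u -> L1 v ->
  err k u <= err k v + 2 * Int (fun x => `|u x - v x|).
Proof.
move=> Lu Lv; have Luv := L1B Lu Lv.
rewrite mulr_natl mulr2n.
have h := step_contraction (@net_same_measure _ _ netl k) (@net_disjoint _ _ netl k) Luv.
apply: le_trans (lerD (lexx _) (lerD (lexx _) h)).
rewrite -IntD; [|exact: L1_norm..].
rewrite -IntD; [|exact/L1_norm/L1err|by apply: L1D; exact: L1_norm].
apply: Int_le; [exact/L1_norm/L1err| |].
  by apply: L1D; [exact/L1_norm/L1err|apply: L1D; exact: L1_norm].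
move=> x; rewrite stepB//.
have -> : \1_Q x * u x - step (l k) u x = (\1_Q x * v x - step (l k) v x) +
  (\1_Q x * (u x - v x) - (step (l k) u x - step (l k) v x)) by ring.
apply: le_trans (ler_normD _ _) _; rewrite lerD2l.
apply: le_trans (ler_normB _ _) _; rewrite lerD2r.
by rewrite normrM ler_piMl// indic_norm_le1.
Qed.

Let good_limit u : L1 u ->
  (forall e, 0 < e -> exists2 v, good v & Int (fun x => `|u x - v x|) <= e) ->
  good u.
Proof.
move=> Lu Hu; split; first exact: Lu.
apply/(cvg0_leP (fun k => err_ge0 k u)) => e e0.
have e4 : 0 < e / 4 by rewrite divr_gt0.
have [v [Lv /(cvg0_leP (fun k => err_ge0 k v))/(_ _ e4) Hv] uv] := Hu _ e4.
apply: filterS Hv => k Hv; have := err_perturb k Lu Lv; move: uv Hv.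
move: (err k u) (err k v) (Int _) => a b c; lra.
Qed.

Let good_0 : good (fun=> 0).
Proof.
split; first exact: L1_0.
have -> : err ^~ (fun=> 0) = fun=> 0.
  apply/funext => k; rewrite /err -[RHS](Int0 (@leb R n)); apply: eq_Int => x.
  rewrite mulr0 sub0r normrN /step big1 ?normr0// => q _.
  by rewrite /avg; under eq_Int do rewrite mulr0; rewrite Int0 mul0r mulr0.
exact: cvg_cst.
Qed.

Let goodZ c v : good v -> good (fun x => c * v x).
Proof.
move=> [Lv cv]; split; first exact: L1Z.
have -> : err ^~ (fun x => c * v x) = fun k => `|c| * err k v.
  apply/funext => k; rewrite /err -IntZ; last exact/L1_norm/L1err.
  apply: eq_Int => x; rewrite -normrM; congr `|_|.
  rewrite mulrBr mulrCA; congr (_ - _); rewrite /step mulr_sumr.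
  by apply: eq_bigr => q _; rewrite avgZ// mulrCA.
exact: cvg0Z.
Qed.

Let goodD u v : good u -> good v -> good (fun x => u x + v x).
Proof.
move=> [Lu cu] [Lv cv]; split; first exact: L1D.
apply: (cvg0_le (b := fun k => err k u + err k v)) => [k|k|].
- exact: err_ge0.
- rewrite /err -IntD; [|exact/L1_norm/L1err..].
  apply: Int_le; [by apply/L1_norm/L1err/L1D|by apply: L1D; exact/L1_norm/L1err|].
  move=> x; apply: le_trans (ler_normD _ _); rewrite le_eqVlt; apply/orP; left.
  apply/eqP; congr `|_|.
  have -> : step (l k) (fun x => u x + v x) x = step (l k) u x + step (l k) v x.
    have := stepB (l k) x (L1D Lu Lv) Lv.
    under [in LHS]eq_fun do rewrite addrK.
    by move=> ->; rewrite subrK.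
  by ring.
- exact: cvg0D.
Qed.

(** For an open set the averages converge from below at each of its points,
    and they do not increase the integral: both together give convergence in
    mean. *)
Let good_open C : open C -> L1 \1_C -> good \1_C.
Proof.
move=> oC LC; split => //.
have mC := measurable_open oC.
(* [b q] marks the boxes that are not inside [C]: [D] is where the averages can
   be smaller than 1 in [C], and [E] is what the companion boxes take from
   outside [Q]. *)
pose S k x : R := \sum_(q <- l k) \1_(bset q.2) x.
pose b q : R := (~~ `[< bset q.2 `<=` C >])%:R.
pose D k x : R := \sum_(q <- l k) \1_(bset q.1) x * (\1_C x * b q).
have mmax a : measurable_fun setT (fun x => Num.max 0 (\1_C x - a) : R).
  apply: measurable_maxr; first exact: measurable_cst.
  by apply: measurable_funB; [exact: measurable_indic|exact: measurable_cst].
have b0 q : 0 <= b q by [].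
have b1 q : b q <= 1 by rewrite /b lern1; case: (~~ _).
pose E k x : R := S k x * \1_C x * (1 - \1_Q x).
have mS k : measurable_fun setT (S k).
  by apply: measurable_sum => q; exact: measurable_indic.
have S0 k x : 0 <= S k x by apply: sumr_ge0.
have ind0 (A : set Rn) x : 0 <= \1_A x :> R by exact: indic_ge0.
have ind1 (A : set Rn) x : \1_A x <= 1 :> R by exact: indic_le1.
have LD k : L1 (D k).
  by apply: L1_sum => q; apply: L1_indicM => //; under eq_fun do rewrite mulrC;
    exact: L1Z.
have D0 k x : 0 <= D k x by apply: sumr_ge0 => q _; rewrite !mulr_ge0.
have cD : Int (D k) @[k --> \oo] --> 0.
  apply: (Int_dct0 LD _ LC).
  - apply: aeW => x.
    have [Cx|Cx] := pselect (C x); last first.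
      rewrite (_ : D ^~ x = fun=> 0); first exact: cvg_cst.
      apply/funext => k; rewrite /D big1// => q _.
      by rewrite [\1_C x]indic_out// mul0r mulr0.
    have /nbhs_ballP[r /= r0 xrC] : nbhs x C by exact: open_nbhs_nbhs.
    apply: (cvg_near_cst); apply: filterS (net_close netl r0) => k Hk.
    rewrite /D big1_seq// => q /andP[_ ql].
    have [qx|qx] := pselect (bset q.1 x); last by rewrite indic_out// mul0r.
    rewrite /b asboolT ?mulr0// => y qy; apply: xrC; exact: Hk ql _ _ qx qy.
  - move=> k x; rewrite ger0_norm; last exact: D0.
    apply: (@le_trans _ _ (\sum_(q <- l k) \1_(bset q.1) x * \1_C x)).
      by apply: ler_sum => q _; rewrite ler_wpM2l// ler_piMr.
    by rewrite -mulr_suml (net_tiles netl) ler_piMl.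
have LE k : L1 (E k).
  rewrite /E; under eq_fun do rewrite mulrAC.
  apply: (@L1_mulbdd _ _ _ _ _ _ 1); last exact: LC.
    apply: measurable_funM; first exact: mS.
    by apply: measurable_funB; [exact: measurable_cst|exact: measurable_indic].
  move=> x; rewrite ger0_norm; last by rewrite mulr_ge0// subr_ge0.
  by rewrite mulr_ile1// ?subr_ge0// ?(net_disjoint netl)// lerBlDr lerDl.
have E0 k x : 0 <= E k x by rewrite !mulr_ge0// subr_ge0.
have cE : Int (E k) @[k --> \oo] --> 0.
  apply: (Int_dct0 LE _ LC).
  - apply: filterS (net_leaves netl) => x lx; apply: cvg_near_cst.
    have [Qx|Qx] := pselect (Q x).
      by apply: nearW => k; rewrite /E [\1_Q x]indic_in// subrr mulr0.
    by apply: filterS (lx Qx) => k Sk; rewrite /E /S Sk !mul0r.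
  - move=> k x; rewrite ger0_norm; last exact: E0.
    rewrite /E -mulrA mulrCA ler_piMr//.
    by rewrite mulr_ile1 ?subr_ge0// ?(net_disjoint netl)// lerBlDr lerDl.
apply: (cvg0_le (b := fun k => 2 * Int (D k) + Int (E k))) => [k|k|].
- exact: err_ge0.
- pose w x := \1_Q x * \1_C x - step (l k) \1_C x.
  have Lw : L1 w by exact: L1err.
  have Lwp : L1 (fun x => Num.max 0 (w x)).
    apply: (@L1_dom _ _ _ _ _ (fun x => `|w x|)).
    - by apply: measurable_maxr; [exact: measurable_cst|exact: (@L1_measurable _ _ _ leb)].
    - exact: L1_norm.
    - move=> x; have [w0|w0] := lerP 0 (w x); first exact: lexx.
      by rewrite normr0.
  have -> : err k \1_C = 2 * Int (fun x => Num.max 0 (w x)) - Int w.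
    rewrite -IntZ// -IntB//; last exact: L1Z.
    apply: eq_Int => x; rewrite -/(w x).
    have [w0|w0] := lerP 0 (w x).
      by rewrite ger0_norm//; ring.
    by rewrite ltr0_norm//; ring.
  apply: lerD.
    rewrite ler_pM2l//.
    have LT q : L1 (fun x => \1_(bset q.1) x * Num.max 0 (\1_C x - avg q.2 \1_C)).
      under eq_fun do rewrite mulrC.
      apply: (@L1_mulbdd _ _ _ _ _ _ (1 + `|avg q.2 \1_C|)); last exact: L1_bset.
        by apply: mmax.
      move=> x; rewrite ger0_norm ?le_max ?lexx// ge_max addr_ge0//=.
      by rewrite lerD// -normrN ler_norm.
    apply: (@le_trans _ _ (Int (fun x => \sum_(q <- l k)
        \1_(bset q.1) x * Num.max 0 (\1_C x - avg q.2 \1_C)))).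
      apply: Int_le => //; first exact: L1_sum.
      move=> x; rewrite ge_max; apply/andP; split.
        by apply: sumr_ge0 => q _; rewrite mulr_ge0// le_max lexx.
      rewrite /w -(net_tiles netl k) mulr_suml /step -sumrB; apply: ler_sum => q _.
      by rewrite -mulrBr ler_wpM2l// le_max lexx orbT.
    rewrite Int_sum// /D Int_sum; last first.
      by move=> q; apply: L1_indicM => //; under eq_fun do rewrite mulrC; exact: L1Z.
    rewrite big_seq [leRHS]big_seq; apply: ler_sum => q ql.
    have a0 : 0 <= avg q.2 \1_C.
      by rewrite /avg divr_ge0 ?msr_ge0//; apply: Int_ge0 => x; rewrite mulr_ge0.
    have mx1 x : Num.max 0 (\1_C x - avg q.2 \1_C) <= \1_C x.
      by rewrite ge_max ind0/= lerBlDr lerDl.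
    have [q0|q0] := eqVneq (msr q.1) 0.
      rewrite [leLHS](@msr_eq0_Int _ _ 1 q0); [|exact: mmax|].
        by apply: Int_ge0 => x; rewrite !mulr_ge0.
      move=> x; rewrite ger0_norm ?le_max ?lexx//.
      exact: le_trans (mx1 x) (ind1 _ _).
    apply: Int_le; first exact: LT.
      by apply: L1_indicM => //; under eq_fun do rewrite mulrC; exact: L1Z.
    move=> x; rewrite ler_wpM2l//.
    rewrite /b; case: asboolP => /= [qC|_]; last by rewrite mulr1.
    rewrite mulr0 (_ : avg q.2 \1_C = 1).
      by rewrite ge_max lexx/= subr_le0.
    have q20 : msr q.2 != 0 by rewrite /msr -(net_same_measure netl ql).
    rewrite /avg (_ : Int _ = msr q.2) ?divff//.
    rewrite -Int_bset; apply: eq_Int => y; rewrite !indicE.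
    case: (boolP (y \in bset q.2)) => [/set_mem/qC yC|_]; last by rewrite mul0r.
    by rewrite mem_set// mulr1.
  rewrite /w IntB//; last exact: L1_indicM.
  rewrite opprB (Int_step (@net_same_measure _ _ netl k))//.
  rewrite -IntB; [|exact: L1_smul (@net_disjoint _ _ netl k) LC|exact: L1_indicM].
  apply: Int_le => //.
    by apply: L1B; [exact: L1_smul (@net_disjoint _ _ netl k) LC|exact: L1_indicM].
  move=> x; rewrite -/(S k x) /E.
  have := net_disjoint netl k x; rewrite -/(S k x) => Sk1.
  rewrite -mulrBl mulrAC ler_wpM2r//.
  by rewrite indicE; case: (x \in Q) => /=; lra.
- by apply: cvg0D; [exact: cvg0Z|exact: cE].
Qed.

Let good_measurable A : measurable A -> (leb A < +oo)%E -> good \1_A.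
Proof.
move=> mA Aoo; apply: good_limit; first exact: L1_indic.
move=> e e0; have [C oC [AC Ce]] := outer_regular e0 Aoo.
have mC := measurable_open oC.
have Coo : (leb C < +oo)%E.
  by apply: le_lt_trans Ce _; rewrite lte_add_pinfty// ltry.
exists \1_C; first by apply: good_open => //; exact: L1_indic.
have -> : Int (fun x => `|\1_A x - \1_C x|) = Int (fun x => \1_C x - \1_A x).
  apply: eq_Int => x; rewrite distrC ger0_norm// subr_ge0 !indicE ler_nat.
  by case: (boolP (x \in A)) => // /set_mem/AC Cx; rewrite mem_set.
rewrite IntB; [|exact: L1_indic..].
rewrite !Int_indic// lerBlDl -lee_fin EFinD !fineK ?ge0_fin_numE//.
Qed.

Import HBSimple.

(** The functions with the property form a linear space that is closed in mean
    and contains the indicators of open sets; by outer regularity it contains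
    those of measurable sets, hence simple functions, hence everything. *)
Theorem step_cvg_L1 v : L1 v ->
  Int (fun x => `|\1_Q x * v x - step (l k) v x|) @[k --> \oo] --> 0.
Proof.
move=> Lv; suff [] : good v by [].
apply: good_limit => // e e0.
have [g [Lg _ cg]] := approximation_sfun_integrable measurableT ((L1P _ _).1 Lv).
have [N HN] : exists N, (\int[leb]_x `|(EFin \o v) x - (g N x)%:E| <= e%:E)%E.
  have e0' : (0 < e%:E)%E by rewrite lte_fin.
  have /fine_cvgP[fg /cvgrPdist_le/(_ _ e0) dg] := cg.
  near \oo => N; exists N.
  rewrite -[leLHS]fineK; last by near: N.
  rewrite lee_fin; have : `|0 - fine (\int[leb]_x `|(EFin \o v) x - (g N x)%:E|)%E| <= e.
    by near: N.
  by rewrite sub0r normrN; apply: le_trans; rewrite ler_norm.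
exists (g N); last first.
  rewrite -lee_fin; apply: le_trans HN; rewrite EFin_Int//.
  by apply/L1_norm/L1B => //; apply/L1P; exact: Lg.
rewrite (_ : (g N : Rn -> R) = fun x => \sum_(y <- fset_set (range (g N)))
    (y * \1_(g N @^-1` [set y]) x)); last first.
  by apply/funext => x; rewrite fimfunE fsbig_finite.
elim: (enum_fset (fset_set _)) => [|y r IH].
  by under eq_fun do rewrite big_nil; exact: good_0.
under eq_fun do rewrite big_cons; apply: goodD; last exact: IH.
have [->|y0] := eqVneq y 0.
  by under eq_fun do rewrite mul0r; exact: good_0.
have my : measurable (g N @^-1` [set y]) by exact: measurable_funPTI.
apply: goodZ; apply: good_measurable => //.
have Ly : L1 \1_(g N @^-1` [set y]).
  apply: (@L1_dom _ _ _ _ _ (fun x => `|y|^-1 * `|g N x|)) => //.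
    by apply: L1Z; apply: L1_norm; apply/L1P; exact: Lg.
  move=> x; rewrite ger0_norm// indicE.
  case: (boolP (x \in _)) => [/set_mem /= ->|_].
    by rewrite mulVf ?normr_eq0.
  by rewrite mulr_ge0// invr_ge0.
have := integrable_lty measurableT ((L1P _ _).1 Ly).
by rewrite integral_indic// setIT.
Unshelve. all: by end_near. Qed.

End convergence.

End averaging.
#[export] Hint Resolve measurable_bset L1_bset L1_step : core.

Opaque msr avg step.

(** * Continuously differentiable tents *)

Section positive_part_squared.
Context {R : realType}.
Implicit Types s t h e : R.

Definition pos t : R := Num.max 0 t.

Definition possq t : R := pos t ^+ 2.

Lemma pos_ge0 t : 0 <= pos t.
Proof. by rewrite /pos le_max lexx. Qed.

Lemma pos_le0 t : t <= 0 -> pos t = 0.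
Proof. by rewrite /pos => /max_idPl. Qed.

Lemma pos_id t : 0 <= t -> pos t = t.
Proof. by rewrite /pos => /max_idPr. Qed.

Lemma continuous_pos : continuous pos.
Proof.
move=> t; apply: (@continuous_max _ _ (cst 0) id); first exact: cvg_cst.
exact: cvg_id.
Qed.

Lemma is_derive_possq t : is_derive t 1 possq (2 * pos t).
Proof.
have H : h^-1 *: ((possq \o shift t) (h *: 1) - possq t) @[h --> 0^'] --> 2 * pos t.
  apply/cvgrPdist_le => e e0.
  have : \forall h \near (0:R)^', `|h| <= e /\ h != 0.
    near=> h; split; last by near: h; exact: nbhs_dnbhs_neq.
    near: h; apply: dnbhs0_le => //.
  apply: filterS => h [he h0] /=.
  apply: le_trans he; rewrite [h%:A]mulr1 /possq.
  have -> : 2 * pos t - h^-1 *: (pos (h + t) ^+ 2 - pos t ^+ 2) =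
      h^-1 * (2 * pos t * h - (pos (h + t) ^+ 2 - pos t ^+ 2)).
    by rewrite mulrBr [_ * (2 * _ * _)]mulrC mulfK.
  have hh : `|h| * `|h| = h ^+ 2 by rewrite -normrM -expr2 ger0_norm ?sqr_ge0.
  rewrite normrM normfV ler_pdivrMl ?normr_gt0// hh.
  rewrite ler_norml; apply/andP; split.
    have [t0|t0] := lerP t 0; have [s0|s0] := lerP (h + t) 0;
      rewrite ?(pos_le0 t0) ?(pos_le0 s0) ?(pos_id (ltW t0)) ?(pos_id (ltW s0)); nra.
  have [t0|t0] := lerP t 0; have [s0|s0] := lerP (h + t) 0;
    rewrite ?(pos_le0 t0) ?(pos_le0 s0) ?(pos_id (ltW t0)) ?(pos_id (ltW s0)); nra.
by apply: DeriveDef; [apply/cvg_ex; eexists; exact: H|exact/cvg_lim/H].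
Unshelve. all: by end_near. Qed.

End positive_part_squared.

Section C1_functions.
Context {R : realType} {n : nat}.
Local Notation Rn := ('rV[R]_n.+1).
Implicit Types (f g : Rn -> R) (x v : Rn) (i j : 'I_n.+1).

Definition C1 f := (forall x, differentiable f x) /\ forall v, continuous ('D_v f).

Lemma C1_continuous f : C1 f -> continuous f.
Proof. by move=> [df _] x; exact: (differentiable_continuous (df x)). Qed.

Lemma C1_cst (c : R) : C1 (cst c).
Proof.
split=> [x|v x]; first exact: differentiable_cst.
rewrite (_ : 'D_v _ = cst 0); first by apply: cst_continuous.
by apply/funext => y; rewrite derive_cst.
Qed.

Lemma derive_coord j v x : 'D_v (fun y : Rn => y 0 j) x = v 0 j.
Proof.
rewrite deriveE; last exact: differentiable_coord.
have @f : {linear Rn -> R}.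
  by exists (fun y : Rn => y 0 j); do 2![eexists]; do ?[constructor];
     rewrite ?mxE// => ? *; rewrite ?mxE//; move=> ?; rewrite !mxE.
by rewrite (_ : (fun _ => _) = f)// diff_lin//; exact: coord_continuous.
Qed.

Lemma C1_coord j : C1 (fun x => x 0 j).
Proof.
split=> [x|v x]; first exact: differentiable_coord.
rewrite (_ : 'D_v _ = cst (v 0 j)); first by apply: cst_continuous.
by apply/funext => y; rewrite derive_coord.
Qed.

Lemma C1D f g : C1 f -> C1 g -> C1 (fun x => f x + g x).
Proof.
move=> [df cf] [dg cg]; split=> [x|v x]; first exact: differentiableD.
rewrite (_ : 'D_v _ = fun y => 'D_v f y + 'D_v g y).
  exact: (continuousD (cf v x) (cg v x)).
by apply/funext => y; rewrite deriveD//; exact: diff_derivable.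
Qed.

Lemma C1M f g : C1 f -> C1 g -> C1 (fun x => f x * g x).
Proof.
move=> Cf Cg; have [[df cf] [dg cg]] := (Cf, Cg).
split=> [x|v x]; first exact: differentiableM.
rewrite (_ : 'D_v _ = fun y => f y * 'D_v g y + g y * 'D_v f y).
  have c1 := continuousM (@C1_continuous _ Cf x) (cg v x).
  have c2 := continuousM (@C1_continuous _ Cg x) (cf v x).
  exact: (continuousD c1 c2).
by apply/funext => y; rewrite deriveM//; exact: diff_derivable.
Qed.

Lemma C1Z (c : R) f : C1 f -> C1 (fun x => c * f x).
Proof. by move=> Cf; apply: (C1M (C1_cst c)). Qed.

Lemma C1N f : C1 f -> C1 (fun x => - f x).
Proof.
move=> /(C1Z (-1)); rewrite (_ : (fun _ => _) = fun x => - f x)//.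
by apply/funext => x; rewrite mulN1r.
Qed.

Lemma C1_derivable f x v : C1 f -> derivable f x v.
Proof. by move=> [df _]; apply: diff_derivable; exact: df. Qed.

Lemma derive_C1D f g x v : C1 f -> C1 g ->
  'D_v (fun x => f x + g x) x = 'D_v f x + 'D_v g x.
Proof. by move=> Cf Cg; rewrite deriveD//; exact: C1_derivable. Qed.

Lemma derive_C1M f g x v : C1 f -> C1 g ->
  'D_v (fun x => f x * g x) x = f x * 'D_v g x + g x * 'D_v f x.
Proof. by move=> Cf Cg; rewrite deriveM//; exact: C1_derivable. Qed.

Lemma derive_C1Z (c : R) f x v : C1 f ->
  'D_v (fun x => c * f x) x = c * 'D_v f x.
Proof.
by move=> Cf; rewrite (derive_C1M _ _ (C1_cst c) Cf) derive_cst mulr0 addr0.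
Qed.

Lemma C1_prod (J : Type) (s : seq J) (f : J -> Rn -> R) :
  (forall a, C1 (f a)) -> C1 (fun x => \prod_(a <- s) f a x).
Proof.
move=> Cf; elim: s => [|a s IH].
  by under eq_fun do rewrite big_nil; exact: C1_cst.
by under eq_fun do rewrite big_cons; exact: C1M.
Qed.

Lemma C1_sum (J : Type) (s : seq J) (f : J -> Rn -> R) :
  (forall a, C1 (f a)) -> C1 (fun x => \sum_(a <- s) f a x).
Proof.
move=> Cf; elim: s => [|a s IH].
  by under eq_fun do rewrite big_nil; exact: C1_cst.
by under eq_fun do rewrite big_cons; exact: C1D.
Qed.

Lemma derive_sumC1 (J : Type) (s : seq J) (f : J -> Rn -> R) v x :
  (forall a, C1 (f a)) ->
  'D_v (fun x => \sum_(a <- s) f a x) x = \sum_(a <- s) 'D_v (f a) x.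
Proof.
move=> Cf; elim: s => [|a s IH].
  by under eq_fun do rewrite big_nil; rewrite big_nil derive_cst.
under eq_fun do rewrite big_cons; rewrite big_cons -IH deriveD//.
  by apply: diff_derivable; exact: (Cf a).1.
by apply: diff_derivable; exact: (C1_sum s Cf).1.
Qed.

Let differentiable_possq (t : R) : differentiable possq t.
Proof. by apply/derivable1_diffP; have [] := is_derive_possq t. Qed.

Lemma derive_possq f x v : differentiable f x ->
  'D_v (fun y => possq (f y)) x = 2 * pos (f x) * 'D_v f x.
Proof.
move=> df; rewrite deriveE; last exact: differentiable_comp.
rewrite (@diff_comp _ _ _ _ f possq)//= diff1E// derive1E.
have [_ ->] := is_derive_possq (f x); rewrite -deriveE//.
by rewrite [LHS]mulrC.
Qed.

Lemma C1_possq f : C1 f -> C1 (fun x => possq (f x)).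
Proof.
move=> Cf; have [df cf] := Cf; split=> [x|v x]; first exact: differentiable_comp.
rewrite (_ : 'D_v _ = fun y => 2 * pos (f y) * 'D_v f y).
  have cpf : {for x, continuous (pos \o f)}.
    apply: continuous_comp; [exact: (C1_continuous Cf)|exact: continuous_pos].
  have c2 := continuousM (@cst_continuous Rn R 2 x) cpf.
  exact: (continuousM c2 (cf v x)).
by apply/funext => y; rewrite derive_possq.
Qed.

Lemma derive_invariant f x v : (forall h : R, f (h *: v + x) = f x) -> 'D_v f x = 0.
Proof.
move=> fv; rewrite /derive [X in lim (X @ _)](_ : _ = cst 0); last first.
  by apply/funext => h /=; rewrite fv subrr scaler0.
exact: lim_cst.
Qed.

End C1_functions.

Section ramp.
Context {R : realType}.
Implicit Types s t e : R.

(** [ramp e] is a C^1 approximation, within [e], of the positive part. *)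
Definition ramp e s : R := (2 * e)^-1 * (possq s - possq (s - e)).

Definition ramp' e s : R := e^-1 * (pos s - pos (s - e)).

Lemma ramp_le0 e s : 0 < e -> s <= 0 -> ramp e s = 0.
Proof.
move=> e0 s0; rewrite /ramp /possq !pos_le0//; last lra.
by rewrite subrr mulr0.
Qed.

Lemma ramp_ge e s : 0 < e -> e <= s -> ramp e s = s - e / 2.
Proof.
move=> e0 es; rewrite /ramp /possq !pos_id; [|lra..].
by have := lt0r_neq0 e0 => he; field.
Qed.

Lemma ramp_pos e s : 0 < e -> `|ramp e s - pos s| <= e / 2.
Proof.
move=> e0; have [s0|s0] := lerP s 0.
  by rewrite ramp_le0// pos_le0// subrr normr0; lra.
have [es|se] := lerP e s.
  rewrite ramp_ge// pos_id; last lra.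
  by rewrite ler_norml; apply/andP; split; lra.
rewrite /ramp /possq (pos_le0 (_ : s - e <= 0)); last lra.
rewrite (pos_id (ltW s0)) expr0n/= subr0.
have -> : (2 * e)^-1 * s ^+ 2 - s = (2 * e)^-1 * (s ^+ 2 - 2 * e * s).
  by rewrite mulrBr mulKf// mulf_neq0// gt_eqF.
have e20 : 0 < 2 * e by rewrite mulr_gt0.
rewrite normrM normfV (gtr0_norm e20) ler_pdivrMl//.
by rewrite ler_norml; apply/andP; split; nra.
Qed.

Lemma ramp'_le0 e s : 0 < e -> s <= 0 -> ramp' e s = 0.
Proof.
by move=> e0 s0; rewrite /ramp' !pos_le0//; [rewrite subrr mulr0|lra].
Qed.

Lemma ramp'_ge e s : 0 < e -> e <= s -> ramp' e s = 1.
Proof.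
move=> e0 es; rewrite /ramp' !pos_id; [|lra..].
by rewrite opprB addrCA subrr addr0 mulVf// gt_eqF.
Qed.

Lemma ramp'_01 e s : 0 < e -> 0 <= ramp' e s <= 1.
Proof.
move=> e0; have [s0|s0] := lerP s 0; first by rewrite ramp'_le0// lexx ler01.
have [es|se] := lerP e s; first by rewrite ramp'_ge// lexx ler01.
rewrite /ramp' (pos_le0 (_ : s - e <= 0)); last lra.
rewrite subr0 (pos_id (ltW s0)); apply/andP; split.
  by rewrite mulr_ge0// ?invr_ge0; exact: ltW.
by rewrite mulrC ler_pdivrMr// mul1r ltW.
Qed.

(** The hat on the interval from [a] to [b], with slopes 1 and -1, is a second
    difference of positive parts. In its C^1 approximation [shat] the last two
    ramps start early, by [e / 2] and [e], so that the support is not enlarged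
    and the three ramps still cancel beyond [b]. *)
Definition hat (a b : R) s : R := pos (s - a) - 2 * pos (s - (a + b) / 2) + pos (s - b).

Definition shat e (a b : R) s : R :=
  ramp e (s - a) - 2 * ramp e (s - (a + b) / 2 + e / 2) + ramp e (s - b + e).

Definition shat' e (a b : R) s : R :=
  ramp' e (s - a) - 2 * ramp' e (s - (a + b) / 2 + e / 2) + ramp' e (s - b + e).

Lemma hatE (a b s : R) : a <= b -> hat a b s =
  if (a < s) && (s <= b) then Num.min (s - a) (b - s) else 0.
Proof.
move=> ab; rewrite /hat minEle /pos !maxEle.
by do ![case: ifP => //= ?]; lra.
Qed.

Lemma pos_lip s t : `|pos s - pos t| <= `|s - t|.
Proof.
have := ler_norm (s - t); have := ler_norm (- (s - t)); rewrite normrN.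
move: `|s - t| => m h1 h2.
have [s0|s0] := lerP s 0; have [t0|t0] := lerP t 0;
  rewrite ?(pos_le0 s0) ?(pos_le0 t0) ?(pos_id (ltW s0)) ?(pos_id (ltW t0));
  rewrite ler_norml; apply/andP; split; lra.
Qed.

Section shat_facts.
Variables (e a b : R).
Hypotheses (e0 : 0 < e) (eab : 2 * e <= b - a).

Lemma shat_out s : ~~ (a < s < b) -> shat e a b s = 0.
Proof.
have [h0 hab] := (e0, eab).
rewrite negb_and -!leNgt => /orP[sa|bs]; rewrite /shat.
  by rewrite !ramp_le0//; lra.
by rewrite !ramp_ge//; lra.
Qed.

Lemma shat'_out s : ~~ (a < s < b) -> shat' e a b s = 0.
Proof.
have [h0 hab] := (e0, eab).
rewrite negb_and -!leNgt => /orP[sa|bs]; rewrite /shat'.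
  by rewrite !ramp'_le0//; lra.
by rewrite !ramp'_ge//; lra.
Qed.

Lemma shat'_le2 s : `|shat' e a b s| <= 2.
Proof.
have h0 := e0.
have /andP[h1 h2] := ramp'_01 (s - a) e0.
have /andP[h3 h4] := ramp'_01 (s - (a + b) / 2 + e / 2) e0.
have /andP[h5 h6] := ramp'_01 (s - b + e) e0.
by rewrite /shat' ler_norml; apply/andP; split; lra.
Qed.

Lemma shat_hat s : `|shat e a b s - hat a b s| <= 4 * e.
Proof.
have [h0 hab] := (e0, eab).
have := ramp_pos (s - a) e0.
have := ramp_pos (s - (a + b) / 2 + e / 2) e0.
have := ramp_pos (s - b + e) e0.
have := pos_lip (s - (a + b) / 2 + e / 2) (s - (a + b) / 2).
have := pos_lip (s - b + e) (s - b).
have -> : s - b + e - (s - b) = e by ring.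
have -> : s - (a + b) / 2 + e / 2 - (s - (a + b) / 2) = e / 2 by ring.
rewrite /shat /hat (gtr0_norm e0) (gtr0_norm (_ : 0 < e / 2)); last lra.
rewrite !ler_norml => /andP[? ?] /andP[? ?] /andP[? ?] /andP[? ?] /andP[? ?].
by apply/andP; split; lra.
Qed.

Lemma shat_le s : `|shat e a b s| <= 3 * (b - a).
Proof.
have [h0 hab] := (e0, eab).
have h := shat_hat s.
have : `|hat a b s| <= b - a.
  rewrite hatE; last lra.
  case: ifP => [/andP[h1 h2]|_]; last by rewrite normr0; lra.
  rewrite minEle; case: ifP => _; rewrite ler_norml; apply/andP; split; lra.
move: h; rewrite !ler_norml => /andP[? ?] /andP[? ?].
by apply/andP; split; lra.
Qed.

End shat_facts.

Lemma shat'_cvg (e : nat -> R) (a b s : R) : a < b -> (forall k, 0 < e k) ->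
  e k @[k --> \oo] --> 0 -> s != a -> s != b -> s != (a + b) / 2 ->
  shat' (e k) a b s @[k --> \oo] -->
    ((a < s <= (a + b) / 2)%R%:R - ((a + b) / 2 < s <= b)%R%:R : R).
Proof.
move=> ab e0 ec sa sb sc.
pose m : R := Num.min `|s - a| (Num.min `|s - b| `|s - (a + b) / 2|).
have m0 : 0 < m by rewrite !lt_min !normr_gt0 !subr_eq0 sa sb sc.
have /cvgrPdist_lt/(_ _ m0) := ec.
move=> H; apply: cvg_near_cst; apply: filterS H => k.
rewrite sub0r normrN gtr0_norm// !lt_min => /andP[ha /andP[hb hc]].
have ek := e0 k; rewrite /shat'.
have A : ramp' (e k) (s - a) = (a < s)%R%:R.
  case: ltgtP sa => // h _.
    by rewrite ramp'_ge//; move: ha; rewrite gtr0_norm ?subr_gt0//; lra.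
  by rewrite ramp'_le0//; lra.
have B : ramp' (e k) (s - b + e k) = (b < s)%R%:R.
  case: ltgtP sb => // h _.
    by rewrite ramp'_ge//; lra.
  by rewrite ramp'_le0//; move: hb; rewrite ltr0_norm ?subr_lt0//; lra.
have C : ramp' (e k) (s - (a + b) / 2 + e k / 2) = ((a + b) / 2 < s)%R%:R.
  case: ltgtP sc => // h _.
    by rewrite ramp'_ge//; move: hc; rewrite gtr0_norm ?subr_gt0//; lra.
  by rewrite ramp'_le0//; move: hc; rewrite ltr0_norm ?subr_lt0//; lra.
rewrite A B C.
by case: (ltP a s) => h1; case: (ltP b s) => h2; case: (ltP ((a + b) / 2) s) => h3 /=; lra.
Qed.

Lemma shat_cvg (e : nat -> R) (a b s : R) : (forall k, 0 < e k) ->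
  (forall k, 2 * e k <= b - a) ->
  e k @[k --> \oo] --> 0 -> shat (e k) a b s @[k --> \oo] --> hat a b s.
Proof.
move=> e0 eab ec; apply/cvgrPdist_le => d d0.
have d4 : 0 < d / 4 by rewrite divr_gt0.
have /cvgrPdist_le/(_ _ d4) := ec.
apply: filterS => k; rewrite sub0r normrN gtr0_norm// => ek.
by rewrite distrC; have := shat_hat (e0 k) (eab k) s; lra.
Qed.

(** Squaring the positive part twice gives a C^1 transition from 0, for
    [w <= 0], to 1, for [w >= 1]. *)
Definition bump (w : R) : R := 1 - possq (1 - possq w).

Lemma bump_le0 w : w <= 0 -> bump w = 0.
Proof.
move=> w0; rewrite /bump /possq (pos_le0 w0) expr0n subr0 pos_id// expr1n.
by rewrite subrr.
Qed.

Lemma bump_ge1 w : 1 <= w -> bump w = 1.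
Proof.
move=> w1; rewrite /bump /possq (pos_id (_ : 0 <= w)); last lra.
by rewrite pos_le0 ?expr0n ?subr0//; nra.
Qed.

Lemma bump_01 w : 0 <= bump w <= 1.
Proof.
rewrite /bump; apply/andP; split; last by rewrite lerBlDr lerDl sqr_ge0.
rewrite subr_ge0 /possq.
have : 0 <= pos w ^+ 2 by rewrite sqr_ge0.
move: (pos w ^+ 2) => u u0; have [u1|u1] := lerP u 1.
  by rewrite pos_id; nra.
by rewrite pos_le0 ?expr0n//; lra.
Qed.

Lemma bump_cvg (w : R) : 0 < w -> bump (k%:R * w) @[k --> \oo] --> (1 : R).
Proof.
move=> w0; apply: cvg_near_cst; exists (Num.truncn w^-1).+1 => // k /= hk.
rewrite bump_ge1// -ler_pdivrMr// div1r.
apply: le_trans (_ : (Num.truncn w^-1).+1%:R <= _); last by rewrite ler_nat.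
exact/ltW/truncnS_gt.
Qed.

End ramp.

Section tent_functions.
Context {R : realType} {n : nat}.
Local Notation Rn := ('rV[R]_n.+1).
Implicit Types (p : Rn * Rn) (x v : Rn) (i j : 'I_n.+1).

Definition mid p i : R := (p.1 0 i + p.2 0 i) / 2.
Definition lo i p : Rn * Rn := (p.1, upd p.2 i (mid p i)).
Definition hi i p : Rn * Rn := (upd p.1 i (mid p i), p.2).

(** The tent over the box [p]: a hat in the [i]-th coordinate, constant in the
    other ones. Its [i]-th derivative is the difference of the indicators of
    the two halves of [p]. *)
Definition tent p i x : R := \1_(bset p) x * hat (p.1 0 i) (p.2 0 i) (x 0 i).

Section smooth_tent.
Variables (p : Rn * Rn) (i : 'I_n.+1).
Hypothesis vp : valid p.

Let e k : R := (p.2 0 i - p.1 0 i) / 2 / k.+1%:R.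

Let len : 0 < p.2 0 i - p.1 0 i. Proof. by rewrite subr_gt0; exact: vp. Qed.

Let e0 k : 0 < e k. Proof. by rewrite !divr_gt0. Qed.

Let e2 k : 2 * e k <= p.2 0 i - p.1 0 i.
Proof.
rewrite /e -[leRHS](divfK (_ : 2 != 0 :> R))// mulrC ler_pM2r//.
rewrite ler_pdivrMr// ler_peMr ?ler1n//.
by rewrite divr_ge0// ltW.
Qed.

Let ecvg : e k @[k --> \oo] --> 0.
Proof.
by apply: cvg0Z; exact: cvg_harmonic.
Qed.

(* Positive exactly over the open cross-section of [p] transverse to direction [i]. *)
Let w x : R := \prod_(j | j != i) (possq (x 0 j - p.1 0 j) * possq (p.2 0 j - x 0 j)).

(** The cut-off factor tends to the indicator of the open cross-section of [p]
    and is constant in direction [i], so that it comes out of the [i]-th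
    derivative. *)
Definition smooth_tent k x : R :=
  shat (e k) (p.1 0 i) (p.2 0 i) (x 0 i) * bump (k%:R * w x).

Let C1_shift j (c : R) : C1 (fun x : Rn => x 0 j + c).
Proof. by apply: C1D; [exact: C1_coord|exact: C1_cst]. Qed.

Let C1_ramp d j (c : R) : C1 (fun x : Rn => ramp d (x 0 j + c)).
Proof.
apply/C1Z/C1D; first exact/C1_possq/C1_shift.
apply/C1N/C1_possq; rewrite (_ : (fun _ => _) = fun x => x 0 j + (c - d)).
  exact: C1_shift.
by apply/funext => x; rewrite addrA.
Qed.

Let derive_ramp d j (c : R) v x :
  'D_v (fun x : Rn => ramp d (x 0 j + c)) x = ramp' d (x 0 j + c) * v 0 j.
Proof.
have Cs c' := C1_possq (C1_shift j c').
have Ds c' : 'D_v (fun x : Rn => possq (x 0 j + c')) x = 2 * pos (x 0 j + c') * v 0 j.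
  rewrite derive_possq; last exact: (C1_shift _ _).1.
  by rewrite (derive_C1D _ _ (C1_coord j) (C1_cst c')) derive_coord derive_cst addr0.
rewrite (_ : (fun _ => _) = fun x : Rn =>
    (2 * d)^-1 * (possq (x 0 j + c) + -1 * possq (x 0 j + (c - d)))); last first.
  by apply/funext => y; rewrite /ramp mulN1r addrA.
rewrite derive_C1Z; last by apply: C1D; [exact: Cs|exact/C1Z/Cs].
rewrite (derive_C1D _ _ (Cs c) (C1Z (-1) (Cs (c - d)))).
rewrite derive_C1Z; last exact: Cs.
rewrite !Ds /ramp' -addrA invfM.
have two : (2 : R) * 2^-1 = 1 by rewrite divff.
transitivity ((2 * 2^-1) * d^-1 * (pos (x 0 j + c) - pos (x 0 j + (c - d))) * v 0 j).
  by ring.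
by rewrite two mul1r.
Qed.

Let C1_w : C1 w.
Proof.
rewrite /w; under eq_fun do rewrite -big_filter; apply: C1_prod => j.
apply: C1M; first exact/C1_possq/C1_shift.
rewrite (_ : (fun _ => _) = fun x => possq (-1 * x 0 j + p.2 0 j)).
  by apply/C1_possq/C1D; [exact/C1Z/C1_coord|exact: C1_cst].
by apply/funext => x; rewrite mulN1r addrC.
Qed.

Let C1_bump k : C1 (fun x => bump (k%:R * w x)).
Proof.
apply: C1D; first exact: C1_cst.
apply/C1N/C1_possq/C1D; first exact: C1_cst.
exact/C1N/C1_possq/C1Z/C1_w.
Qed.

Let shatE d : (fun x : Rn => shat d (p.1 0 i) (p.2 0 i) (x 0 i)) =
  fun x => ramp d (x 0 i + - p.1 0 i) +
    (-2 * ramp d (x 0 i + (- ((p.1 0 i + p.2 0 i) / 2) + d / 2)) +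
    ramp d (x 0 i + (- p.2 0 i + d))).
Proof. by apply/funext => x; rewrite /shat !addrA mulNr. Qed.

Let C1_shat d : C1 (fun x : Rn => shat d (p.1 0 i) (p.2 0 i) (x 0 i)).
Proof.
rewrite shatE; apply: C1D; first exact: C1_ramp.
by apply: C1D; [apply: C1Z; exact: C1_ramp|exact: C1_ramp].
Qed.

Let derive_shat d v x :
  'D_v (fun x : Rn => shat d (p.1 0 i) (p.2 0 i) (x 0 i)) x =
  shat' d (p.1 0 i) (p.2 0 i) (x 0 i) * v 0 i.
Proof.
rewrite shatE derive_C1D; [|exact: C1_ramp|]; last first.
  by apply: C1D; [apply: C1Z; exact: C1_ramp|exact: C1_ramp].
rewrite derive_C1D; [|apply: C1Z; exact: C1_ramp|exact: C1_ramp].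
rewrite (derive_C1Z (-2)); last exact: C1_ramp.
rewrite !derive_ramp /shat' !addrA.
by ring.
Qed.

Lemma C1_smooth_tent k : C1 (smooth_tent k).
Proof. by apply: C1M; [exact: C1_shat|exact: C1_bump]. Qed.

Let w_ge0 x : 0 <= w x.
Proof. by apply: prodr_ge0 => j _; rewrite mulr_ge0// sqr_ge0. Qed.

Let w_gt0 x : 0 < w x <-> forall j, j != i -> p.1 0 j < x 0 j < p.2 0 j.
Proof.
split.
  move=> /lt0r_neq0 + j ji; rewrite /w (bigD1 j)//= mulf_eq0 negb_or => /andP[+ _].
  rewrite mulf_eq0 negb_or => /andP[h1 h2]; apply/andP; split.
    rewrite ltNge; apply: contraNN h1 => h; rewrite /possq pos_le0 ?expr0n//.
    by rewrite subr_le0.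
  rewrite ltNge; apply: contraNN h2 => h; rewrite /possq pos_le0 ?expr0n//.
  by rewrite subr_le0.
move=> H; apply: prodr_gt0 => j ji; have /andP[h1 h2] := H j ji.
by rewrite mulr_gt0// exprn_gt0// pos_id ?subr_gt0// subr_ge0 ltW.
Qed.

Let bump_neq0 k x : bump (k%:R * w x) != 0 -> 0 < w x.
Proof.
by rewrite lt_def w_ge0 andbT; apply: contraNN => /eqP ->; rewrite mulr0 bump_le0.
Qed.

Let bset_interior x : (forall j, j != i -> p.1 0 j < x 0 j < p.2 0 j) ->
  p.1 0 i < x 0 i < p.2 0 i -> bset p x.
Proof.
move=> H1 H2 j; have [->|ji] := eqVneq j i.
  by have /andP[-> /ltW ->] := H2.
by have /andP[-> /ltW ->] := H1 j ji.
Qed.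

Lemma smooth_tent_support k x : smooth_tent k x != 0 -> bset p x.
Proof.
rewrite mulf_eq0 negb_or => /andP[h1 /bump_neq0/w_gt0 h2].
apply: bset_interior h2 _; apply: contraNT h1 => h.
by rewrite (shat_out (e0 k) (e2 k) h).
Qed.

Lemma smooth_tent_le k x :
  `|smooth_tent k x| <= 3 * (p.2 0 i - p.1 0 i) * \1_(bset p) x.
Proof.
have [h|/smooth_tent_support h] := eqVneq (smooth_tent k x) 0.
  by rewrite h normr0 !mulr_ge0// ltW.
rewrite indic_in// mulr1 normrM -[leRHS]mulr1; apply: ler_pM => //.
  exact: shat_le (e0 k) (e2 k) _.
by have /andP[h1 h2] := bump_01 (k%:R * w x); rewrite ger0_norm.
Qed.

Lemma derive_smooth_tent k x : 'D_(evec i) (smooth_tent k) x =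
  shat' (e k) (p.1 0 i) (p.2 0 i) (x 0 i) * bump (k%:R * w x).
Proof.
rewrite /smooth_tent (derive_C1M _ _ (C1_shat (e k)) (C1_bump k)) derive_shat.
rewrite derive_invariant ?mulr0 ?add0r.
  by rewrite !mxE !eqxx mulr1 mulrC.
move=> h; congr bump; congr (_ * _); apply: eq_bigr => j ji.
by rewrite !mxE eqxx (negbTE ji)/= mulr0 add0r.
Qed.

Lemma derive_smooth_tent_le k x :
  `|'D_(evec i) (smooth_tent k) x| <= 2 * \1_(bset p) x.
Proof.
rewrite derive_smooth_tent.
have [h|] := eqVneq (shat' (e k) (p.1 0 i) (p.2 0 i) (x 0 i) * bump (k%:R * w x)) 0.
  by rewrite h normr0 mulr_ge0.
rewrite mulf_eq0 negb_or => /andP[h1 /bump_neq0/w_gt0 h2].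
rewrite indic_in; last first.
  apply: bset_interior h2 _; apply: contraNT h1 => h.
  by rewrite (shat'_out (e0 k) (e2 k) h).
rewrite normrM; apply: ler_pM => //; first exact: shat'_le2 (e0 k) _.
by have /andP[h3 h4] := bump_01 (k%:R * w x); rewrite ger0_norm.
Qed.

Let generic x := [/\ forall j, x 0 j != p.1 0 j, forall j, x 0 j != p.2 0 j &
  x 0 i != mid p i].

Let ae_generic : {ae leb, forall x, generic x}.
Proof.
have H1 : {ae leb, forall x : Rn, forall j, x 0 j != p.1 0 j}.
  by apply: filter_forall => j; exact: ae_coord_neq.
have H2 : {ae leb, forall x : Rn, forall j, x 0 j != p.2 0 j}.
  by apply: filter_forall => j; exact: ae_coord_neq.
by apply: filterS3 H1 H2 (ae_coord_neq i (mid p i)) => x h1 h2 h3; split.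
Qed.

(** Off the faces of [p], the half-open box and its interior agree. *)
Let dichotomy x : generic x ->
  (forall j, j != i -> p.1 0 j < x 0 j < p.2 0 j) \/
  (w x = 0 /\ exists2 j, j != i & ~~ (p.1 0 j < x 0 j <= p.2 0 j)).
Proof.
move=> [g1 g2 g3].
have [/w_gt0|w0] := pselect (0 < w x); [by left|right].
split; first by apply/eqP; rewrite eq_le w_ge0 andbT leNgt; apply/negP.
apply: contrapT => H; apply/w0/w_gt0 => j ji.
have /andP[-> h] : p.1 0 j < x 0 j <= p.2 0 j.
  by apply: contrapT => /negP h; apply: H; exists j.
by rewrite lt_neqAle g2.
Qed.

Lemma smooth_tent_cvg : {ae leb, forall x,
  smooth_tent k x @[k --> \oo] --> tent p i x}.
Proof.
apply: filterS ae_generic => x gx; have [tx|[w0 [j ji nj]]] := dichotomy gx.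
  have -> : tent p i x = hat (p.1 0 i) (p.2 0 i) (x 0 i) * 1.
    rewrite /tent mulr1; have [xi|xi] := boolP (p.1 0 i < x 0 i < p.2 0 i).
      by rewrite indic_in ?mul1r//; exact: bset_interior.
    rewrite hatE; last exact/ltW/vp.
    case: ifP; last by rewrite mulr0.
    move=> /andP[h1 h2]; move: xi; rewrite h1/= lt_neqAle h2.
    by have [_ -> _] := gx.
  apply: cvgM; first exact: shat_cvg.
  by apply: bump_cvg; exact/w_gt0.
have -> : tent p i x = 0.
  by rewrite /tent indic_out ?mul0r// => /(_ j); rewrite (negbTE nj).
apply: cvg_near_cst; apply: nearW => k.
by rewrite /smooth_tent w0 mulr0 bump_le0// mulr0.
Qed.

Lemma derive_smooth_tent_cvg : {ae leb, forall x,
  'D_(evec i) (smooth_tent k) x @[k --> \oo] -->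
    (\1_(bset (lo i p)) x - \1_(bset (hi i p)) x : R)}.
Proof.
apply: filterS ae_generic => x gx.
rewrite (_ : (fun k => 'D_(evec i) (smooth_tent k) x) = fun k =>
    shat' (e k) (p.1 0 i) (p.2 0 i) (x 0 i) * bump (k%:R * w x)); last first.
  by apply/funext => k; rewrite derive_smooth_tent.
have [tx|[w0 [j ji nj]]] := dichotomy gx.
  have tx' j : j != i -> p.1 0 j < x 0 j <= p.2 0 j.
    by move=> /tx/andP[-> /ltW ->].
  have -> : \1_(bset (lo i p)) x = (p.1 0 i < x 0 i <= mid p i)%R%:R :> R.
    have [h|h] := boolP (p.1 0 i < x 0 i <= mid p i).
      rewrite indic_in// => j; rewrite /= updE.
      by case: eqP => [->//|/eqP/tx'].
    by rewrite indic_out// => /(_ i); rewrite /= upd_same (negbTE h).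
  have -> : \1_(bset (hi i p)) x = (mid p i < x 0 i <= p.2 0 i)%R%:R :> R.
    have [h|h] := boolP (mid p i < x 0 i <= p.2 0 i).
      rewrite indic_in// => j; rewrite /= updE.
      by case: eqP => [->//|/eqP/tx'].
    by rewrite indic_out// => /(_ i); rewrite /= upd_same (negbTE h).
  rewrite -[_ - _]mulr1.
  apply: cvgM; last by apply: bump_cvg; exact/w_gt0.
  by have [g1 g2 g3] := gx; apply: shat'_cvg.
rewrite indic_out; last by move=> /(_ j); rewrite /= upd_other// (negbTE nj).
rewrite indic_out; last by move=> /(_ j); rewrite /= upd_other// (negbTE nj).
rewrite subrr; apply: cvg_near_cst; apply: nearW => k.
by rewrite w0 mulr0 bump_le0// mulr0.
Qed.

End smooth_tent.

Section integrals.
Local Notation L1 := (L1 (@leb R n)).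
Local Notation Int := (Int (@leb R n)).
Variables (p : Rn * Rn) (i : 'I_n.+1) (v : Rn -> R).
Hypotheses (vp : valid p) (Lv : L1 (fun x => \1_(bset p) x * v x)).

Lemma measurable_hat (a b : R) : measurable_fun setT (fun x : Rn => hat a b (x 0 i)).
Proof.
apply: continuous_measurable => x.
have c c' : {for x, continuous (fun x : Rn => pos (x 0 i - c'))}.
  apply: (@continuous_comp _ _ _ (fun x : Rn => x 0 i - c') pos).
    by apply: continuousB; [exact: coord_continuous|exact: cst_continuous].
  exact: continuous_pos.
have c2 := continuousM (@cst_continuous Rn R 2 x) (c ((a + b) / 2)).
exact: (continuousD (continuousB (c a) c2) (c b)).
Qed.

Lemma measurable_tent : measurable_fun setT (tent p i).
Proof.
by apply: measurable_funM; [exact: measurable_indic|exact: measurable_hat].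
Qed.

Lemma tent_bound x : 0 <= tent p i x <= p.2 0 i - p.1 0 i.
Proof.
have := vp i; move=> pi; rewrite /tent hatE; last exact: ltW.
apply/andP; split.
  rewrite mulr_ge0 ?indic_ge0//; case: ifP => // /andP[h1 h2].
  by rewrite le_min !subr_ge0 h2 ltW.
rewrite -[leRHS]mul1r; apply: ler_pM; rewrite ?indic_ge0 ?indic_le1//.
  by case: ifP => // /andP[h1 h2]; rewrite le_min !subr_ge0 h2 ltW.
case: ifP => [/andP[h1 h2]|_]; last by rewrite subr_ge0 ltW.
by rewrite ge_min lerD2r h2.
Qed.

Lemma L1_tent : L1 (fun x => v x * tent p i x).
Proof.
have -> : (fun x => v x * tent p i x) =
    (fun x => tent p i x * (\1_(bset p) x * v x)).
  apply/funext => x; rewrite /tent; have [px|px] := pselect (bset p x).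
    by rewrite indic_in// !mul1r mulrC.
  by rewrite indic_out// !mul0r mulr0.
apply: (@L1_mulbdd _ _ _ _ _ _ (p.2 0 i - p.1 0 i)); last exact: Lv.
  exact: measurable_tent.
by move=> x; have /andP[h1 h2] := tent_bound x; rewrite ger0_norm.
Qed.

Lemma Int_smooth_tent : Int (fun x => v x * smooth_tent p i k x) @[k --> \oo] -->
  Int (fun x => v x * tent p i x).
Proof.
have E g : (forall x, g x != 0 -> bset p x) ->
    Int (fun x => v x * g x) = Int (fun x => g x * (\1_(bset p) x * v x)).
  move=> gp; apply: eq_Int => x; have [->|/gp px] := eqVneq (g x) 0.
    by rewrite mul0r mulr0.
  by rewrite indic_in// mul1r mulrC.
rewrite E; last first.
  by move=> x; rewrite mulf_eq0 negb_or => /andP[+ _];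
    apply: contraNP => /indic_out ->.
under eq_fun do rewrite (E _ (fun x => @smooth_tent_support p i vp _ x)).
have msm k : measurable_fun setT (smooth_tent p i k).
  by apply: continuous_measurable; exact: C1_continuous (C1_smooth_tent p i k).
apply: (@Int_cvg _ _ _ (@leb R n)
  (fun k x => smooth_tent p i k x * (\1_(bset p) x * v x))
  (fun x => tent p i x * (\1_(bset p) x * v x))
  (fun x => 3 * (p.2 0 i - p.1 0 i) * `|\1_(bset p) x * v x|)).
- by move=> k; apply: measurable_funM; [exact: msm|exact: (@L1_measurable _ _ _ leb)].
- by apply: measurable_funM; [exact: measurable_tent|exact: (@L1_measurable _ _ _ leb)].
- apply: filterS (smooth_tent_cvg i vp) => x hx.
  by apply: cvgM => //; exact: cvg_cst.
- exact/L1Z/L1_norm.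
- move=> k x; rewrite normrM ler_wpM2r//.
  apply: le_trans (smooth_tent_le i vp k x) _; rewrite ler_piMr// ?indic_le1//.
  by rewrite mulr_ge0// subr_ge0; exact/ltW/vp.
Qed.

Lemma Int_derive_smooth_tent :
  Int (fun x => v x * 'D_(evec i) (smooth_tent p i k) x) @[k --> \oo] -->
  Int (fun x => \1_(bset (lo i p)) x * v x) - Int (fun x => \1_(bset (hi i p)) x * v x).
Proof.
have midp : p.1 0 i < mid p i < p.2 0 i.
  by have := vp i; rewrite /mid => h; apply/andP; split; lra.
have [mid1 mid2] := andP midp.
have lop x : bset (lo i p) x -> bset p x.
  move=> h j; have := h j; rewrite /= updE; case: eqP => // -> /andP[-> h2] /=.
  exact: le_trans h2 (ltW mid2).
have hip x : bset (hi i p) x -> bset p x.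
  move=> h j; have := h j; rewrite /= updE; case: eqP => // -> /andP[h2 ->].
  by rewrite andbT; exact: lt_trans mid1 h2.
have indM (A : set Rn) x : (A x -> bset p x) ->
    \1_A x * (\1_(bset p) x * v x) = \1_A x * v x.
  move=> Ap; have [Ax|Ax] := pselect (A x); last by rewrite indic_out// !mul0r.
  by rewrite (indic_in (Ap Ax)) mul1r.
pose w x := \1_(bset p) x * v x.
have Lw : L1 w by [].
have mw : measurable_fun setT w by exact: (@L1_measurable _ _ _ leb).
have LA (A : set Rn) : measurable A -> L1 (fun x => \1_A x * w x).
  by move=> mA; exact: L1_indicM.
rewrite (_ : _ - _ = Int (fun x => (\1_(bset (lo i p)) x - \1_(bset (hi i p)) x) * w x)).
  have Dp k x : 'D_(evec i) (smooth_tent p i k) x * w x =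
      v x * 'D_(evec i) (smooth_tent p i k) x.
    rewrite /w; have [px|px] := pselect (bset p x).
      by rewrite indic_in// mul1r mulrC.
    have := derive_smooth_tent_le i vp k x.
    by rewrite indic_out// mulr0 normr_le0 => /eqP ->; rewrite mul0r mulr0.
  under eq_fun do rewrite -(eq_Int leb (Dp _)).
  have mD k : measurable_fun setT ('D_(evec i) (smooth_tent p i k)).
    by apply: continuous_measurable; exact: (C1_smooth_tent p i k).2.
  apply: (@Int_cvg _ _ _ (@leb R n)
    (fun k x => 'D_(evec i) (smooth_tent p i k) x * w x)
    (fun x => (\1_(bset (lo i p)) x - \1_(bset (hi i p)) x) * w x)
    (fun x => 2 * `|w x|)).
  - by move=> k; apply: measurable_funM; [exact: mD|exact: mw].
  - apply: measurable_funM; last exact: mw.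
    by apply: measurable_funB; exact: measurable_indic.
  - apply: filterS (derive_smooth_tent_cvg i vp) => x hx.
    by apply: cvgM => //; exact: cvg_cst.
  - exact/L1Z/L1_norm.
  - move=> k x; rewrite normrM ler_wpM2r//.
    apply: le_trans (derive_smooth_tent_le i vp k x) _.
    by rewrite ler_piMr// indic_le1.
under [in RHS]eq_Int do rewrite mulrBl.
rewrite IntB; [|exact: LA|exact: LA].
congr (_ - _); apply: eq_Int => x; rewrite indM//; [exact: lop|exact: hip].
Qed.

End integrals.

End tent_functions.

(** * Dyadic tilings *)

Section dyadic.
Context {R : realType} {n : nat}.
Local Notation Rn := ('rV[R]_n.+1).
Local Notation L1 := (L1 (@leb R n)).
Local Notation Int := (Int (@leb R n)).
Implicit Types (p Q : Rn * Rn) (l : seq (Rn * Rn)) (x : Rn) (i j : 'I_n.+1).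
Implicit Types (js : seq 'I_n.+1) (v : Rn -> R).

Definition side p j : R := p.2 0 j - p.1 0 j.

(** The identity of indicators says at once that the boxes are disjoint and
    that they exhaust [Q]. *)
Definition tiles l Q := forall x, \sum_(p <- l) \1_(bset p) x = \1_(bset Q) x :> R.

Definition split j l := flatten [seq [:: lo j p; hi j p] | p <- l].

Definition halve js l := foldr split l js.

(** Only the directions in [js] are halved: a tiling into thin columns arises
    when one direction is left out. *)
Definition dyadic js k Q := iter k (halve js) [:: Q].

Lemma mid_in p j : valid p -> p.1 0 j < mid p j < p.2 0 j.
Proof. by move=> /(_ j) h; rewrite /mid; apply/andP; split; lra. Qed.

Lemma valid_lo p j : valid p -> valid (lo j p).
Proof.
move=> vp i; rewrite /= updE; case: eqP => [->|_]; last exact: vp.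
by have /andP[] := mid_in j vp.
Qed.

Lemma valid_hi p j : valid p -> valid (hi j p).
Proof.
move=> vp i; rewrite /= updE; case: eqP => [->|_]; last exact: vp.
by have /andP[] := mid_in j vp.
Qed.

Lemma indic_lo_hi p j x : valid p ->
  \1_(bset p) x = \1_(bset (lo j p)) x + \1_(bset (hi j p)) x :> R.
Proof.
move=> vp; have /andP[m1 m2] := mid_in j vp.
have [h|h] := lerP (x 0 j) (mid p j).
  rewrite [X in _ = _ + X]indic_out ?addr0; last first.
    by move=> /(_ j); rewrite /= upd_same ltNge h.
  rewrite !indicE; congr ((nat_of_bool _)%:R); apply/idP/idP => /set_mem H; apply/mem_set => i.
    rewrite /= updE; case: eqP => [->|_]; last exact: H.
    by have /andP[-> _] := H j.
  have := H i; rewrite /= updE; case: eqP => [->|_//] /andP[-> h2] /=.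
  exact: le_trans h2 (ltW m2).
rewrite [X in _ = X + _]indic_out ?add0r; last first.
  by move=> /(_ j); rewrite /= upd_same leNgt h andbF.
rewrite !indicE; congr ((nat_of_bool _)%:R); apply/idP/idP => /set_mem H; apply/mem_set => i.
  rewrite /= updE; case: eqP => [->|_]; last exact: H.
  by have /andP[_ ->] := H j; rewrite h.
have := H i; rewrite /= updE; case: eqP => [->|_//] /andP[h2 ->].
by rewrite andbT; exact: lt_trans m1 h2.
Qed.

Lemma leb_lo_hi p j : leb (bset (lo j p)) = leb (bset (hi j p)).
Proof.
rewrite /bset /= -(leb_box_shift _ _ ((side p j / 2) *: evec j)).
congr (leb (box _ _)); apply/rowP => i; rewrite !mxE eqxx/=;
  case: (eqVneq i j) => [->|ij]; rewrite ?mulr0 ?addr0// mulr1 /side /mid; by field.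
Qed.

Lemma tiles_split j l Q : (forall p, p \in l -> valid p) ->
  tiles l Q -> tiles (split j l) Q.
Proof.
move=> vl lQ x; rewrite -lQ /split big_flatten big_map/=.
rewrite big_seq [RHS]big_seq; apply: eq_bigr => p pl.
by rewrite !big_cons big_nil addr0 -indic_lo_hi//; exact: vl.
Qed.

Lemma mem_split j l p : p \in split j l ->
  exists2 p0, p0 \in l & p = lo j p0 \/ p = hi j p0.
Proof.
move=> /flattenP[s /mapP[p0 p0l ->]]; rewrite !inE => /orP[] /eqP ->.
- by exists p0 => //; left.
- by exists p0 => //; right.
Qed.

Lemma valid_split j l : (forall p, p \in l -> valid p) ->
  forall p, p \in split j l -> valid p.
Proof.
move=> vl p /mem_split[p0 /vl vp0 [] ->]; [exact: valid_lo|exact: valid_hi].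
Qed.

Lemma valid_halve js l : (forall p, p \in l -> valid p) ->
  forall p, p \in halve js l -> valid p.
Proof. by move=> vl; elim: js => // j js IH; exact: valid_split. Qed.

Lemma tiles_halve js l Q : (forall p, p \in l -> valid p) ->
  tiles l Q -> tiles (halve js l) Q.
Proof.
move=> vl lQ; elim: js => // j js IH; apply: tiles_split IH.
exact: valid_halve.
Qed.

Lemma valid_dyadic js k Q : valid Q -> forall p, p \in dyadic js k Q -> valid p.
Proof.
move=> vQ; elim: k => [p|k IH]; first by rewrite inE => /eqP ->.
exact: valid_halve.
Qed.

Lemma tiles_dyadic js k Q : valid Q -> tiles (dyadic js k Q) Q.
Proof.
move=> vQ; elim: k => [|k IH]; first by move=> x; rewrite big_seq1.
by apply: tiles_halve => //; exact: valid_dyadic.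
Qed.

Lemma mem_halve js l p : uniq js -> p \in halve js l ->
  exists2 p0, p0 \in l & (forall j, j \in js -> side p j = side p0 j / 2) /\
    (forall j, j \notin js -> p.1 0 j = p0.1 0 j /\ p.2 0 j = p0.2 0 j).
Proof.
elim: js p => [p _ pl|j js IH p /= /andP[jjs ujs] /mem_split[q ql pq]].
  by exists p.
have [p0 p0l [h1 h2]] := IH _ ujs ql.
have other i : i != j -> p.1 0 i = q.1 0 i /\ p.2 0 i = q.2 0 i.
  by move=> ij; case: pq => ->; rewrite /= upd_other.
have sj : side p j = side q j / 2.
  by case: pq => ->; rewrite /side /= upd_same /mid; field.
exists p0 => //; split => i; rewrite inE.
  case: eqVneq => [->|ij] /=.
    by have [h3 h4] := h2 _ jjs; rewrite sj /side h3 h4.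
  by move=> /h1 <-; have [h3 h4] := other _ ij; rewrite /side h3 h4.
rewrite negb_or => /andP[/other[-> ->]]; exact: h2.
Qed.

Lemma mem_dyadic js k Q p : uniq js -> p \in dyadic js k Q ->
  (forall j, j \in js -> side p j = side Q j / 2 ^+ k) /\
  (forall j, j \notin js -> p.1 0 j = Q.1 0 j /\ p.2 0 j = Q.2 0 j).
Proof.
move=> ujs; elim: k p => [p|k IH p /= /(mem_halve ujs)[p0 /IH[h1 h2] [h3 h4]]].
  by rewrite inE => /eqP ->; split => // j _; rewrite expr0 divr1.
split=> j jjs.
  by rewrite h3// h1// exprS; field; rewrite expf_neq0.
by have [-> ->] := h4 _ jjs; exact: h2.
Qed.

Lemma tiles_sub l Q p : tiles l Q -> p \in l -> bset p `<=` bset Q.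
Proof.
move=> lQ pl x px; apply: contrapT => Qx.
have := lQ x; rewrite (indic_out Qx) (perm_big _ (perm_to_rem pl)) big_cons.
rewrite (indic_in px) => /eqP; apply/negP; rewrite gt_eqF// ltr_wpDr//.
by apply: sumr_ge0 => q _; exact: indic_ge0.
Qed.

Lemma tiles_pick (J : eqType) (s : seq J) (S : J -> set Rn) (c : J -> R) x k :
  \sum_(q <- s) \1_(S q) x <= 1 :> R -> k \in s -> S k x ->
  \sum_(q <- s) \1_(S q) x * c q = c k.
Proof.
move=> s1 ks Skx.
have e := perm_to_rem ks; move: s1; rewrite !(perm_big _ e) !big_cons/=.
rewrite (indic_in Skx) mul1r gerDl => s0.
rewrite [X in _ + X]big1_seq ?addr0// => q /andP[_ qs].
have : \1_(S q) x <= 0 :> R.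
  apply: le_trans s0; rewrite (perm_big _ (perm_to_rem qs)) big_cons lerDl.
  by apply: sumr_ge0 => ? _; exact: indic_ge0.
move=> h; suff -> : \1_(S q) x = 0 :> R by rewrite mul0r.
by apply/eqP; rewrite eq_le h indic_ge0.
Qed.

Lemma bset_dist p x y j : bset p x -> bset p y -> `|x 0 j - y 0 j| <= side p j.
Proof.
move=> /(_ j) /andP[h1 h2] /(_ j) /andP[h3 h4].
by rewrite /side ler_norml; apply/andP; split; lra.
Qed.

Lemma small_sides Q (e : R) : valid Q -> 0 < e ->
  \forall k \near \oo, forall j, side Q j / 2 ^+ k < e.
Proof.
move=> vQ e0; apply: filter_forall => j.
have : side Q j / 2 ^+ k @[k --> \oo] --> (0 : R).
  rewrite (_ : (fun _ => _) = fun k => side Q j * (2^-1) ^+ k).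
    by apply: cvg0Z; apply: cvg_expr; rewrite ger0_norm ?invr_ge0// invf_lt1// ltr1n.
  by apply/funext => k; rewrite exprVn.
move=> /cvgrPdist_lt/(_ _ e0); apply: filterS => k; rewrite sub0r normrN.
by apply: le_lt_trans; exact: ler_norm.
Qed.

Definition boxes k Q := dyadic (enum 'I_n.+1) k Q.

Lemma mem_boxes k Q p j : p \in boxes k Q -> side p j = side Q j / 2 ^+ k.
Proof.
by move=> /(mem_dyadic (enum_uniq _))[h _]; apply: h; rewrite mem_enum.
Qed.

Definition diag l := [seq (p, p) | p <- l].

Lemma net_boxes Q : valid Q -> averaging_net (bset Q) (fun k => diag (boxes k Q)).
Proof.
move=> vQ; have tQ k := @tiles_dyadic (enum 'I_n.+1) k Q vQ; split.
- by move=> k x; rewrite big_map; exact: tQ.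
- by move=> k x; rewrite big_map (tQ k) indic_le1.
- by move=> k q /mapP[p _ ->].
- by apply: aeW => x Qx; apply: nearW => k; rewrite big_map (tQ k) indic_out.
- move=> e e0; apply: filterS (small_sides vQ e0) => k he q /mapP[p pk ->] x y px py.
  apply/ball_coord => // j; apply: le_lt_trans (he j); rewrite -(mem_boxes j pk).
  exact: bset_dist px py.
Qed.

(** All averages of [v] vanish, and they converge to [v] in mean. *)
Lemma ae_zero_on_boxes Q v : valid Q -> L1 v ->
  (forall p, valid p -> bset p `<=` bset Q -> Int (fun x => \1_(bset p) x * v x) = 0) ->
  {ae leb, forall x, bset Q x -> v x = 0}.
Proof.
move=> vQ Lv v0.
have := step_cvg_L1 (measurable_bset Q) (net_boxes vQ) Lv.
have E k : Int (fun x => `|\1_(bset Q) x * v x - step (diag (boxes k Q)) v x|) =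
    Int (fun x => `|\1_(bset Q) x * v x|).
  apply: eq_Int => x; congr `|_|; rewrite -[RHS]subr0; congr (_ - _).
  rewrite stepE big_map big1_seq// => p /andP[_ pk].
  rewrite avgE v0 ?mul0r ?mulr0//; first exact: valid_dyadic pk.
  by apply: tiles_sub pk; exact: tiles_dyadic.
under eq_fun do rewrite E.
move=> c0.
have Lw : L1 (fun x => \1_(bset Q) x * v x) by exact: L1_indicM.
apply: filterS (Int_null Lw _) => [x + Qx|]; first by rewrite indic_in// mul1r.
exact: (cvg_unique (@norm_hausdorff _ R^o) (cvg_cst _) c0).
Qed.

End dyadic.

(** * The gradient vanishes where the density vanishes *)

Section saturation.
Context {R : realType}.
Implicit Types e s t : R.

(** The slope between [s] and [t] of the bounded increasing function [sat e]
    below, in a form that makes sense for [s = t] too, where it is the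
    derivative. *)
Definition slope e s t : R := (e / (e + s)) * (e / (e + t)).

Definition sat e t : R := e * t / (e + t).

(** The chain rule in discrete form. *)
Lemma slope_sat e s t : 0 < e -> 0 <= s -> 0 <= t ->
  slope e s t * (t - s) = sat e t - sat e s.
Proof.
move=> e0 s0 t0; rewrite /slope /sat; field.
by rewrite !gt_eqF//; lra.
Qed.

Lemma sat_bound e t : 0 < e -> 0 <= t -> 0 <= sat e t <= e.
Proof.
move=> e0 t0; have et : 0 < e + t by lra.
rewrite /sat; apply/andP; split; first by rewrite divr_ge0// ?mulr_ge0// ltW.
by rewrite ler_pdivrMr// ler_pM2l//; lra.
Qed.

Lemma ratio_01 e t : 0 < e -> 0 <= t -> 0 <= e / (e + t) <= 1.
Proof.
move=> e0 t0; have et : 0 < e + t by lra.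
apply/andP; split; first by rewrite divr_ge0// ltW.
by rewrite ler_pdivrMr//; lra.
Qed.

Lemma slope_01 e s t : 0 < e -> 0 <= s -> 0 <= t -> 0 <= slope e s t <= 1.
Proof.
move=> e0 s0 t0; have /andP[h1 h2] := ratio_01 e0 s0.
have /andP[h3 h4] := ratio_01 e0 t0.
by rewrite /slope mulr_ge0//= mulr_ile1.
Qed.

Lemma ratio_lip e s t : 0 < e -> 0 <= s -> 0 <= t ->
  `|e / (e + s) - e / (e + t)| <= `|s - t| / e.
Proof.
move=> e0 s0 t0; have es : 0 < e + s by lra.
have et : 0 < e + t by lra.
have -> : e / (e + s) - e / (e + t) =
    (t - s) / e * ((e / (e + s)) * (e / (e + t))).
  by field; rewrite !gt_eqF.
have /andP[h1 h2] := slope_01 e0 s0 t0.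
have -> : `|s - t| / e = `|(t - s) / e| by rewrite normrM normfV (gtr0_norm e0) distrC.
by rewrite normrM ler_piMr// -/(slope e s t) ger0_norm.
Qed.

Lemma slope_lip e a b c : 0 < e -> 0 <= a -> 0 <= b -> 0 <= c ->
  `|slope e a b - slope e c c| <= (`|a - c| + `|b - c|) / e.
Proof.
move=> e0 a0 b0 c0; rewrite /slope.
have /andP[h1 h2] := ratio_01 e0 a0; have /andP[h3 h4] := ratio_01 e0 c0.
have ha := ratio_lip e0 a0 c0; have hb := ratio_lip e0 b0 c0.
set A := e / (e + a) in h1 h2 ha *; set B := e / (e + b) in hb *.
set C := e / (e + c) in h3 h4 ha hb *.
clearbody A B C.
have -> : A * B - C * C = A * (B - C) + C * (A - C) by ring.
apply: le_trans (ler_normD _ _) _; rewrite !normrM (ger0_norm h1) (ger0_norm h3).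
rewrite mulrDl addrC; apply: lerD.
  by apply: le_trans ha; rewrite ler_piMl.
by apply: le_trans hb; rewrite ler_piMl.
Qed.

Lemma sum_intervals (a d s : R) N : 0 <= d ->
  \sum_(0 <= m < N) ((a + m%:R * d < s <= a + m%:R * d + d)%R)%:R =
  ((a < s <= a + N%:R * d)%R)%:R :> R.
Proof.
move=> d0; have E u v : u <= v ->
    ((u < s <= v)%R)%:R = ((s <= v)%R)%:R - ((s <= u)%R)%:R :> R.
  move=> uv; case: (ltP u s) => h /=; first by rewrite subr0.
  by rewrite (le_trans h uv) subrr.
rewrite E ?lerDl ?mulr_ge0//.
under eq_bigr do rewrite E ?lerDl//.
under eq_bigr do rewrite -addrA -{2}[d]mul1r -mulrDl natr1.
by rewrite (telescope_sumr (fun m => ((s <= a + m%:R * d)%R)%:R))// mul0r addr0.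
Qed.

(** A hat is a second difference, so that a sum of consecutive hats is a
    difference of two first differences. *)
Lemma sum_hats (a d s : R) N :
  \sum_(0 <= m < N) hat (a + m%:R * d) (a + m%:R * d + 2 * d) s =
  (pos (s - a) - pos (s - (a + d))) -
  (pos (s - (a + N%:R * d)) - pos (s - (a + N%:R * d + d))).
Proof.
pose D m := pos (s - (a + m%:R * d + d)) - pos (s - (a + m%:R * d)).
rewrite (eq_bigr (fun m => D m.+1 - D m)).
  by rewrite telescope_sumr// /D mul0r addr0; ring.
move=> m _; rewrite /D /hat.
have -> : m.+1%:R = m%:R + 1 :> R by rewrite natr1.
have -> : (a + m%:R * d + (a + m%:R * d + 2 * d)) / 2 = a + m%:R * d + d by field.
have -> : a + (m%:R + 1) * d = a + m%:R * d + d by ring.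
have -> : a + m%:R * d + d + d = a + m%:R * d + 2 * d by ring.
by ring.
Qed.

End saturation.

Section gradient_on_zero_set.
Context {R : realType} {n : nat}.
Local Notation Rn := ('rV[R]_n.+1).
Local Notation L1 := (L1 (@leb R n)).
Local Notation Int := (Int (@leb R n)).
Implicit Types (p Q : Rn * Rn) (x y : Rn) (j : 'I_n.+1).

Section direction.
Variable i : 'I_n.+1.

(** The indicator of the infinite cylinder over the cross-section of [p]
    transverse to direction [i]. *)
Definition trans p x : R := \prod_(j | j != i) ((p.1 0 j < x 0 j <= p.2 0 j)%R)%:R.

Lemma trans_01 p x : trans p x = 0 \/ trans p x = 1.
Proof.
have [H|H] := pselect (forall j, j != i -> p.1 0 j < x 0 j <= p.2 0 j).
  by right; rewrite /trans big1// => j /H ->.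
left; apply: contrapT => t0; apply: H => j ji; apply: contrapT => /negP/negbTE h.
by apply: t0; rewrite /trans (bigD1 j)//= h mul0r.
Qed.

Lemma indic_trans p x :
  \1_(bset p) x = ((p.1 0 i < x 0 i <= p.2 0 i)%R)%:R * trans p x :> R.
Proof.
have -> : ((p.1 0 i < x 0 i <= p.2 0 i)%R)%:R * trans p x =
    \prod_j ((p.1 0 j < x 0 j <= p.2 0 j)%R)%:R by rewrite [RHS](bigD1 i).
have [px|px] := pselect (bset p x).
  by rewrite indic_in// big1// => j _; rewrite px.
have [j /negbTE pj] : exists j, ~~ (p.1 0 j < x 0 j <= p.2 0 j).
  apply: contrapT => H; apply: px => j; apply: contrapT => /negP h.
  by apply: H; exists j.
by rewrite indic_out// (bigD1 j)//= pj mul0r.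
Qed.

Definition slice (d : R) p (t : R) : Rn * Rn := (upd p.1 i t, upd p.2 i (t + d)).

Lemma trans_slice d p t x : trans (slice d p t) x = trans p x.
Proof. by apply: eq_bigr => j ji; rewrite /= !upd_other. Qed.

Lemma indic_slice d p t x :
  \1_(bset (slice d p t)) x = ((t < x 0 i <= t + d)%R)%:R * trans p x :> R.
Proof. by rewrite indic_trans trans_slice /= !upd_same. Qed.

Lemma leb_slice d p t t' : leb (bset (slice d p t)) = leb (bset (slice d p t')).
Proof.
rewrite /bset /= -(leb_box_shift _ _ ((t' - t) *: evec i)).
by congr (leb (box _ _)); apply/rowP => j; rewrite !mxE eqxx/=;
  case: (eqVneq j i) => [_|_]; rewrite ?mulr0 ?addr0// mulr1; ring.
Qed.

Lemma valid_slice d p t : 0 < d -> valid p -> valid (slice d p t).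
Proof.
move=> d0 vp j; rewrite /= !updE; case: eqP => [_|_]; last exact: vp.
by rewrite ltrDl.
Qed.

Lemma lo_slice d p t : lo i (slice (2 * d) p t) = slice d p t.
Proof.
rewrite /lo /slice /=; congr (_, _); apply/rowP => j; rewrite !updE.
by case: eqP => [_|//]; rewrite /mid /= !upd_same; field.
Qed.

Lemma hi_slice d p t : hi i (slice (2 * d) p t) = slice d p (t + d).
Proof.
rewrite /hi /slice /=; congr (_, _); apply/rowP => j; rewrite !updE;
  (case: eqP => [_|//]); rewrite ?/mid /= ?upd_same; first by field.
by ring.
Qed.

Lemma tent_slice d p t x : 0 < d ->
  tent (slice (2 * d) p t) i x = trans p x * hat t (t + 2 * d) (x 0 i).
Proof.
move=> d0; rewrite /tent indic_slice /= !upd_same mulrAC mulrC.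
rewrite hatE; last by rewrite lerDl mulr_ge0// ltW.
by case: ifP => _; rewrite ?mulr0 ?mul0r// mul1r.
Qed.

Section cube.
Variables (Q : Rn * Rn) (vQ : valid Q).

Let a := Q.1 0 i.
Let L := side Q i.
Let d k : R := L / 2 ^+ k.

Let L0 : 0 < L. Proof. by rewrite /L /side subr_gt0; exact: vQ. Qed.

Let d0 k : 0 < d k. Proof. by rewrite divr_gt0// exprn_gt0. Qed.

Let dL k : (2 ^ k)%:R * d k = L.
Proof. by rewrite natrX mulrC divfK// expf_neq0. Qed.

(** The boxes that run through [Q] in direction [i] and are thin in the other
    ones. *)
Definition columns k := dyadic [seq j <- enum 'I_n.+1 | j != i] k Q.

Lemma columns_side k p j : p \in columns k -> j != i -> side p j = side Q j / 2 ^+ k.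
Proof.
move=> /(mem_dyadic (filter_uniq _ (enum_uniq _)))[h _] ji; apply: h.
by rewrite mem_filter ji mem_enum.
Qed.

Lemma columns_ends k p : p \in columns k -> p.1 0 i = a /\ p.2 0 i = Q.2 0 i.
Proof.
move=> /(mem_dyadic (filter_uniq _ (enum_uniq _)))[_ h]; apply: h.
by rewrite mem_filter eqxx.
Qed.

Lemma sum_trans k x : \sum_(p <- columns k) trans p x = trans Q x.
Proof.
have := @tiles_dyadic _ _ [seq j <- enum 'I_n.+1 | j != i] k Q vQ (upd x i (Q.2 0 i)).
have T p : trans p (upd x i (Q.2 0 i)) = trans p x.
  by apply: eq_bigr => j ji; rewrite upd_other.
rewrite indic_trans upd_same lexx (vQ i) mul1r T => <-.
rewrite big_seq [RHS]big_seq; apply: eq_bigr => p pk.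
have [h1 h2] := columns_ends pk.
by rewrite indic_trans T upd_same h1 h2 lexx (vQ i) mul1r.
Qed.

Definition cell k p (m : R) := slice (d k) p (a + m * d k).

(** The cells of the grid of step [2^-k], each paired with its translate by [c]
    steps in direction [i]. *)
Definition shifted_cells (c : R) k : seq ((Rn * Rn) * (Rn * Rn)) :=
  [seq (cell k p m%:R, cell k p (m%:R + c)) | p <- columns k, m <- index_iota 0 (2 ^ k)].

Lemma sum_cells c k x : \sum_(p <- columns k) \sum_(0 <= m < 2 ^ k)
    \1_(bset (cell k p (m%:R + c))) x =
  ((a + c * d k < x 0 i <= a + c * d k + L)%R)%:R * trans Q x :> R.
Proof.
have E p : \sum_(0 <= m < 2 ^ k) \1_(bset (cell k p (m%:R + c))) x =
    ((a + c * d k < x 0 i <= a + c * d k + L)%R)%:R * trans p x :> R.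
  under eq_bigr do rewrite indic_slice; rewrite -mulr_suml; congr (_ * _).
  rewrite -(dL k) -(sum_intervals (a + c * d k) _ _ (ltW (d0 k))).
  apply: eq_bigr => m _.
  by have -> : a + (m%:R + c) * d k = a + c * d k + m%:R * d k by ring.
by under eq_bigr do rewrite E; rewrite -mulr_sumr sum_trans.
Qed.

Lemma big_shifted_cells c k (F : (Rn * Rn) * (Rn * Rn) -> R) :
  \sum_(q <- shifted_cells c k) F q = \sum_(p <- columns k) \sum_(0 <= m < 2 ^ k)
    F (cell k p m%:R, cell k p (m%:R + c)).
Proof. exact: big_allpairs_dep. Qed.

Lemma tiles_cells c k x : \sum_(q <- shifted_cells c k) \1_(bset q.1) x =
  \1_(bset Q) x :> R.
Proof.
rewrite big_shifted_cells.
transitivity (\sum_(p <- columns k) \sum_(0 <= m < 2 ^ k)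
    \1_(bset (cell k p (m%:R + 0))) x : R).
  by apply: eq_bigr => p _; apply: eq_bigr => m _; rewrite addr0.
rewrite sum_cells indic_trans mul0r addr0.
by have -> : a + L = Q.2 0 i by rewrite /a /L /side addrC subrK.
Qed.

Lemma mem_shifted_cells c k p m : p \in columns k -> (m < 2 ^ k)%N ->
  (cell k p m%:R, cell k p (m%:R + c)) \in shifted_cells c k.
Proof.
move=> pk mk; apply/allpairsPdep; exists p, m; split => //.
by rewrite mem_index_iota.
Qed.

Lemma net_cells c : `|c| <= 1 -> averaging_net (bset Q) (shifted_cells c).
Proof.
move=> c1; have cd k : `|c * d k| <= d k.
  by rewrite normrM (gtr0_norm (d0 k)) ler_piMl// ltW.
have aL : a + L = Q.2 0 i by rewrite /a /L /side addrC subrK.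
split.
- exact: tiles_cells.
- move=> k x; rewrite big_shifted_cells sum_cells.
  have [->|->] := trans_01 Q x; first by rewrite mulr0.
  by rewrite mulr1; case: (_ && _).
- by move=> k q /allpairsPdep[p [m [_ _ ->]]]; exact: leb_slice.
- apply: filterS2 (ae_coord_neq i a) (ae_coord_neq i (a + L)) => x xa xb Qx.
  pose r := Num.min `|x 0 i - a| `|x 0 i - (a + L)|.
  have r0 : 0 < r by rewrite lt_min !normr_gt0 !subr_eq0 xa xb.
  apply: filterS (small_sides vQ r0) => k /(_ i).
  rewrite -[side Q i / 2 ^+ k]/(d k) lt_min => /andP[h1 h2].
  rewrite big_shifted_cells sum_cells.
  have [->|t1] := trans_01 Q x; first by rewrite mulr0.
  have cdk := cd k; move: cdk; rewrite ler_norml => /andP[h3 h4].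
  case: ltP => h5 /=; last by rewrite mul0r.
  case: leP => h6 /=; last by rewrite mul0r.
  exfalso; apply: Qx.
  apply/set_mem; have := indic_trans Q x; rewrite t1 mulr1 indicE.
  case: (x \in bset Q) => // /eqP; rewrite eq_sym -aL -/a.
  case: ltP => h7 /=; last first.
    by move: h1; rewrite ler0_norm ?subr_le0//; have := L0; lra.
  case: leP => h8 /=; first by rewrite oner_eq0.
  by move: h2; rewrite gtr0_norm ?subr_gt0//; have := L0; lra.
- move=> e e0; have e2 : 0 < e / 2 by rewrite divr_gt0.
  apply: filterS (small_sides vQ e2) => k he q /allpairsPdep[p [m [pk _ ->]]] x y /= px py.
  apply/ball_coord => // j; have [->|ji] := eqVneq j i.
    have := px i; have := py i; rewrite /= !upd_same => /andP[h1 h2] /andP[h3 h4].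
    have h5 : d k < e / 2 := he i.
    move: (cd k); rewrite ler_norml => /andP[h6 h7].
    rewrite mulrDl in h1 h2.
    by rewrite ltr_norml; apply/andP; split; lra.
  have := px j; have := py j; rewrite /= !upd_other// => /andP[h1 h2] /andP[h3 h4].
  have := columns_side pk ji; rewrite /side => h5.
  have := he j; rewrite -(columns_side pk ji) /side => h6.
  by rewrite ltr_norml; apply/andP; split; lra.
Qed.

Section weak_derivative.
Variables (f g : Rn -> R).
Hypotheses (Lf : L1 f) (f0 : forall x, 0 <= f x).
Hypothesis Lg : forall p, valid p -> L1 (fun x => \1_(bset p) x * g x).
Hypothesis fg : forall p, valid p ->
  Int (fun x => \1_(bset (hi i p)) x * f x) -
  Int (fun x => \1_(bset (lo i p)) x * f x) = Int (fun x => g x * tent p i x).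

Section chain_rule.
Variables (e : R) (e0 : 0 < e).

Let av k p m := avg (cell k p m) f.

Let av0 k p m : 0 <= av k p m.
Proof.
rewrite /av avgE divr_ge0 ?msr_ge0//; apply: Int_ge0 => x.
by rewrite mulr_ge0// indic_ge0.
Qed.

(** A discrete version of [e^2 / (e + f)^2]: the tent over two consecutive cells
    is weighted by the slope of [sat e] between the averages of [f] on them, and
    the tents of a column add up to 1 away from its ends. *)
Definition weighted_tents k x := \sum_(p <- columns k) \sum_(0 <= m < 2 ^ k)
  slope e (av k p m%:R) (av k p (m%:R + 1)) *
  (tent (slice (2 * d k) p (a + m%:R * d k)) i x / d k).

Let vcol k p : p \in columns k -> valid p.
Proof. exact: valid_dyadic. Qed.

Let d20 k : 0 < 2 * d k. Proof. by rewrite mulr_gt0. Qed.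

Let step_cell c k p m x : p \in columns k -> (m < 2 ^ k)%N ->
  bset (cell k p m%:R) x -> step (shifted_cells c k) f x = av k p (m%:R + c).
Proof.
move=> pk mk px; rewrite stepE.
rewrite (@tiles_pick _ _ _ _ (fun q => bset q.1) (fun q => avg q.2 f) x _ _
  (mem_shifted_cells c pk mk) px)// tiles_cells; exact: indic_le1.
Qed.

Lemma Int_tent_cell k p m : p \in columns k ->
  Int (fun x => g x * tent (slice (2 * d k) p (a + m * d k)) i x) =
  msr (cell k p 0) * (av k p (m + 1) - av k p m).
Proof.
move=> pk; rewrite -fg; last exact: valid_slice (vcol pk).
rewrite lo_slice hi_slice mulrBr.
rewrite -(msr_avg (p := cell k p 0) (q := slice (d k) p (a + m * d k + d k)) Lf); last exact: leb_slice.
rewrite -(msr_avg (p := cell k p 0) (q := slice (d k) p (a + m * d k)) Lf); last exact: leb_slice.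
have -> : a + m * d k + d k = a + (m + 1) * d k by ring.
by [].
Qed.

(** Integrating [g] against a tent yields the difference of two consecutive
    averages of [f]; the weight turns it into a difference of values of [sat e],
    and these telescope along each column. The two remaining values lie between
    0 and [e]. *)
Lemma Int_weighted_tents k : `|Int (fun x => g x * weighted_tents k x)| <=
  e * \prod_(j | j != i) side Q j.
Proof.
pose M p := msr (cell k p 0).
have LT p m : p \in columns k ->
    L1 (fun x => g x * tent (slice (2 * d k) p (a + m%:R * d k)) i x).
  move=> pk; have vs := valid_slice (a + m%:R * d k) (d20 k) (vcol pk).
  by apply: L1_tent => //; exact: Lg.
have -> : Int (fun x => g x * weighted_tents k x) =
    \sum_(p <- columns k) M p / d k *
      (sat e (av k p (2 ^ k)%:R) - sat e (av k p 0%:R)).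
  pose h p m x := if p \in columns k then
    slope e (av k p m%:R) (av k p (m%:R + 1)) / d k *
    (g x * tent (slice (2 * d k) p (a + m%:R * d k)) i x) else 0.
  have Lh p m : L1 (h p m).
    rewrite /h; have [pk|_] := boolP (p \in columns k); last exact: L1_0.
    by apply: L1Z; exact: LT.
  transitivity (Int (fun x => \sum_(p <- columns k) \sum_(0 <= m < 2 ^ k) h p m x)).
    apply: eq_Int => x; rewrite /weighted_tents mulr_sumr big_seq [RHS]big_seq.
    apply: eq_bigr => p pk; rewrite mulr_sumr; apply: eq_bigr => m _.
    by rewrite /h pk; ring.
  rewrite Int_sum; last by move=> p; apply: L1_sum => m; exact: Lh.
  rewrite big_seq [RHS]big_seq; apply: eq_bigr => p pk.
  rewrite Int_sum//.
  rewrite -(telescope_sumr (fun m => sat e (av k p m%:R)))// mulr_sumr.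
  apply: eq_bigr => m _; rewrite /h pk IntZ; last exact: LT.
  rewrite Int_tent_cell// -slope_sat//.
  have -> : m.+1%:R = m%:R + 1 :> R by rewrite natr1.
  by rewrite -/(M p); ring.
have M0 p : 0 <= M p by exact: msr_ge0.
have : \sum_(p <- columns k) M p <= d k * \prod_(j | j != i) side Q j.
  rewrite (eq_bigr (fun p => Int \1_(bset (cell k p 0)))); last first.
    by move=> p _; rewrite /M -Int_bset.
  rewrite -Int_sum; last by move=> p; exact: L1_bset.
  rewrite (_ : Int _ = msr (slice (d k) Q a)); last first.
    rewrite -Int_bset; apply: eq_Int => x; rewrite indic_slice -(sum_trans k) mulr_sumr.
    by apply: eq_bigr => p _; rewrite indic_slice mul0r addr0.
  have fin : leb (bset (slice (d k) Q a)) \is a fin_num.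
    by rewrite ge0_fin_numE// leb_bset_fin.
  rewrite -lee_fin msrE fineK//; apply: le_trans (leb_box_le _ _) _.
  rewrite lee_fin (box_volumeD1 _ _ i) /= !upd_same.
  have -> : a + d k - a = d k by ring.
  rewrite (max_idPr (ltW (d0 k))) le_eqVlt; apply/orP; left; apply/eqP.
  congr (_ * _); apply: eq_bigr => j ji; rewrite !upd_other//; apply/max_idPr.
  by rewrite subr_ge0 ltW.
move=> HM; apply: le_trans (ler_norm_sum _ _ _) _.
apply: (@le_trans _ _ (\sum_(p <- columns k) M p / d k * e)).
  apply: ler_sum => p _.
  have Md : 0 <= M p / d k by apply: divr_ge0; [exact: M0|exact/ltW/d0].
  rewrite normrM (ger0_norm Md); apply: ler_wpM2l => //.
  have /andP[h1 h2] := sat_bound e0 (av0 k p (2 ^ k)%:R).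
  have /andP[h3 h4] := sat_bound e0 (av0 k p 0%:R).
  by rewrite ler_norml; apply/andP; split; lra.
rewrite -mulr_suml -mulr_suml mulrC ler_pM2l// ler_pdivrMr// mulrC.
by rewrite mulrC [leRHS]mulrC.
Qed.

(** Away from the ends of the chain the hats add up to their height. *)
Let profile k s : R := ((pos (s - a) - pos (s - (a + d k))) -
  (pos (s - (a + L)) - pos (s - (a + L + d k)))) / d k.

Let profile_out k s : s <= a \/ a + L + d k <= s -> profile k s = 0.
Proof.
have hd := d0 k; have hL := L0.
rewrite /profile => -[h|h].
  by rewrite !pos_le0 ?subrr ?mul0r//; lra.
by rewrite !pos_id; lra.
Qed.

Let profile_in k s : a + d k <= s -> s <= a + L -> profile k s = 1.
Proof.
have hd := d0 k; have hL := L0.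
move=> h1 h2; rewrite /profile (pos_id (_ : 0 <= s - a)); last lra.
rewrite (pos_id (_ : 0 <= s - (a + d k))); last lra.
rewrite !pos_le0; try lra.
by rewrite (_ : _ - _ = d k) ?divff ?gt_eqF//; ring.
Qed.

Let sum_tents k x : \sum_(p <- columns k) \sum_(0 <= m < 2 ^ k)
  (tent (slice (2 * d k) p (a + m%:R * d k)) i x / d k) = trans Q x * profile k (x 0 i).
Proof.
rewrite -(sum_trans k) mulr_suml; apply: eq_bigr => p _.
under eq_bigr do rewrite tent_slice//.
by rewrite -mulr_suml -mulr_sumr sum_hats dL mulrA.
Qed.

Let tent0 k p m x : p \in columns k ->
  0 <= tent (slice (2 * d k) p (a + m%:R * d k)) i x / d k.
Proof.
move=> pk; apply: divr_ge0; last exact/ltW/d0.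
by have /andP[] := tent_bound i (valid_slice (a + m%:R * d k) (d20 k) (vcol pk)) x.
Qed.

Let weighted_le k x : `|weighted_tents k x| <= trans Q x * profile k (x 0 i).
Proof.
rewrite -sum_tents; apply: le_trans (ler_norm_sum _ _ _) _.
rewrite big_seq [leRHS]big_seq; apply: ler_sum => p pk.
apply: le_trans (ler_norm_sum _ _ _) _; apply: ler_sum => m _.
have /andP[h1 h2] := slope_01 e0 (av0 k p m%:R) (av0 k p (m%:R + 1)).
by rewrite normrM (ger0_norm (tent0 _ _ pk)) ger0_norm// ler_piMl// tent0.
Qed.

Let profile_01 k s : 0 <= profile k s <= 1.
Proof.
have hd := d0 k; have hL := L0.
have H u : 0 <= pos u - pos (u - d k) <= d k.
  have [h1|h1] := lerP u 0; have [h2|h2] := lerP (u - d k) 0;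
  rewrite ?(pos_le0 h1) ?(pos_le0 h2) ?(pos_id (ltW h1)) ?(pos_id (ltW h2)); lra.
have Hm u v : u <= v -> pos u - pos (u - d k) <= pos v - pos (v - d k).
  move=> uv; have [h1|h1] := lerP u 0; have [h2|h2] := lerP (u - d k) 0;
  have [h3|h3] := lerP v 0; have [h4|h4] := lerP (v - d k) 0;
  rewrite ?(pos_le0 h1) ?(pos_le0 h2) ?(pos_id (ltW h1)) ?(pos_id (ltW h2))
    ?(pos_le0 h3) ?(pos_le0 h4) ?(pos_id (ltW h3)) ?(pos_id (ltW h4)); lra.
have E1 : s - (a + d k) = s - a - d k by ring.
have E2 : s - (a + L + d k) = s - (a + L) - d k by ring.
have h1 := H (s - a); have h2 := H (s - (a + L)).
have h3 : s - (a + L) <= s - a by lra.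
have {}h3 := Hm _ _ h3.
rewrite /profile E1 E2; apply/andP; split.
  by rewrite divr_ge0 ?(ltW hd)// subr_ge0.
by rewrite ler_pdivrMr// mul1r; lra.
Qed.

Let weighted_bound k x : `|weighted_tents k x| <= \1_(bset (slice (2 * L) Q a)) x.
Proof.
apply: le_trans (weighted_le k x) _; rewrite indic_slice.
have [->|->] := trans_01 Q x; first by rewrite mul0r mulr0.
rewrite mul1r mulr1; have /andP[_ h] := profile_01 k (x 0 i).
have hL := L0; have hd := d0 k.
have dkL : d k <= L.
  by rewrite /d ler_pdivrMr ?exprn_gt0// ler_peMr ?(ltW hL)// exprn_ege1// ler1n.
case: (ltP a (x 0 i)) => h1 /=; last by rewrite profile_out//; left.
case: (leP (x 0 i) (a + 2 * L)) => h2 /=; first exact: h.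
by rewrite profile_out//; right; lra.
Qed.

(* Deviations from [f x] of the averages of [f] over the cell of [x] and its two
   neighbours in direction [i]. *)
Let gap k x := \sum_(c <- [:: 0; 1; -1]) `|step (shifted_cells c k) f x - f x|.

(** A tent that does not vanish at [x] is supported on the cell of [x] and one of
    its two neighbours. *)
Let weighted_close k x : bset Q x ->
  `|weighted_tents k x - slope e (f x) (f x) * (trans Q x * profile k (x 0 i))| <=
  gap k x / e.
Proof.
move=> Qx.
have gap0 : 0 <= gap k x by exact: sumr_ge0.
have gapc c : c \in [:: 0; 1; -1] -> `|step (shifted_cells c k) f x - f x| <= gap k x.
  move=> cs; rewrite /gap (perm_big _ (perm_to_rem cs)) big_cons lerDl.
  exact: sumr_ge0.
rewrite -sum_tents mulr_sumr -sumrB.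
apply: le_trans (ler_norm_sum _ _ _) _.
have /andP[_ pr1] := profile_01 k (x 0 i).
apply: (@le_trans _ _ (gap k x / e * (trans Q x * profile k (x 0 i)))); last first.
  rewrite ler_piMr//; first by rewrite divr_ge0// ltW.
  by have [->|->] := trans_01 Q x; rewrite ?mul0r ?mul1r.
rewrite -sum_tents mulr_sumr big_seq [leRHS]big_seq; apply: ler_sum => p pk.
rewrite !mulr_sumr -sumrB; apply: le_trans (ler_norm_sum _ _ _) _.
rewrite big_nat [leRHS]big_nat; apply: ler_sum => m /= mk.
rewrite -mulrBl normrM (ger0_norm (tent0 _ _ pk)).
have [t0|t0] := eqVneq (tent (slice (2 * d k) p (a + m%:R * d k)) i x) 0.
  by rewrite t0 mul0r !mulr0.
apply: ler_wpM2r; first exact: tent0.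
apply: le_trans (slope_lip e0 (av0 _ _ _) (av0 _ _ _) (f0 x)) _.
rewrite ler_pM2r ?invr_gt0//.
have tx : bset (slice (2 * d k) p (a + m%:R * d k)) x.
  by apply: contrapT => h; move: t0; rewrite /tent indic_out// mul0r eqxx.
have px j : j != i -> p.1 0 j < x 0 j <= p.2 0 j.
  by move=> ji; have := tx j; rewrite /= !upd_other.
have := tx i; rewrite /= !upd_same => /andP[x1 x2].
have gap2 b c : b \in [:: 0; 1; -1] -> c \in [:: 0; 1; -1] -> b != c ->
    `|step (shifted_cells b k) f x - f x| + `|step (shifted_cells c k) f x - f x|
    <= gap k x.
  move=> bs cs bc; rewrite /gap (perm_big _ (perm_to_rem bs)) big_cons lerD2l.
  have cs' : c \in rem b [:: 0; 1; -1].
    have u3 : uniq [:: 0; 1; -1 : R].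
      rewrite /= !inE negb_or !andbT -andbA.
      by apply/and3P; split; apply/eqP => h; lra.
    by rewrite mem_rem_uniq// inE cs andbT eq_sym.
  rewrite (perm_big _ (perm_to_rem cs')) big_cons lerDl; exact: sumr_ge0.
(* [x] lies in the first or in the second cell under the tent. *)
have [xm|xm] := lerP (x 0 i) (a + m%:R * d k + d k).
  have mx : bset (cell k p m%:R) x.
    move=> j; rewrite /= !updE; case: eqP => [->|/eqP/px//].
    by rewrite x1 xm.
  have := gap2 0 1; rewrite !(step_cell _ pk mk mx) addr0.
  by apply; rewrite ?inE ?eqxx ?orbT// eq_sym oner_eq0.
have mx : bset (cell k p m.+1%:R) x.
  move=> j; rewrite /= !updE; case: eqP => [->|/eqP/px//].
  have -> : m.+1%:R = m%:R + 1 :> R by rewrite natr1.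
  by apply/andP; split; lra.
have mk1 : (m.+1 < 2 ^ k)%N.
  have /andP[_ xQ] := Qx i.
  rewrite -(ltr_nat R) -(ltr_pM2r (d0 k)) dL -natr1 mulrDl mul1r.
  have -> : L = Q.2 0 i - a by [].
  lra.
have := gap2 (-1) 0; rewrite !(step_cell _ pk mk1 mx) addr0 -natr1 addrK.
by apply; rewrite ?inE ?eqxx ?orbT// oppr_eq0 oner_eq0.
Qed.

Lemma measurable_slope : measurable_fun setT (fun x => slope e (f x) (f x)).
Proof.
have mr : measurable_fun setT (fun x => e / (e + f x)).
  have -> : (fun x => e / (e + f x)) = (fun t => e / (e + pos t)) \o f.
    by apply/funext => x /=; rewrite pos_id.
  apply: measurableT_comp; last exact: (@L1_measurable _ _ _ leb).
  apply: continuous_measurable_fun => t.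
  have c : {for t, continuous (fun t => e + pos t)}.
    exact: (continuousD (@cst_continuous R R e t) (@continuous_pos R t)).
  have c' : {for t, continuous (fun t => (e + pos t)^-1)}.
    by apply: continuousV c; rewrite gt_eqF// ltr_pwDl// pos_ge0.
  exact: (continuousM (@cst_continuous R R e t) c').
exact: measurable_funM.
Qed.

(** The weighted tents converge boundedly as the grid is refined, along a
    subsequence for which the averages converge almost everywhere. *)
Lemma Int_slope : `|Int (fun x => slope e (f x) (f x) * (\1_(bset Q) x * g x))| <=
  e * \prod_(j | j != i) side Q j.
Proof.
pose err c k := Int (fun x => `|\1_(bset Q) x * f x - step (shifted_cells c k) f x|).
have err0 c k : 0 <= err c k by exact: Int_ge0.
have errc c : c \in [:: 0; 1; -1] -> err c k @[k --> \oo] --> 0.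
  move=> cs; apply: (step_cvg_L1 (measurable_bset Q) (net_cells _) Lf).
  by move: cs; rewrite !inE => /or3P[] /eqP ->; rewrite ?normrN ?normr1 ?normr0.
pose tot k := err 0 k + (err 1 k + err (-1) k).
have tot0 : tot k @[k --> \oo] --> 0.
  by apply: cvg0D; [|apply: cvg0D]; apply: errc; rewrite !inE eqxx ?orbT.
have [s hs ts] := fast_subsequence tot0.
have aec c : c \in [:: 0; 1; -1] -> {ae leb, forall x,
    \1_(bset Q) x * f x - step (shifted_cells c (s k)) f x @[k --> \oo] --> 0}.
  move=> cs; apply: (@ae_cvg0_fast _ _ _ (@leb R n) _ 1).
    by move=> k; apply: L1B; [exact: L1_indicM|exact: L1_step].
  move=> k; apply: le_trans (ts k); rewrite -/(err c (s k)).
  have t0 : 0 <= tot (s k) by rewrite !addr_ge0.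
  rewrite (ger0_norm t0) /tot.
  move: cs; rewrite !inE => /or3P[] /eqP ->.
  - by rewrite lerDl addr_ge0.
  - by rewrite addrCA lerDl addr_ge0.
  - by rewrite addrA lerDr addr_ge0.
have dcvg r : 0 < r -> \forall k \near \oo, d (s k) < r.
  move=> r0; have [N _ HN] := small_sides vQ r0; exists N => // k /= Nk.
  apply: HN; apply: leq_trans Nk _.
  by elim: k => // k IH; apply: leq_ltn_trans IH _; exact: hs.
have wcvg : {ae leb, forall x, weighted_tents (s k) x @[k --> \oo] -->
    \1_(bset Q) x * slope e (f x) (f x)}.
  have A0 := aec 0; have A1 := aec 1; have A2 := aec (-1).
  apply: filterS3 (A0 _) (A1 _) (A2 _); rewrite ?inE ?eqxx ?orbT// => x x0 x1 x2.
  have aL : a + L = Q.2 0 i by rewrite /a /L /side addrC subrK.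
  have hL := L0.
  have [Qx|Qx] := pselect (bset Q x).
    rewrite indic_in// mul1r.
    have /andP[xa xb] := Qx i.
    have t1 : trans Q x = 1.
      by have := indic_trans Q x; rewrite indic_in// Qx mul1r => <-.
    apply/cvgrPdist_le => r r0.
    have g0 : gap (s k) x @[k --> \oo] --> 0.
      rewrite /gap; under eq_fun do rewrite !big_cons big_nil addr0.
      have N0 c : \1_(bset Q) x * f x - step (shifted_cells c (s k)) f x @[k --> \oo] --> 0 ->
          `|step (shifted_cells c (s k)) f x - f x| @[k --> \oo] --> 0.
        rewrite indic_in// mul1r => /cvg_norm; rewrite normr0.
        by under eq_fun do rewrite distrC.
      by apply: cvg0D; [|apply: cvg0D]; apply: N0.
    have re : 0 < r * e by rewrite mulr_gt0.
    have ux : 0 < x 0 i - a by rewrite subr_gt0.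
    have /cvgrPdist_lt/(_ _ re) := g0.
    apply: filterS2 (dcvg _ ux) => k hk; rewrite sub0r normrN => hg.
    have := weighted_close (s k) Qx.
    rewrite t1 (@profile_in (s k)) ?mulr1; [|lra|by rewrite aL].
    rewrite distrC => h; apply: le_trans h _.
    by rewrite ler_pdivrMr//; apply: le_trans (ltW hg); exact: ler_norm.
  rewrite indic_out// mul0r; apply: cvg_near_cst.
  have W0 k : trans Q x * profile k (x 0 i) = 0 -> weighted_tents k x = 0.
    by move=> h; apply/eqP; have := weighted_le k x; rewrite h normr_le0.
  have [t0|t1] := trans_01 Q x; first by apply: nearW => k; apply: W0; rewrite t0 mul0r.
  have [xa|xa] := lerP (x 0 i) a.
    by apply: nearW => k; apply: W0; rewrite profile_out ?mulr0//; left.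
  have [xb|xb] := lerP (x 0 i) (a + L).
    exfalso; move: (indic_trans Q x); rewrite indic_out// t1 -aL xa xb mul1r.
    by move/eqP; rewrite eq_sym oner_eq0.
  have ux : 0 < x 0 i - (a + L) by rewrite subr_gt0.
  apply: filterS (dcvg _ ux) => k hk; apply: W0; rewrite profile_out ?mulr0//.
  by right; lra.
pose Q2 := slice (2 * L) Q a.
have vQ2 : valid Q2 by apply: valid_slice => //; rewrite mulr_gt0.
have QQ2 x : bset Q x -> bset Q2 x.
  move=> Qx j; rewrite /= !updE; case: eqP => [->|_]; last exact: Qx.
  have /andP[-> h] := Qx i; apply: le_trans h _; have := L0.
  have -> : Q.2 0 i = a + L by rewrite /a /L /side addrC subrK.
  lra.
pose w x := \1_(bset Q2) x * g x.
have Lw : L1 w by exact: Lg.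
have Lww k : L1 (fun x => weighted_tents k x * w x).
  apply: (@L1_mulbdd _ _ _ _ _ _ 1); last exact: Lw.
    rewrite /weighted_tents; apply: measurable_sum => p; apply: measurable_sum => m.
    apply: measurable_funM; first exact: measurable_cst.
    apply: measurable_funM; last exact: measurable_cst.
    exact: measurable_tent.
  by move=> x; apply: le_trans (weighted_bound k x) (indic_le1 _ _).
have mw : measurable_fun setT w by exact: (@L1_measurable _ _ _ leb).
have lim : Int (fun x => weighted_tents (s k) x * w x) @[k --> \oo] -->
    Int (fun x => (\1_(bset Q) x * slope e (f x) (f x)) * w x).
  apply: (@Int_cvg _ _ _ (@leb R n) (fun k x => weighted_tents (s k) x * w x)
    (fun x => (\1_(bset Q) x * slope e (f x) (f x)) * w x) (fun x => `|w x|)).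
  - by move=> k; exact: (@L1_measurable _ _ _ leb).
  - apply: measurable_funM; last exact: mw.
    apply: measurable_funM; last exact: measurable_slope.
    exact: measurable_indic.
  - by apply: filterS wcvg => x hx; apply: cvgM => //; exact: cvg_cst.
  - exact: L1_norm.
  - move=> k x; rewrite normrM ler_piMl//.
    exact: le_trans (weighted_bound (s k) x) (indic_le1 _ _).
rewrite (_ : Int _ = Int (fun x => (\1_(bset Q) x * slope e (f x) (f x)) * w x)); last first.
  apply: eq_Int => x; rewrite /w; have [Qx|Qx] := pselect (bset Q x).
    by rewrite (indic_in (QQ2 _ Qx)) indic_in// !mul1r.
  by rewrite indic_out// !mul0r mulr0.
apply: (cvg_norm_le lim) => k; apply: le_trans (Int_weighted_tents (s k)).
rewrite le_eqVlt; apply/orP; left; apply/eqP; congr `|_|; apply: eq_Int => x.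
rewrite /w; have [Q2x|Q2x] := pselect (bset Q2 x).
  by rewrite indic_in// mul1r mulrC.
have := weighted_bound (s k) x; rewrite indic_out// normr_le0 => /eqP ->.
by rewrite mul0r mulr0.
Qed.

End chain_rule.

(** As [e] tends to 0, [e^2 / (e + f)^2] tends to 1 on the zero set of [f] and
    to 0 elsewhere, while the bound of [Int_slope] tends to 0. *)
Lemma Int_zero_set :
  Int (fun x => \1_(bset Q) x * (\1_[set x | f x = 0] x * g x)) = 0.
Proof.
pose e k : R := k.+1%:R^-1.
have e0 k : 0 < e k by rewrite invr_gt0.
have ec : e k @[k --> \oo] --> 0 by exact: cvg_harmonic.
pose w x := \1_(bset Q) x * g x.
have Lw : L1 w by exact: Lg.
pose A := [set x | f x = 0].
have mA : measurable A.
  rewrite (_ : A = f @^-1` [set 0]); last by [].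
  by rewrite -[X in measurable X]setTI; apply: (@L1_measurable _ _ _ leb _ Lf).
have lim : Int (fun x => slope (e k) (f x) (f x) * w x) @[k --> \oo] -->
    Int (fun x => \1_A x * w x).
  apply: (@Int_cvg _ _ _ (@leb R n) (fun k x => slope (e k) (f x) (f x) * w x)
    (fun x => \1_A x * w x) (fun x => `|w x|)).
  - move=> k; apply: measurable_funM; last exact: (@L1_measurable _ _ _ leb).
    exact: measurable_slope.
  - by apply: (@L1_measurable _ _ _ leb); exact: L1_indicM.
  - apply: aeW => x; apply: cvgM; last exact: cvg_cst.
    have [Ax|Ax] := pselect (A x).
      rewrite indic_in//; apply: cvg_near_cst; apply: nearW => k.
      by rewrite /slope Ax addr0 divff ?gt_eqF// mul1r.
    rewrite indic_out//.
    have fx : 0 < f x by rewrite lt_def f0 andbT; apply/eqP.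
    apply: (cvg0_le (b := fun k => (f x)^-1 * e k)).
    + by move=> k; have /andP[] := slope_01 (e0 k) (f0 x) (f0 x).
    + move=> k; rewrite /slope; have ek := e0 k.
      have /andP[h1 h2] := ratio_01 ek (f0 x).
      apply: le_trans (_ : e k / (e k + f x) <= _); first by rewrite ler_piMl.
      rewrite mulrC ler_pM2r// lef_pV2 ?posrE//; lra.
    + exact: cvg0Z.
  - exact: L1_norm.
  - move=> k x; have /andP[h1 h2] := slope_01 (e0 k) (f0 x) (f0 x).
    by rewrite normrM ler_piMl// ger0_norm.
have lim0 : Int (fun x => slope (e k) (f x) (f x) * w x) @[k --> \oo] --> 0.
  pose V := \prod_(j | j != i) side Q j.
  apply/cvgrPdist_le => r r0.
  have /cvgrPdist_le/(_ _ r0) : V * e k @[k --> \oo] --> 0 by exact: cvg0Z.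
  apply: filterS => k; rewrite !sub0r !normrN => h.
  apply: le_trans (Int_slope (e0 k)) _; rewrite mulrC; apply: le_trans h.
  exact: ler_norm.
rewrite (_ : Int _ = Int (fun x => \1_A x * w x)).
  exact: (cvg_unique (@norm_hausdorff _ R^o) lim lim0).
by apply: eq_Int => x; rewrite mulrCA.
Qed.

End weak_derivative.
End cube.
End direction.

Lemma closed_cbox (p1 p2 : Rn) : closed (cbox p1 p2).
Proof. by apply: compact_closed; [exact: norm_hausdorff|exact: compact_cbox]. Qed.

Lemma C1c_box (W : normedModType R) (U : set Rn) p (phi : Rn -> W) :
  (forall x, differentiable phi x) -> (forall v, continuous ('D_v phi)) ->
  cbox p.1 p.2 `<=` U -> (forall x, phi x != 0 -> bset p x) -> C1c U phi.
Proof.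
move=> dphi cphi pU phip.
have sub : closure [set x | phi x != 0] `<=` cbox p.1 p.2.
  rewrite closureE => x; apply; split; first exact: closed_cbox.
  by move=> y /= /phip; exact: box_sub_cbox.
split; [exact: dphi|exact: cphi| |exact: subset_trans sub pU].
exact: (subclosed_compact (@closed_closure _ _) (@compact_cbox _ _ p.1 p.2) sub).
Qed.

Lemma L1_box_loc (U : set Rn) p (v : Rn -> R) : L1loc leb U v ->
  cbox p.1 p.2 `<=` U -> L1 (fun x => \1_(bset p) x * v x).
Proof.
move=> Lv pU; have cK : compact (cbox p.1 p.2) by exact: compact_cbox.
have := (integrable_L1 leb v (measurable_compact cK)).1 (Lv _ cK pU).
move=> /(L1_indicM (measurable_bset p)).
rewrite (_ : (fun _ => _) = (fun x => \1_(bset p) x * v x))//.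
apply/funext => x; have [px|px] := pselect (bset p x); last by rewrite indic_out// !mul0r.
by rewrite [\1_(cbox _ _) x]indic_in ?mul1r//; exact: box_sub_cbox.
Qed.

(** The tent is not differentiable, but it is the limit of admissible test
    functions whose derivatives are bounded. *)
Lemma weak_gradient_tent (f : Rn -> R) (G : Rn -> Rn) i p : L1 f ->
  weak_gradient f G -> valid p ->
  Int (fun x => \1_(bset (hi i p)) x * f x) -
  Int (fun x => \1_(bset (lo i p)) x * f x) =
  Int (fun x => G x 0 i * tent p i x).
Proof.
move=> Lf [LG fG] vp.
have LGp : L1 (fun x => \1_(bset p) x * G x 0 i) by exact: L1_box_loc (LG i) _.
have Lfp : L1 (fun x => \1_(bset p) x * f x) by exact: L1_indicM.
have c1 := @Int_derive_smooth_tent R n p i _ vp Lfp.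
have c2 := @Int_smooth_tent R n p i _ vp LGp.
have E k : Int (fun x => f x * 'D_(evec i) (smooth_tent p i k) x) =
    - Int (fun x => G x 0 i * smooth_tent p i k x).
  rewrite !IntE; apply: fG; have [d c] := C1_smooth_tent p i k.
  by apply: (@C1c_box _ _ p) => // x; exact: smooth_tent_support.
move: c1; under eq_fun do rewrite E; move=> c1.
have c3 : - Int (fun x => G x 0 i * smooth_tent p i k x) @[k --> \oo] -->
    - Int (fun x => G x 0 i * tent p i x) by exact: cvgN c2.
have := cvg_unique (@norm_hausdorff _ R^o) c1 c3 => h.
by rewrite -opprB h opprK.
Qed.

(** By [Int_zero_set] the integral of the gradient over the part of any box
    where [f = 0] vanishes, and boxes determine integrable functions. *)
Theorem gradient_zero (f : Rn -> R) (G : Rn -> Rn) : L1 f -> (forall x, 0 <= f x) ->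
  weak_gradient f G -> {ae leb, forall x, f x = 0 -> forall i, G x 0 i = 0}.
Proof.
move=> Lf f0 fG.
have LG p i : L1 (fun x => \1_(bset p) x * G x 0 i).
  exact: L1_box_loc (fG.1 i) _.
pose A := [set x | f x = 0].
have mA : measurable A.
  rewrite (_ : A = f @^-1` [set 0]); last by [].
  by rewrite -[X in measurable X]setTI; apply: (@L1_measurable _ _ _ leb _ Lf).
pose C (r : nat) : Rn * Rn := cube r.+1%:R.
have H i r : {ae leb, forall x, bset (C r) x -> \1_(bset (C r)) x * (\1_A x * G x 0 i) = 0}.
  have vC : valid (C r) by move=> j; rewrite !mxE; have : 0 < r.+1%:R :> R by []; lra.
  apply: ae_zero_on_boxes => //.
    under eq_fun do rewrite mulrCA; exact: (L1_indicM mA (LG (C r) i)).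
  move=> p vp pC; rewrite -[RHS](Int_zero_set vp Lf f0 (fun p _ => LG p i)
    (fun p vp => weak_gradient_tent i Lf fG vp)).
  apply: eq_Int => x; have [px|px] := pselect (bset p x).
    by rewrite [\1_(bset (C r)) x]indic_in ?mul1r//; exact: pC.
  by rewrite indic_out// !mul0r.
have H2 : {ae leb, forall x, forall r i, bset (C r) x ->
    \1_(bset (C r)) x * (\1_A x * G x 0 i) = 0}.
  by apply: ae_foralln => r; apply: filter_forall => i; exact: H.
apply: filterS H2 => x hx fx i.
have [r r0 /(_ x erefl) xr] := compact_sub_cube (@compact_set1 Rn x).
have xC : bset (C (Num.truncn r)) x.
  move=> j; have := xr j; rewrite !mxE => /andP[h1 h2].
  have := truncnS_gt r => h3.
  by apply/andP; split; [apply: lt_trans h1; rewrite ltrN2|exact: ltW (le_lt_trans h2 h3)].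
by have := hx _ i xC; rewrite indic_in// mul1r (indic_in (fx : A x)) mul1r.
Qed.

End gradient_on_zero_set.

(** * Testing the weighted variation *)

Section testing.
Context {R : realType} {n : nat}.
Local Notation Rn := ('rV[R]_n.+1).
Local Notation L1 := (L1 (@leb R n)).
Local Notation Int := (Int (@leb R n)).
Implicit Types (p Q : Rn * Rn) (x y : Rn) (i j : 'I_n.+1) (U : set Rn).

Lemma leb_eq0_ae (P : Rn -> Prop) : leb [set: Rn] = 0%E -> {ae leb, forall x, P x}.
Proof. by move=> T0; exists setT; split. Qed.

Lemma Linfnorm_ae_le U (h : Rn -> R) (M : R) : (Linfnorm U h <= M%:E)%E ->
  {ae leb, forall x, U x -> `|h x| <= M}.
Proof.
rewrite /Linfnorm unlock; case: ifPn => [_ /ess_supP|].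
  by apply: filterS => x + Ux; rewrite /= lee_fin indic_in// mul1r.
rewrite lt_def measure_ge0 andbT negbK => /eqP T0 _; exact: leb_eq0_ae.
Qed.

Lemma ae_le_Linfnorm U (h : Rn -> R) (M : R) : 0 <= M ->
  {ae leb, forall x, U x -> `|h x| <= M} -> (Linfnorm U h <= M%:E)%E.
Proof.
move=> M0 hM; rewrite /Linfnorm unlock; case: ifPn => _; last by rewrite lee_fin.
apply/ess_supP; apply: filterS hM => x hx; rewrite /= lee_fin.
have [Ux|Ux] := pselect (U x); first by rewrite indic_in// mul1r hx.
by rewrite indic_out// mul0r normr0.
Qed.

Lemma off_support (V : normedModType R) (phi : Rn -> V) x :
  ~ closure [set x | phi x != 0] x -> phi x = 0.
Proof.
move=> Kx; apply/eqP; apply: contrapT => /negP p0; apply: Kx.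
exact: subset_closure.
Qed.

Lemma derive_off_support (V : normedModType R) (phi : Rn -> V) v x :
  ~ closure [set x | phi x != 0] x -> 'D_v phi x = 0.
Proof.
move=> Kx.
have near0 : \forall x \near x, cst 0 x = phi x.
  have : nbhs x (~` closure [set x | phi x != 0]).
    apply: open_nbhs_nbhs; split => //; apply: closed_openC; exact: closed_closure.
  by apply: filterS => y Ky; rewrite (off_support Ky).
by rewrite -(near_eq_derive _ near0) derive_cst.
Qed.

Lemma C1c_bounded (W V : normedModType R) U (phi : Rn -> W) (psi : Rn -> V) :
  C1c U phi -> continuous psi ->
  (forall x, ~ closure [set x | phi x != 0] x -> psi x = 0) ->
  exists C, forall x, `|psi x| <= C.
Proof.
move=> [_ _ cK _] cpsi psi0.
have /compact_bounded[M [_ HM]] : compact (psi @` closure [set x | phi x != 0]).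
  by apply: continuous_compact => //; apply: continuous_subspaceT => x; exact: cpsi.
exists (Num.max 0 (M + 1)) => x.
have [Kx|Kx] := pselect (closure [set x | phi x != 0] x).
  have M1 : M < Num.max 0 (M + 1) by rewrite lt_max ltrDl ltr01 orbT.
  by apply: HM M1 _ _; exists x.
by rewrite psi0// normr0 le_max lexx.
Qed.

Section density.
Variables (f : Rn -> R) (U : set Rn).
Hypotheses (Lf : L1 f) (oU : open U).
Hypothesis fG : weak_gradient f (grad f).

Let mU : measurable U. Proof. exact: measurable_open. Qed.

(** The integrand of the weighted variation, as a function of the test field. *)
Definition theta (phi : Rn -> Rn) x : R :=
  div phi x * f x + edot (phi x) (grad f x).

Lemma L1_theta phi : C1c U phi -> L1 (theta phi).
Proof.
move=> Cphi; have [dphi cphi cK KU] := Cphi; apply: L1D.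
  have cdiv : continuous (div phi).
    have c i x : {for x, continuous (fun x => 'D_(evec i) phi x 0 i)}.
      apply: (@continuous_comp _ _ _ ('D_(evec i) phi) (fun y : Rn => y 0 i)).
        exact: cphi.
      exact: coord_continuous.
    rewrite /div => x; elim: (index_enum _) => [|i s IH].
      rewrite (_ : (fun _ => _) = cst 0); first exact: cst_continuous.
      by apply/funext => y; rewrite big_nil.
    rewrite (_ : (fun _ => _) = (fun y => 'D_(evec i) phi y 0 i) \+
      (fun y => \sum_(i <- s) 'D_(evec i) phi y 0 i)).
      exact: (continuousD (c i x) IH).
    by apply/funext => y; rewrite big_cons.
  have [C HC] : exists C, forall x, `|div phi x| <= C.
    apply: (C1c_bounded Cphi cdiv) => x Kx.
    by rewrite /div big1// => i _; rewrite (derive_off_support (evec i) Kx) mxE.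
  exact: (L1_mulbdd (continuous_measurable cdiv) HC Lf).
rewrite /edot; apply: L1_sum => i.
have ci : continuous (fun x => phi x 0 i).
  move=> x; apply: (@continuous_comp _ _ _ phi (fun y : Rn => y 0 i)).
    exact: (differentiable_continuous (dphi x)).
  exact: coord_continuous.
have [C HC] : exists C, forall x, `|phi x 0 i| <= C.
  by apply: (C1c_bounded Cphi ci) => x Kx; rewrite (off_support Kx) mxE.
set K := closure [set x | phi x != 0] in cK KU.
have -> : (fun x => phi x 0 i * grad f x 0 i) =
    (fun x => phi x 0 i * (\1_K x * grad f x 0 i)).
  apply/funext => x; have [Kx|Kx] := pselect (K x); first by rewrite indic_in// mul1r.
  by rewrite (off_support Kx) mxE !mul0r.
apply: (L1_mulbdd (continuous_measurable ci) HC).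
exact: (integrable_L1 leb _ (measurable_compact cK)).1 (fG.1 i _ cK (@subsetT _ _)).
Qed.

Lemma L1_bounded_theta phi (h : Rn -> R) (M : R) : C1c U phi ->
  measurable_fun U h -> {ae leb, forall x, U x -> `|h x| <= M} ->
  0 <= M -> L1 (fun x => \1_U x * (h x * theta phi x)).
Proof.
move=> Cphi mh hM M0; have Lt := L1_theta Cphi.
apply: (@L1_dom_ae _ _ _ _ _ (fun x => M * `|theta phi x|)).
- under eq_fun do rewrite mulrA.
  apply: measurable_funM; first exact: measurable_indicM.
  exact: (@L1_measurable _ _ _ leb).
- exact/L1Z/L1_norm.
- apply: filterS hM => x hx.
  have [Ux|Ux] := pselect (U x).
    by rewrite indic_in// mul1r normrM ler_wpM2r// hx.
  by rewrite indic_out// mul0r normr0 mulr_ge0.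
Qed.

Lemma BVnorm_test phi (h : Rn -> R) (M B : R) : C1c U phi ->
  (forall x, enorm (phi x) <= 1) ->
  measurable_fun U h -> {ae leb, forall x, U x -> `|h x| <= M} -> 0 <= M ->
  (BVnorm f U h <= B%:E)%E ->
  Int (fun x => \1_U x * (h x * theta phi x)) <= B.
Proof.
move=> Cphi phi1 mh hM M0 hB; rewrite -lee_fin; apply: le_trans hB.
rewrite -EFin_Int_restrict//; last exact: L1_bounded_theta hM M0.
apply: ereal_sup_ubound; exists phi => //; split => //.
apply: ae_le_Linfnorm => //; apply: aeW => x _ /=.
by rewrite ger0_norm// /enorm sqrtr_ge0.
Qed.

End density.
End testing.

(** * Haar coefficients of the product with the density *)

Section haar.
Context {R : realType} {n : nat}.
Local Notation Rn := ('rV[R]_n.+1).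
Local Notation L1 := (L1 (@leb R n)).
Local Notation Int := (Int (@leb R n)).
Implicit Types (p Q : Rn * Rn) (l : seq (Rn * Rn)) (x y : Rn) (i j : 'I_n.+1).

Lemma Int_sum_in (J : eqType) (s : seq J) (v : J -> Rn -> R) :
  (forall a, a \in s -> L1 (v a)) ->
  Int (fun x => \sum_(a <- s) v a x) = \sum_(a <- s) Int (v a).
Proof.
move=> Lv; pose v' a := if a \in s then v a else (fun=> 0).
have Lv' a : L1 (v' a).
  by rewrite /v'; case: ifP => [/Lv//|_]; exact: L1_0.
transitivity (Int (fun x => \sum_(a <- s) v' a x)).
  by apply: eq_Int => x; apply: eq_big_seq => j js; rewrite /v' js.
by rewrite Int_sum//; apply: eq_big_seq => j js; rewrite /v' js.
Qed.

Lemma Int_le_ae (u v : Rn -> R) : L1 u -> L1 v ->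
  {ae leb, forall x, u x <= v x} -> Int u <= Int v.
Proof.
move=> Lu Lv uv; have mu := L1_measurable Lu; have mv := L1_measurable Lv.
have mm : measurable_fun setT (fun x => Num.max (u x) (v x)).
  exact: measurable_maxr.
have Lm : L1 (fun x => Num.max (u x) (v x)).
  apply: (L1_dom mm (L1D (L1_norm Lu) (L1_norm Lv))) => x.
  by rewrite maxEle; case: ifP => _; rewrite ?lerDl ?lerDr.
have -> : Int v = Int (fun x => Num.max (u x) (v x)).
  by apply: (ae_eq_Int mv mm); apply: filterS uv => x /max_idPr ->.
by apply: (Int_le Lu Lm) => x; rewrite le_max lexx.
Qed.

Section vector_field.
Variables (g : Rn -> R) (i : 'I_n.+1).
Hypothesis Cg : C1 g.

Lemma differentiable_scale_evec x : differentiable (fun y => g y *: evec i : Rn) x.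
Proof. exact/differentiableZl/Cg.1. Qed.

Lemma derive_scale_evec v x :
  'D_v (fun y => g y *: evec i : Rn) x = 'D_v g x *: evec i.
Proof.
rewrite deriveE; last exact: differentiable_scale_evec.
rewrite diffZl; last exact: Cg.1.
by rewrite deriveE//; exact: Cg.1.
Qed.

Lemma continuous_derive_scale_evec v : continuous ('D_v (fun y => g y *: evec i : Rn)).
Proof.
rewrite (_ : 'D_v _ = fun x => 'D_v g x *: evec i).
  move=> x; exact: (@cvgZr_tmp R Rn Rn (nbhs x) _ _ ('D_v g x) (evec i) (Cg.2 v x)).
by apply/funext => x; exact: derive_scale_evec.
Qed.

Lemma div_scale_evec x : div (fun y => g y *: evec i : Rn) x = 'D_(evec i) g x.
Proof.
rewrite /div (bigD1 i)//= derive_scale_evec !mxE !eqxx mulr1 big1 ?addr0// => j ji.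
by rewrite derive_scale_evec !mxE (negbTE ji) andbF mulr0.
Qed.

Lemma edot_scale_evec x (w : Rn) : edot (g x *: evec i) w = g x * w 0 i.
Proof.
rewrite /edot (bigD1 i)//= !mxE !eqxx mulr1 big1 ?addr0// => j ji.
by rewrite !mxE (negbTE ji) andbF mulr0 mul0r.
Qed.

Lemma enorm_scale_evec x : enorm (g x *: evec i) = `|g x|.
Proof. by rewrite /enorm edot_scale_evec !mxE !eqxx mulr1 -expr2 sqrtr_sqr. Qed.

End vector_field.

Section estimate.
Variables (f : Rn -> R) (U : set Rn).
Hypotheses (Lf : L1 f) (oU : open U).
Hypothesis fG : weak_gradient f (grad f).

Let mU : measurable U. Proof. exact: measurable_open. Qed.

Variables (h : Rn -> R) (M B : R).
Hypotheses (mh : measurable_fun U h) (hM : {ae leb, forall x, U x -> `|h x| <= M}).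
Hypotheses (M0 : 0 <= M) (hB : (BVnorm f U h <= B%:E)%E).

Definition weighted x : R := \1_U x * (h x * f x).

Lemma L1_bounded_mul v : L1 v -> L1 (fun x => \1_U x * (h x * v x)).
Proof.
move=> Lv; apply: (@L1_dom_ae _ _ _ _ _ (fun x => M * `|v x|)).
- under eq_fun do rewrite mulrA.
  apply: measurable_funM; first exact: measurable_indicM.
  exact: (@L1_measurable _ _ _ leb).
- exact/L1Z/L1_norm.
- apply: filterS hM => x hx.
  have [Ux|Ux] := pselect (U x).
    by rewrite indic_in// mul1r normrM ler_wpM2r// hx.
  by rewrite indic_out// mul0r normr0 mulr_ge0.
Qed.

Lemma L1_weighted : L1 weighted.
Proof. exact: L1_bounded_mul. Qed.

Section box.
Variables (Q : Rn * Rn).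
Hypothesis QU : cbox Q.1 Q.2 `<=` U.

Definition box_gradient i : R := Int (fun x => `|\1_(bset Q) x * grad f x 0 i|).

(** The test field points in direction [i] and is the sum of the tents over the
    tiles, each with the sign that makes its contribution positive. As the tiles
    are disjoint and the tents at most [3 s] high, dividing by [3 s] makes the
    field admissible. The derivatives of the tents produce the differences on the
    left, and the term with the gradient of [f] is bounded by [M] times its
    mass. *)
Lemma haar_estimate l i (s : R) : 0 < s -> tiles l Q ->
  (forall p, p \in l -> valid p /\ side p i <= s) ->
  \sum_(p <- l) `|Int (fun x => \1_(bset (lo i p)) x * weighted x) -
                  Int (fun x => \1_(bset (hi i p)) x * weighted x)| <=
  3 * s * (B + M * box_gradient i).
Proof.
move=> s0 lQ vl.
pose D p := Int (fun x => \1_(bset (lo i p)) x * weighted x) -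
  Int (fun x => \1_(bset (hi i p)) x * weighted x).
pose phi k x := \sum_(p <- l) Num.sg (D p) * smooth_tent p i k x.
pose a := (3 * s)^-1; have s3 : 0 < 3 * s by rewrite mulr_gt0.
have a0 : 0 < a by rewrite invr_gt0.
have Cphi k : C1 (phi k).
  by apply: C1_sum => p; apply: C1Z; exact: C1_smooth_tent.
have sg1 p : `|Num.sg (D p)| <= 1 by rewrite normr_sg; case: (_ != _).
have phi_le k x : `|phi k x| <= 3 * s * \1_(bset Q) x.
  apply: le_trans (ler_norm_sum _ _ _) _; rewrite -lQ mulr_sumr.
  rewrite big_seq [leRHS]big_seq; apply: ler_sum => p /vl[vp ps].
  rewrite normrM; apply: le_trans (_ : `|smooth_tent p i k x| <= _).
    by rewrite ler_piMl.
  apply: le_trans (smooth_tent_le i vp k x) _.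
  by rewrite ler_wpM2r// ler_wpM2l.
pose Phi k x : Rn := (a * phi k x) *: evec i.
have Cgphi k : C1 (fun x => a * phi k x) by exact: C1Z.
have aphi_le k x : `|a * phi k x| <= \1_(bset Q) x.
  by rewrite normrM (gtr0_norm a0) /a ler_pdivrMl.
have CPhi k : C1c U (Phi k).
  apply: (@C1c_box _ _ _ _ Q).
  - exact: differentiable_scale_evec.
  - exact: continuous_derive_scale_evec.
  - exact: QU.
  - move=> x; rewrite scaler_eq0 negb_or => /andP[g0 _].
    apply: contrapT => Qx; have := aphi_le k x; rewrite indic_out// normr_le0.
    by rewrite (negbTE g0).
have Phi1 k x : enorm (Phi k x) <= 1.
  rewrite (enorm_scale_evec (fun x => a * phi k x)).
  exact: le_trans (aphi_le k x) (indic_le1 _ _).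
pose z x := \1_U x * (h x * (\1_(bset Q) x * grad f x 0 i)).
have LG : L1 (fun x => \1_(bset Q) x * grad f x 0 i).
  by apply: (L1_box_loc (fG.1 i)) => x _.
have Lz : L1 z by exact: L1_bounded_mul.
have Lw := L1_weighted.
have Lwb p : L1 (fun x => \1_(bset p) x * weighted x).
  by apply: L1_indicM; [exact: measurable_bset|exact: Lw].
have mphi k : measurable_fun setT (phi k).
  exact: (continuous_measurable (C1_continuous (Cphi k))).
have Lz' k : L1 (fun x => phi k x * z x).
  apply: (@L1_mulbdd _ _ _ _ _ _ (3 * s) (mphi k) _ Lz) => x.
  exact: le_trans (phi_le k x) (ler_piMr (ltW s3) (indic_le1 _ _)).
have LD p k : p \in l -> L1 (fun x => weighted x * 'D_(evec i) (smooth_tent p i k) x).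
  move=> /vl[vp _]; under eq_fun do rewrite mulrC.
  have [_ ct] := C1_smooth_tent p i k.
  apply: (@L1_mulbdd _ _ _ _ _ _ 2 (continuous_measurable (ct (evec i))) _ Lw) => x.
  apply: le_trans (derive_smooth_tent_le i vp k x) _.
  by apply: ler_piMr => //; exact: indic_le1.
have dphi k x : 'D_(evec i) (phi k) x =
    \sum_(p <- l) Num.sg (D p) * 'D_(evec i) (smooth_tent p i k) x.
  rewrite derive_sumC1; last by move=> p; apply: C1Z; exact: C1_smooth_tent.
  by apply: eq_bigr => p _; rewrite derive_C1Z//; exact: C1_smooth_tent.
have LDphi k : L1 (fun x => weighted x * 'D_(evec i) (phi k) x).
  under eq_fun do rewrite dphi mulr_sumr.
  rewrite (_ : (fun _ => _) = (fun x => \sum_(p <- l)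
      (if p \in l then Num.sg (D p) * (weighted x * 'D_(evec i) (smooth_tent p i k) x)
       else 0))).
    apply: L1_sum => p; case: (boolP (p \in l)) => [pl|_]; last exact: L1_0.
    exact: L1Z (LD p k pl).
  apply/funext => x; apply: eq_big_seq => p ->; exact: mulrCA.
have IntDk k : Int (fun x => weighted x * 'D_(evec i) (phi k) x) =
    \sum_(p <- l) Num.sg (D p) *
      Int (fun x => weighted x * 'D_(evec i) (smooth_tent p i k) x).
  transitivity (Int (fun x => \sum_(p <- l)
      Num.sg (D p) * (weighted x * 'D_(evec i) (smooth_tent p i k) x))).
    apply: eq_Int => x; rewrite dphi mulr_sumr; apply: eq_bigr => p _; exact: mulrCA.
  rewrite Int_sum_in; last by move=> p pl; exact: L1Z (LD p k pl).
  by apply: eq_big_seq => p pl; exact: IntZ (LD p k pl).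
have bound k : Int (fun x => weighted x * 'D_(evec i) (phi k) x) <=
    3 * s * (B + M * box_gradient i).
  have test := BVnorm_test Lf oU fG (CPhi k) (Phi1 k) mh hM M0 hB.
  have E : Int (fun x => \1_U x * (h x * theta f (Phi k) x)) =
      a * (Int (fun x => weighted x * 'D_(evec i) (phi k) x) + Int (fun x => phi k x * z x)).
    rewrite -(IntD (LDphi k) (Lz' k)) -(IntZ a (L1D (LDphi k) (Lz' k))).
    apply: eq_Int => x; rewrite /theta /Phi (div_scale_evec i (Cgphi k)).
    rewrite (edot_scale_evec (fun x => a * phi k x)) (derive_C1Z _ _ _ (Cphi k)).
    have -> : phi k x * z x = phi k x * (\1_U x * (h x * grad f x 0 i)).
      rewrite /z; have [Qx|Qx] := pselect (bset Q x); first by rewrite (indic_in Qx) mul1r.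
      have := phi_le k x; rewrite (indic_out Qx) mulr0 normr_le0 => /eqP ->.
      by rewrite !mul0r.
    by rewrite /weighted; ring.
  have I2 : `|Int (fun x => phi k x * z x)| <= 3 * s * (M * box_gradient i).
    apply: le_trans (Int_abs (Lz' k)) _.
    rewrite /box_gradient -(IntZ _ (L1_norm LG)) -(IntZ _ (L1Z M (L1_norm LG))).
    apply: (Int_le_ae (L1_norm (Lz' k)) (L1Z _ (L1Z M (L1_norm LG)))).
    apply: filterS hM => x hx; rewrite normrM.
    apply: ler_pM => //.
      exact: le_trans (phi_le k x) (ler_piMr (ltW s3) (indic_le1 _ _)).
    rewrite /z; have [Ux|Ux] := pselect (U x); last first.
      by rewrite indic_out// mul0r normr0 mulr_ge0.
    by rewrite indic_in// mul1r normrM ler_wpM2r// hx.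
  have I3 := ler_norm (- Int (fun x => phi k x * z x)).
  rewrite normrN in I3.
  move: test; rewrite E /a ler_pdivrMl// => test.
  move: I2 I3 test; move: (Int _) (Int _) `|_| => X Y Z; lra.
have lim : Int (fun x => weighted x * 'D_(evec i) (phi k) x) @[k --> \oo] -->
    \sum_(p <- l) `|D p|.
  rewrite (_ : (fun _ => _) = fun k => \sum_(p <- l) Num.sg (D p) *
      Int (fun x => weighted x * 'D_(evec i) (smooth_tent p i k) x)); last first.
    exact/funext/IntDk.
  have : {in l, forall p, valid p} by move=> p /vl[].
  elim: (l) => [_|p l' IH vl'].
    rewrite big_nil; under eq_fun do rewrite big_nil; exact: cvg_cst.
  rewrite big_cons; under eq_fun do rewrite big_cons; apply: cvgD.
    rewrite normrEsg; apply: cvgM; first exact: cvg_cst.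
    by apply: Int_derive_smooth_tent => //; apply: vl'; exact: mem_head.
  by apply: IH => q ql; apply: vl'; rewrite inE ql orbT.
by apply: (cvgr_to_le lim); apply: nearW.
Qed.

End box.
End estimate.
End haar.

(** * Decay of the averaging error *)

Section refinement.
Context {R : realType} {n : nat}.
Local Notation Rn := ('rV[R]_n.+1).
Local Notation L1 := (L1 (@leb R n)).
Local Notation Int := (Int (@leb R n)).
Implicit Types (p Q : Rn * Rn) (l : seq (Rn * Rn)) (x y : Rn) (i j : 'I_n.+1).
Implicit Types (v : Rn -> R) (js : seq 'I_n.+1).

Lemma Int_lo_hi p i v : valid p -> L1 v -> Int (fun x => \1_(bset p) x * v x) =
  Int (fun x => \1_(bset (lo i p)) x * v x) + Int (fun x => \1_(bset (hi i p)) x * v x).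
Proof.
move=> vp Lv; have L q : L1 (fun x => \1_(bset q) x * v x).
  exact: (L1_indicM (measurable_bset q) Lv).
rewrite -(IntD (L (lo i p)) (L (hi i p))); apply: eq_Int => x.
by rewrite (indic_lo_hi i x vp) mulrDl.
Qed.

Lemma msr_lo_hi i p : msr (lo i p) = msr (hi i p) :> R.
Proof.
rewrite -!Int_bset !Int_indic; [|exact: measurable_bset..].
by congr fine; exact: leb_lo_hi.
Qed.

Lemma msr_lo i p : valid p -> msr p = 2 * msr (lo i p) :> R.
Proof.
move=> vp; rewrite -!Int_bset; have L q : L1 (\1_(bset q) : Rn -> R) by exact: L1_bset.
transitivity (Int \1_(bset (lo i p)) + Int \1_(bset (hi i p))).
  by rewrite -(IntD (L _) (L _)); apply: eq_Int => x; exact: indic_lo_hi.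
by rewrite !Int_bset msr_lo_hi mulr_natl mulr2n.
Qed.

Lemma avg_lo_hi p i v : valid p -> L1 v ->
  avg p v = (avg (lo i p) v + avg (hi i p) v) / 2.
Proof.
move=> vp Lv; rewrite !avgE (Int_lo_hi i vp Lv) (msr_lo i vp) -msr_lo_hi.
by rewrite invfM -mulrDl -[RHS]mulrA [2^-1 * _]mulrC.
Qed.

(** Up to normalisation, the Haar coefficients of [v] on the boxes of [l] for the
    halving in direction [i]. *)
Definition jumps i l v : R := \sum_(p <- l)
  `|Int (fun x => \1_(bset (lo i p)) x * v x) - Int (fun x => \1_(bset (hi i p)) x * v x)|.

(** Halving every box in one direction moves the average by a multiple of a
    Haar function on each box, whose coefficient is the difference of the two
    halves. *)
Lemma step_split i l v : (forall p, p \in l -> valid p) -> L1 v ->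
  Int (fun x => `|step (diag (split i l)) v x - step (diag l) v x|) <= jumps i l v.
Proof.
move=> vl Lv.
pose c p := `|avg (lo i p) v - avg (hi i p) v| / 2.
have Lc p : L1 (fun x => c p * \1_(bset p) x) by apply: L1Z; exact: L1_bset.
apply: (@le_trans _ _ (Int (fun x => \sum_(p <- l) c p * \1_(bset p) x))).
  apply: Int_le; [apply: L1_norm; apply: L1B; exact: L1_step|exact: L1_sum|].
  move=> x; rewrite !stepE /diag !big_map /split big_flatten big_map -sumrB.
  apply: le_trans (ler_norm_sum _ _ _) _.
  rewrite big_seq [leRHS]big_seq; apply: ler_sum => p /vl vp.
  rewrite !big_cons big_nil /= addr0 (avg_lo_hi i vp Lv) (indic_lo_hi i x vp).
  have i1 := indic_ge0 (R := R) (bset (lo i p)) x.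
  have i2 := indic_ge0 (R := R) (bset (hi i p)) x.
  rewrite /c; move: (avg (lo i p) v) (avg (hi i p) v) i1 i2 => a b.
  move: (\1_(bset (lo i p)) x) (\1_(bset (hi i p)) x) => s t s0 t0.
  have -> : s * a + t * b - (s + t) * ((a + b) / 2) = (s - t) * ((a - b) / 2) by field.
  rewrite normrM mulrC; apply: ler_pM => //.
    by rewrite normrM (ger0_norm (_ : 0 <= 2^-1)).
  by apply: le_trans (ler_normB _ _) _; rewrite !ger0_norm.
rewrite (Int_sum _ Lc) /jumps big_seq [leRHS]big_seq; apply: ler_sum => p /vl vp.
rewrite (IntZ _ (L1_bset p)) Int_bset (msr_lo i vp).
rewrite /c !avgE msr_lo_hi -mulrBl.
move: (Int _ - Int _) (msr_ge0 (R := R) (hi i p)) => d m0.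
have [->|m1] := eqVneq (msr (hi i p)) 0; first by rewrite !mulr0.
rewrite normrM normfV (ger0_norm m0).
by rewrite le_eqVlt; apply/orP; left; apply/eqP; field.
Qed.

Lemma side_split i s l : (forall p, p \in l -> valid p /\ forall j, side p j <= s) ->
  forall p, p \in split i l -> valid p /\ forall j, side p j <= s.
Proof.
move=> vl p /mem_split[q /vl[vq qs] pq].
have /andP[m1 m2] := mid_in i vq.
case: pq => ->; (split; first by [exact: valid_lo|exact: valid_hi]) => j;
  apply: le_trans (qs j); rewrite /side /= updE; case: eqP => // ->.
- by rewrite lerB// ltW.
- by rewrite lerB// ltW.
Qed.

Lemma side_halve js s l : (forall p, p \in l -> valid p /\ forall j, side p j <= s) ->
  forall p, p \in halve js l -> valid p /\ forall j, side p j <= s.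
Proof. by move=> vl; elim: js => // j js IH; exact: side_split. Qed.

Section decay.
Variables (Q : Rn * Rn) (v : Rn -> R) (K : R).
Hypotheses (vQ : valid Q) (Lv : L1 v) (K0 : 0 <= K).
Hypothesis small_jumps : forall i l s, 0 < s -> tiles l Q ->
  (forall p, p \in l -> valid p /\ forall j, side p j <= s) -> jumps i l v <= s * K.

Definition averaging_error l : R :=
  Int (fun x => `|\1_(bset Q) x * v x - step (diag l) v x|).

Let L1err l : L1 (fun x => \1_(bset Q) x * v x - step (diag l) v x).
Proof.
by apply: L1B; [exact: (L1_indicM (measurable_bset Q) Lv)|exact: L1_step].
Qed.

Lemma averaging_error_split i l : (forall p, p \in l -> valid p) ->
  averaging_error l <= averaging_error (split i l) + jumps i l v.
Proof.
move=> vl; apply: le_trans (lerD (lexx _) (step_split i vl Lv)).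
have L3 : L1 (fun x => step (diag (split i l)) v x - step (diag l) v x).
  by apply: L1B; exact: L1_step.
rewrite /averaging_error -(IntD (L1_norm (L1err _)) (L1_norm L3)).
apply: (Int_le (L1_norm (L1err _)) (L1D (L1_norm (L1err _)) (L1_norm L3))) => x.
by apply: le_trans (ler_normD _ _); rewrite addrA subrK.
Qed.

Lemma averaging_error_halve js l s : 0 < s -> tiles l Q ->
  (forall p, p \in l -> valid p /\ forall j, side p j <= s) ->
  averaging_error l <= averaging_error (halve js l) + (size js)%:R * (s * K).
Proof.
move=> s0 lQ vl; have vl' p : p \in l -> valid p by move=> /vl[].
elim: js => [|j js IH]; first by rewrite mul0r addr0.
apply: le_trans IH _; rewrite /= -natr1 mulrDl mul1r addrA addrAC lerD2r.
have vh := side_halve vl.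
apply: le_trans (averaging_error_split j (fun p ph => (vh js p ph).1)) _.
rewrite lerD2l; apply: small_jumps => //; last exact: vh.
exact: tiles_halve.
Qed.

Definition total_side : R := \sum_j side Q j.

Lemma side_le_total j : 0 < side Q j <= total_side.
Proof.
have s0 i : 0 < side Q i by rewrite subr_gt0.
rewrite s0 /total_side (bigD1 j)//= lerDl; apply: sumr_ge0 => i _; exact: ltW.
Qed.

(** Each refinement decreases the error by at most a constant times the side of
    the boxes, which is a geometric sequence, and in the limit no error is
    left. *)
Lemma averaging_error_boxes k :
  averaging_error (boxes k Q) <= 2 * (n.+1%:R * (total_side * K)) / 2 ^+ k.
Proof.
set C := n.+1%:R * (total_side * K).
have /andP[S1 S2] := side_le_total ord0.
have S0 : 0 < total_side by exact: lt_le_trans S1 S2.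
have step1 m : averaging_error (boxes m Q) <=
    averaging_error (boxes m.+1 Q) + C / 2 ^+ m.
  have m0 : 0 < total_side / 2 ^+ m by rewrite divr_gt0// exprn_gt0.
  have vl p : p \in boxes m Q -> valid p /\ forall j, side p j <= total_side / 2 ^+ m.
    move=> pm; split; first exact: valid_dyadic pm.
    move=> j; rewrite (mem_boxes j pm) ler_pM2r ?invr_gt0 ?exprn_gt0//.
    by have /andP[] := side_le_total j.
  have := averaging_error_halve (enum 'I_n.+1) m0 (tiles_dyadic _ m vQ) vl.
  rewrite size_enum_ord => h; apply: le_trans h _; rewrite lerD2l.
  by rewrite /C !mulrA [X in X <= _]mulrAC mulrAC.
have C0 : 0 <= C by rewrite !mulr_ge0// ltW.
have step2 m : averaging_error (boxes k Q) <=
    averaging_error (boxes (k + m) Q) + 2 * C / 2 ^+ k * (1 - 1 / 2 ^+ m).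
  elim: m => [|m IH]; first by rewrite addn0 expr0 divr1 subrr mulr0 addr0.
  apply: le_trans IH _; rewrite addnS.
  have := step1 (k + m)%N.
  have k0 : (2 : R) ^+ k != 0 by rewrite expf_neq0.
  have m0 : (2 : R) ^+ m != 0 by rewrite expf_neq0.
  have -> : C / 2 ^+ (k + m) = 2 * C / 2 ^+ k * (1 - 1 / 2 ^+ m.+1) -
      2 * C / 2 ^+ k * (1 - 1 / 2 ^+ m).
    by rewrite exprD exprS; field; rewrite k0 m0.
  move: (averaging_error _) (averaging_error _) => a b; lra.
have lim : averaging_error (boxes (k + m) Q) + 2 * C / 2 ^+ k @[m --> \oo] -->
    0 + 2 * C / 2 ^+ k.
  apply: cvgD; last exact: cvg_cst.
  under eq_fun do rewrite addnC.
  have := step_cvg_L1 (measurable_bset Q) (net_boxes vQ) Lv.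
  by rewrite -(cvg_shiftn k).
rewrite -[leRHS]add0r; apply: (@ler_cvg_to _ _ _ _ _ _ _ _ (cvg_cst _) lim).
apply: nearW => m; apply: le_trans (step2 m) _; rewrite lerD2l.
have p0 r : 0 <= (2 : R) ^+ r by exact: exprn_ge0.
apply: ler_piMr; first by rewrite divr_ge0// mulr_ge0.
by rewrite lerBlDr lerDl divr_ge0.
Qed.

End decay.
End refinement.

(** * Selection of an almost everywhere convergent subsequence *)

Section ultralimit.
Context {R : realType}.

(** Along an ultrafilter every bounded sequence converges, so that a single
    ultrafilter serves all bounded sequences at once. *)
Lemma ultra_bounded_limit (G : set_system nat) (a : nat -> R) (C : R) :
  UltraFilter G -> (forall j, `|a j| <= C) ->
  exists l, forall e, 0 < e -> G [set j | `|a j - l| < e].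
Proof.
move=> GU aC.
have GC : G [set j | a j \in `[- C, C]].
  by apply: filterE => j /=; rewrite in_itv/= -ler_norml.
have [l [_ al]] := @segment_compact R (- C) C (a @ G) _ GC.
exists l => e e0.
have [//|Gn] := in_ultra_setVsetC [set j | `|a j - l| < e] GU.
have GA : (a @ G) [set t | ~ `|t - l| < e] by [].
have [t [/= tl lt]] := al _ _ GA (nbhsx_ballx l e e0).
by exfalso; apply: tl; rewrite distrC.
Qed.

Lemma ultra_sum_small (J : Type) (G : set_system nat) (a : J -> nat -> R)
    (l : J -> R) (s : seq J) : Filter G ->
  (forall p e, 0 < e -> G [set j | `|a p j - l p| < e]) ->
  forall e, 0 < e -> G [set j | \sum_(p <- s) `|a p j - l p| <= e].
Proof.
move=> GF al; elim: s => [e e0|p s IH e e0].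
  by apply: filterE => j /=; rewrite big_nil ltW.
have e2 : 0 < e / 2 by rewrite divr_gt0.
apply: filterS2 (al p _ e2) (IH _ e2) => j /= h1 h2.
by rewrite big_cons; lra.
Qed.

End ultralimit.

Section selection.
Context {R : realType} {n : nat}.
Local Notation Rn := ('rV[R]_n.+1).
Local Notation L1 := (L1 (@leb R n)).
Local Notation Int := (Int (@leb R n)).
Implicit Types (p Q : Rn * Rn) (l : seq (Rn * Rn)) (x y : Rn) (i j : 'I_n.+1).

Lemma Int_step_le l v : L1 v -> Int (fun x => `|step (diag l) v x|) <=
  \sum_(p <- l) `|Int (fun x => \1_(bset p) x * v x)|.
Proof.
move=> Lv.
have Lc p : L1 (fun x => `|avg p v| * \1_(bset p) x) by apply: L1Z; exact: L1_bset.
apply: (@le_trans _ _ (Int (fun x => \sum_(p <- l) `|avg p v| * \1_(bset p) x))).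
  apply: Int_le; [apply: L1_norm; exact: L1_step|exact: L1_sum|] => x.
  rewrite stepE /diag big_map; apply: le_trans (ler_norm_sum _ _ _) _.
  apply: ler_sum => p _; rewrite normrM mulrC.
  by rewrite [X in _ * X <= _]ger0_norm// indic_ge0.
rewrite (Int_sum _ Lc); apply: ler_sum => p _.
rewrite (IntZ _ (L1_bset p)) Int_bset.
rewrite avgE normrM normfV (ger0_norm (msr_ge0 p)).
have [->|m0] := eqVneq (msr p) 0; first by rewrite mulr0.
by rewrite divfK.
Qed.

Variables (f : Rn -> R) (U : set Rn).
Hypotheses (f0 : forall x, 0 <= f x) (Lf : L1 f) (oU : open U).
Hypothesis fG : weak_gradient f (grad f).
Variables (h : nat -> Rn -> R) (M B : R).
Hypotheses (mh : forall k, measurable_fun U (h k)).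
Hypotheses (hM : forall k, {ae leb, forall x, U x -> `|h k x| <= M}).
Hypotheses (M0 : 0 <= M) (B0 : 0 <= B) (hB : forall k, (BVnorm f U (h k) <= B%:E)%E).

Let w k := weighted f U (h k).

Let Lw k : L1 (w k). Proof. exact: L1_weighted (hM k) M0. Qed.

(** The constant depends on the sequence through [B] and [M] only. *)
Lemma uniform_averaging_error Q : valid Q -> cbox Q.1 Q.2 `<=` U ->
  exists2 D, 0 <= D & forall k m, averaging_error Q (w k) (boxes m Q) <= D / 2 ^+ m.
Proof.
move=> vQ QU; pose K := 3 * \sum_i (B + M * box_gradient f Q i).
have t0 i : 0 <= B + M * box_gradient f Q i.
  by rewrite addr_ge0// mulr_ge0//; apply: Int_ge0.
have K0 : 0 <= K by apply: mulr_ge0 => //; apply: sumr_ge0 => i _; exact: t0.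
exists (2 * (n.+1%:R * (total_side Q * K))).
  have /andP[h1 h2] := side_le_total vQ ord0.
  have h3 : 0 <= total_side Q by exact: ltW (lt_le_trans h1 h2).
  by apply: mulr_ge0 => //; apply: mulr_ge0 => //; exact: mulr_ge0 h3 K0.
move=> k m; apply: averaging_error_boxes => // i l s s0 lQ vl.
have := haar_estimate Lf oU fG (mh k) (hM k) M0 (hB k) QU (i := i) s0 lQ _.
rewrite /jumps -/(w k) => H; apply: le_trans (H _) _.
  by move=> p /vl[vp ps]; split.
rewrite /K mulrA [s * 3]mulrC ler_wpM2l//; first by rewrite mulr_ge0// ltW.
by rewrite (bigD1 i)//= lerDl; apply: sumr_ge0 => j _; exact: t0.
Qed.

Let coef p k := Int (fun x => \1_(bset p) x * w k x).

Let L1_coef p k : L1 (fun x => \1_(bset p) x * w k x).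
Proof. exact: (L1_indicM (measurable_bset p) (Lw k)). Qed.

Lemma coef_bound p k : `|coef p k| <= M * Int f.
Proof.
apply: le_trans (Int_abs (L1_coef p k)) _; rewrite -(IntZ _ Lf).
apply: (Int_le_ae (L1_norm (L1_coef p k)) (L1Z _ Lf)).
apply: filterS (hM k) => x hx; rewrite normrM.
apply: (@le_trans _ _ `|w k x|); first by rewrite ler_piMl// indic_norm_le1.
rewrite /w /weighted; have [Ux|Ux] := pselect (U x).
  by rewrite indic_in// mul1r normrM (ger0_norm (f0 x)) ler_wpM2r// hx.
by rewrite indic_out// mul0r normr0 mulr_ge0.
Qed.

(** An enumeration of the boxes with rational vertices. The default value is not
    [valid], hence harmless. *)
Definition rational_boxes (q : nat) : Rn * Rn :=
  if choice.unpickle q is Some p then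
    let p : {ffun 'I_n.+1 -> rat} * {ffun 'I_n.+1 -> rat} := p in
    (\row_j ratr (p.1 j), \row_j ratr (p.2 j))
  else (0, 0).

(** A diagonal subsequence, along which at step [k] all integrals over the tiles
    of the first [k] subdivisions of the first [k] rational boxes are close to
    their limits along an ultrafilter. *)
Lemma converging_coefficients : exists2 s : nat -> nat,
  {homo s : a b / (a < b)%N} & exists lim : Rn * Rn -> R, forall k q m,
    (q <= k)%N -> (m <= k)%N ->
    \sum_(p <- boxes m (rational_boxes q)) `|coef p (s k) - lim p| <= 1 / 2 ^+ k.
Proof.
have [G [GU Goo]] := ultraFilterLemma (@eventually_filter).
have GP : ProperFilter G by exact: ultra_proper.
have [lim hlim] : {lim : Rn * Rn -> R & forall p e, 0 < e ->
    G [set j | `|coef p j - lim p| < e]}.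
  apply: (@choice _ _ (fun p (c : R) => forall e, 0 < e -> G [set j | `|coef p j - c| < e])).
  by move=> p; apply: ultra_bounded_limit GU (coef_bound p).
pose P k (j : nat) := forall q m : 'I_k.+1,
  \sum_(p <- boxes m (rational_boxes q)) `|coef p j - lim p| <= 1 / 2 ^+ k.
have [|s hs Ps] := @exists_increasing P; last first.
  exists s => //; exists lim => k q m qk mk.
  have qk' : (q < k.+1)%N by [].
  have mk' : (m < k.+1)%N by [].
  exact: (Ps k (Ordinal qk') (Ordinal mk')).
move=> k N.
have GPk : G (P k).
  apply: filter_forall => q; apply: filter_forall => m.
  by apply: ultra_sum_small => //; rewrite divr_gt0// exprn_gt0.
have GN : G [set j | (N <= j)%N] by apply: Goo; exists N.
by have [j [Pj Nj]] := filter_ex (filterI GPk GN); exists j.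
Qed.

(** At step [k] the averages over tiles of side [2^-k] differ little between
    consecutive members, and these averages are close to the functions. *)
Theorem selection : exists2 s : nat -> nat, {homo s : a b / (a < b)%N} &
  {ae leb, forall x, U x -> cvgn (fun k => h (s k) x * f x)}.
Proof.
have [s hs [lim hlim]] := converging_coefficients; exists s => //.
have H q : {ae leb, forall x, valid (rational_boxes q) ->
    cbox (rational_boxes q).1 (rational_boxes q).2 `<=` U ->
    bset (rational_boxes q) x -> cvgn (fun k => h (s k) x * f x)}.
  set Q := rational_boxes q.
  have [vQ|vQ] := pselect (valid Q); last by apply: aeW => x /vQ.
  have [QU|QU] := pselect (cbox Q.1 Q.2 `<=` U); last by apply: aeW => x _ /QU.
  have [D D0 HD] := uniform_averaging_error vQ QU.
  have Lq k : L1 (fun x => \1_(bset Q) x * w (s (k + q)%N) x) by exact: L1_coef.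
  have Ld k k' : L1 (fun x => w k x - w k' x) by exact: L1B.
  have Le k m : L1 (fun x => \1_(bset Q) x * w k x - step (diag (boxes m Q)) (w k) x).
    by apply: L1B; [exact: L1_coef|exact: L1_step].
  have fast k : Int (fun x => `|\1_(bset Q) x * w (s (k.+1 + q)%N) x -
      \1_(bset Q) x * w (s (k + q)%N) x|) <= (2 * D + 2) / 2 ^+ k.
    pose m := (k + q)%N; rewrite addSn -/m.
    set a := s m.+1; set b := s m; set l := boxes m Q.
    have stepab : Int (fun x => `|step (diag l) (fun x => w a x - w b x) x|) <= 2 / 2 ^+ m.
      apply: le_trans (Int_step_le l (Ld a b)) _.
      apply: (@le_trans _ _ (\sum_(p <- l) (`|coef p a - lim p| + `|coef p b - lim p|))).
        apply: ler_sum => p _.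
        rewrite (_ : Int _ = coef p a - coef p b).
          by rewrite [X in _ <= _ + X]distrC; apply: le_trans (ler_normD _ _); rewrite addrA subrK.
        rewrite /coef -(IntB (L1_coef p a) (L1_coef p b)); apply: eq_Int => x.
        by rewrite mulrBr.
      rewrite big_split /=.
      have h1 := hlim m.+1 q m (leq_trans (leq_addl k q) (leqnSn _)) (leqnSn _).
      have h2 := hlim m q m (leq_addl k q) (leqnn _).
      apply: le_trans (lerD h1 h2) _.
      have m0 : (0 : R) < 2 ^+ m by rewrite exprn_gt0.
      have : 1 / 2 ^+ m.+1 <= 1 / 2 ^+ m :> R.
        by rewrite !div1r lef_pV2 ?posrE ?exprn_gt0// exprS; apply: ler_peMl; [exact: ltW|exact: ler1n].
      lra.
    have mk : 1 / 2 ^+ m <= 1 / 2 ^+ k :> R.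
      by rewrite !div1r lef_pV2 ?posrE ?exprn_gt0// ler_weXn2l ?ler1n// leq_addr.
    apply: (@le_trans _ _ (D / 2 ^+ m + D / 2 ^+ m + 2 / 2 ^+ m)); last first.
      have : 0 <= (2 * D + 2) * (1 / 2 ^+ k - 1 / 2 ^+ m).
        by rewrite mulr_ge0 ?subr_ge0// addr_ge0// mulr_ge0.
      lra.
    apply: le_trans (lerD (lerD (HD a m) (HD b m)) stepab).
    rewrite /averaging_error -(IntD (L1_norm (Le a m)) (L1_norm (Le b m))).
    have LS : L1 (step (diag l) (fun x => w a x - w b x)) by exact: L1_step.
    have Ls2 := L1D (L1_norm (Le a m)) (L1_norm (Le b m)).
    rewrite -(IntD Ls2 (L1_norm LS)).
    apply: (Int_le (L1_norm (L1B (L1_coef Q a) (L1_coef Q b))) (L1D Ls2 (L1_norm LS))) => x.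
    rewrite (stepB _ _ (Lw a) (Lw b)) -/l.
    set A := \1_(bset Q) x * w a x; set Bx := \1_(bset Q) x * w b x.
    move: (step _ (w a) x) (step _ (w b) x) => sa sb.
    have -> : A - Bx = (A - sa) - (Bx - sb) + (sa - sb) by ring.
    by apply: le_trans (ler_normD _ _) _; rewrite lerD2r ler_normB.
  apply: filterS (ae_cvg_fast Lq fast) => x cx _ _ Qx.
  have Ux : U x by apply: QU; exact: box_sub_cbox.
  apply/cvg_ex; move/cvg_ex: cx => [c cx]; exists c.
  rewrite -(cvg_shiftn q) /=; move: cx; apply: cvg_trans.
  apply: near_eq_cvg; apply: nearW => k.
  by rewrite (indic_in Qx) mul1r /w /weighted (indic_in Ux) mul1r.
have H2 := ae_foralln H.
apply: filterS H2 => x hx Ux.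
have [p [vp xp pU]] := rational_box oU Ux.
have E : rational_boxes (choice.pickle p) = (\row_j ratr (p.1 j), \row_j ratr (p.2 j)).
  by rewrite /rational_boxes choice.pickleK.
by apply: (hx (choice.pickle p)); rewrite E.
Qed.

End selection.

(** * Lower semicontinuity and local convergence *)

Section extended_reals.
Context {R : realType}.
Local Open Scope ereal_scope.
Implicit Types u : nat -> \bar R.

Lemma ereal_sup_bounded u : ereal_sup (range u) < +oo ->
  exists2 B : R, (0 <= B)%R & forall j, u j <= B%:E.
Proof.
have ub j : u j <= ereal_sup (range u) by apply: ereal_sup_ubound; exists j.
move: ub; case: (ereal_sup _) => [r| |] ub // _.
  by exists (Num.max 0 r)%R => [|j]; rewrite ?le_max ?lexx// (le_trans (ub j))// lee_fin le_max lexx orbT.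
by exists 0%R => // j; apply: le_trans (ub j) _; exact: leNye.
Qed.

Lemma einfs_le_limn_einf u N : einfs u N <= limn_einf u.
Proof.
rewrite limn_einf_lim (cvg_lim _ (@cvg_einfs_sup _ u))//.
by apply: ereal_sup_ubound; exists N.
Qed.

(** The explicit rate makes the bound survive passing to a further
    subsequence. *)
Lemma liminf_subsequence u (B : R) : (forall j, 0 <= u j <= B%:E) ->
  exists2 c : R, limn_einf u = c%:E & exists2 s : nat -> nat,
    {homo s : i j / (i < j)%N} & forall k, u (s k) <= (c + 1 / 2 ^+ k)%:E.
Proof.
move=> uB.
have l0 : 0 <= limn_einf u.
  apply: le_trans (einfs_le_limn_einf u 0).
  by apply: le_ereal_inf_tmp => _ [m _ <-]; have /andP[] := uB m.
have lB : limn_einf u <= B%:E.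
  rewrite limn_einf_lim (cvg_lim _ (@cvg_einfs_sup _ u))//.
  apply: ge_ereal_sup => _ [N _ <-]; apply: ereal_inf_le.
  by exists (u N); [exists N => /=|have /andP[] := uB N].
have fl : limn_einf u \is a fin_num.
  by rewrite ge0_fin_numE//; apply: le_lt_trans lB _; rewrite ltry.
exists (fine (limn_einf u)); first by rewrite fineK.
apply: (@exists_increasing (fun k m => u m <= (fine (limn_einf u) + 1 / 2 ^+ k)%:E)) => k N; set e := (1 / 2 ^+ k)%R.
have e0 : (0 < e)%R by rewrite divr_gt0// exprn_gt0.
apply: contrapT => H.
have : (fine (limn_einf u) + e)%:E <= einfs u N.
  apply: le_ereal_inf_tmp => _ [m Nm <-]; rewrite leNgt; apply/negP => /ltW um.
  by apply: H; exists m.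
move=> /le_trans/(_ (einfs_le_limn_einf u N)).
by rewrite -[X in _ <= X]fineK// lee_fin gerDl leNgt e0.
Qed.

End extended_reals.

Section lower_semicontinuity.
Context {R : realType} {n : nat}.
Local Notation Rn := ('rV[R]_n.+1).
Local Notation L1 := (L1 (@leb R n)).
Local Notation Int := (Int (@leb R n)).
Implicit Types (x : Rn) (i : 'I_n.+1) (U : set Rn).

Lemma C1c_0 U : C1c U (fun _ : Rn => 0 : Rn).
Proof.
have S0 : closure [set x : Rn | (0 : Rn) != 0] = set0.
  by rewrite (_ : [set x | _] = set0) ?closure0//; apply/seteqP; split => x //=; rewrite eqxx.
split; rewrite ?S0 //.
- by move=> v x; rewrite (_ : 'D_v _ = cst 0); [exact: cst_continuous|
    apply/funext => y; rewrite derive_cst].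
- exact: compact0.
Qed.

Lemma BVnorm_ge0 (f : Rn -> R) U h : (0 <= BVnorm f U h)%E.
Proof.
apply: ereal_sup_ubound; exists (fun=> 0); last first.
  have d0 x : div (fun _ : Rn => 0 : Rn) x = 0.
    rewrite /div big1// => i _.
    by rewrite (_ : 'D_(evec i) _ x = 0) ?mxE//; exact: derive_cst.
  have e0 (v : Rn) : edot 0 v = 0 by rewrite /edot big1// => i _; rewrite mxE mul0r.
  by rewrite integral0_eq// => x _; rewrite d0 e0 mul0r addr0 mulr0.
split; first exact: C1c_0.
apply: ae_le_Linfnorm => //; apply: aeW => x _ /=.
by rewrite /enorm /edot big1 ?sqrtr0 ?normr0// => i _; rewrite mxE mul0r.
Qed.

Section limit.
Variables (f : Rn -> R) (U : set Rn).
Hypotheses (f0 : forall x, 0 <= f x) (Lf : L1 f) (oU : open U).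
Hypothesis fG : weak_gradient f (grad f).
Variables (h : nat -> Rn -> R) (g : Rn -> R) (M : R).
Hypotheses (mh : forall k, measurable_fun U (h k)).
Hypotheses (hM : forall k, {ae leb, forall x, U x -> `|h k x| <= M}).
Hypotheses (mg : measurable_fun U g) (gM : {ae leb, forall x, U x -> `|g x| <= M}).
Hypothesis M0 : 0 <= M.
Hypothesis hg : {ae leb, forall x, U x -> 0 < f x -> h k x @[k --> \oo] --> g x}.

(** For a fixed test field the integrals converge by dominated convergence: on
    [f > 0] the functions do, and on [f = 0] the integrand vanishes almost
    everywhere by [gradient_zero]. *)
Lemma BVnorm_lsc (c : R) :
  (forall k, BVnorm f U (h k) <= (c + 1 / 2 ^+ k)%:E)%E -> (BVnorm f U g <= c%:E)%E.
Proof.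
move=> hc; have mU := measurable_open oU.
apply: ge_ereal_sup => _ [phi [Cphi phi1] <-].
have Lt := L1_theta Lf fG Cphi.
have Lh k := L1_bounded_theta Lf oU fG Cphi (mh k) (hM k) M0.
have Lg := L1_bounded_theta Lf oU fG Cphi mg gM M0.
rewrite (EFin_Int_restrict mU Lg) lee_fin.
have lim : Int (fun x => \1_U x * (h k x * theta f phi x)) @[k --> \oo] -->
    Int (fun x => \1_U x * (g x * theta f phi x)).
  have [] := @Int_dct _ _ _ leb (fun k x => \1_U x * (h k x * theta f phi x))
    (fun x => \1_U x * (g x * theta f phi x)) (fun x => M * `|theta f phi x|).
  - by move=> k; exact: L1_measurable (Lh k).
  - exact: L1_measurable Lg.
  - apply: filterS2 hg (gradient_zero Lf f0 fG) => x hx gx.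
    have [Ux|Ux] := pselect (U x); last first.
      by rewrite indic_out// mul0r; under eq_fun do rewrite mul0r; exact: cvg_cst.
    have [fx|fx] := eqVneq (f x) 0.
      have t0 : theta f phi x = 0.
        rewrite /theta fx mulr0 add0r /edot big1// => i _.
        by rewrite (gx fx) mulr0.
      by rewrite t0 !mulr0; under eq_fun do rewrite !mulr0; exact: cvg_cst.
    apply: cvgM; first exact: cvg_cst.
    apply: cvgM; last exact: cvg_cst.
    by apply: hx => //; rewrite lt_def fx f0.
  - exact: (L1Z M (L1_norm Lt)).
  - move=> k; apply: filterS (hM k) => x hx.
    have [Ux|Ux] := pselect (U x).
      by rewrite indic_in// mul1r normrM ler_wpM2r// hx.
    by rewrite indic_out// mul0r normr0 mulr_ge0.
  by [].
have clim : c + 1 / 2 ^+ k @[k --> \oo] --> c + 0.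
  apply: cvgD; first exact: cvg_cst.
  under eq_fun do rewrite -exprVn; apply: cvg0Z.
  by apply: cvg_expr; rewrite ger0_norm ?invr_ge0// invf_lt1// ltr1n.
rewrite -[leRHS]addr0; apply: (ler_cvg_to lim clim); apply: nearW => k.
rewrite -lee_fin; apply: le_trans (hc k).
by rewrite -(EFin_Int_restrict mU (Lh k)); apply: ereal_sup_ubound; exists phi.
Qed.

End limit.
End lower_semicontinuity.

Section weighted_measure.
Context {R : realType} {n : nat}.
Local Notation Rn := ('rV[R]_n.+1).
Implicit Types (x : Rn) (K : set Rn).
Variables (f : Rn -> R) (U : set Rn).
Hypotheses (f0 : forall x, 0 <= f x) (Lf : L1 leb f) (oU : open U).
Variable mu : {measure set Rn -> \bar R}.
Hypothesis muE : forall A, measurable A -> mu A = (\int[leb]_(x in A) (f x)%:E)%E.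

Lemma ae_weighted (P : Rn -> Prop) : {ae leb, forall x, P x} -> {ae mu, forall x, P x}.
Proof.
move=> [N [mN N0 PN]]; exists N; split => //; rewrite muE// null_set_integral//.
by apply/measurable_EFinP; apply: measurable_funTS; exact: L1_measurable Lf.
Qed.

Lemma ae_density_gt0 : {ae mu, forall x, 0 < f x}.
Proof.
pose A := [set x | f x = 0].
have mA : measurable A.
  rewrite (_ : A = f @^-1` [set 0])//.
  by rewrite -[X in measurable X]setTI; apply: (L1_measurable Lf).
exists A; split => //; last first.
  by move=> x /= /negP; rewrite lt_def f0 andbT negbK => /eqP.
by rewrite muE// integral0_eq// => x /= ->.
Qed.

Lemma weighted_compact_fin K : compact K -> (mu K < +oo)%E.
Proof.
move=> /measurable_compact mK; rewrite muE// EFin_Int_restrict ?ltry//.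
exact: L1_indicM.
Qed.

Section local_convergence.
Variables (h : nat -> Rn -> R) (g : Rn -> R) (M : R).
Hypotheses (mh : forall k, measurable_fun U (h k)).
Hypotheses (hM : forall k, {ae leb, forall x, U x -> `|h k x| <= M}).
Hypothesis mg : measurable_fun U g.
Hypothesis hg : {ae leb, forall x, U x -> 0 < f x -> h k x @[k --> \oo] --> g x}.

(** The weighted measure is absolutely continuous, finite on compact sets, and
    does not charge [f = 0]; so the convergence is almost everywhere and
    dominated for it. *)
Lemma cvg_L1loc_of_ae : cvg_L1loc mu U h g.
Proof.
have H K : compact K -> K `<=` U ->
    [/\ forall k, L1 mu (fun x => \1_K x * h k x), L1 mu (fun x => \1_K x * g x) &
      Int mu (fun x => `|\1_K x * h k x - \1_K x * g x|) @[k --> \oo] --> 0].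
  move=> cK KU; have mK := measurable_compact cK.
  have mr (v : Rn -> R) : measurable_fun U v -> measurable_fun setT (fun x => \1_K x * v x).
    by move=> mv; exact: (measurable_indicM mK (measurable_funS (measurable_open oU) KU mv)).
  have Ldom : L1 mu (fun x => M * \1_K x).
    by apply/L1Z/L1_indic => //; exact: weighted_compact_fin.
  have dom (v : Rn -> R) : {ae leb, forall x, U x -> `|v x| <= M} ->
      {ae mu, forall x, `|\1_K x * v x| <= M * \1_K x}.
    move=> vM; apply: ae_weighted; apply: filterS vM => x vx.
    have [Kx|Kx] := pselect (K x).
      by rewrite indic_in// mul1r mulr1 vx//; exact: KU.
    by rewrite indic_out// mul0r mulr0 normr0.
  have [] := @Int_dct _ _ _ mu (fun k x => \1_K x * h k x) (fun x => \1_K x * g x) _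
    (fun k => mr _ (mh k)) (mr _ mg) _ Ldom (fun k => dom _ (hM k)).
    apply: filterS2 ae_density_gt0 (ae_weighted hg) => x fx hx.
    have [Kx|Kx] := pselect (K x).
      by apply: cvgM; [exact: cvg_cst|apply: hx => //; exact: KU].
    by rewrite indic_out// mul0r; under eq_fun do rewrite mul0r; exact: cvg_cst.
  move=> Lg _ c0; split => // k.
  exact: L1_dom_ae (mr _ (mh k)) Ldom (dom _ (hM k)).
split=> [k K cK KU|K cK KU|K cK KU].
- by have [Lh _ _] := H K cK KU; apply: (integrable_L1 mu _ (measurable_compact cK)).2 (Lh k).
- by have [_ Lg _] := H K cK KU; apply: (integrable_L1 mu _ (measurable_compact cK)).2 Lg.
have [Lh Lg c0] := H K cK KU; have mK := measurable_compact cK.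
have E k : (\int[mu]_(x in K) `|h k x - g x|%:E)%E =
    (Int mu (fun x => `|\1_K x * h k x - \1_K x * g x|))%:E.
  have Ex x : `|\1_K x * h k x - \1_K x * g x| = \1_K x * `|h k x - g x|.
    by rewrite -mulrBr normrM [X in X * _]ger0_norm// indic_ge0.
  rewrite (funext Ex) -EFin_Int_restrict//.
  by rewrite -(funext Ex); exact: L1_norm (L1B (Lh k) Lg).
under eq_fun do rewrite E.
by apply: cvg_EFin => //; exact: nearW.
Qed.

End local_convergence.
End weighted_measure.

(** * Compactness *)

Section compactness.
Context {R : realType} {n : nat}.
Local Notation Rn := ('rV[R]_n.+1).
Implicit Types (x : Rn) (U : set Rn).

Lemma grad_weak_gradient (f : Rn -> R) : W11loc f -> weak_gradient f (grad f).
Proof.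
move=> [_ [G fG]]; rewrite /grad.
by have := @xgetPex _ (fun=> 0) [set G | weak_gradient f G] (ex_intro _ G fG).
Qed.

Section upper_limit.
Variables (U : set Rn) (h : nat -> Rn -> R).

(** A measurable choice of the limit that is defined also where there is
    none. *)
Definition upper_limit x : R := fine (limn_esup (fun k => (\1_U x * h k x)%:E)).

Lemma measurable_upper_limit : measurable U -> (forall k, measurable_fun U (h k)) ->
  measurable_fun setT upper_limit.
Proof.
move=> mU mh; apply: (measurableT_comp (fine_measurable measurableT)).
apply: measurable_fun_limn_esup => k; apply/measurable_EFinP.
exact: measurable_indicM.
Qed.

Lemma upper_limit_cvg x (l : R) : U x -> h k x @[k --> \oo] --> l -> upper_limit x = l.
Proof.
move=> Ux hl; rewrite /upper_limit.
have : (\1_U x * h k x)%:E @[k --> \oo] --> l%:E.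
  rewrite indic_in//; under eq_fun do rewrite mul1r.
  by apply: cvg_EFin => //; exact: nearW.
by move/cvg_limn_einf_sup => [_ ->].
Qed.

End upper_limit.

(** The subsequence does not depend on the limit function, which is left open on
    the set where the sequence diverges: for a sequence of sets it can then be
    chosen to be an indicator. The subsequence is extracted from one along which
    the variations already tend to their lower limit. *)
Theorem BV_compactness (mu : {measure set Rn -> \bar R}) (f : Rn -> R) U
    (h : nat -> Rn -> R) (M B : R) :
  classW mu f -> open U -> 0 <= M ->
  (forall k, measurable_fun U (h k)) ->
  (forall k, {ae leb, forall x, U x -> `|h k x| <= M}) ->
  (forall k, (BVnorm f U (h k) <= B%:E)%E) ->
  exists2 s : nat -> nat, {homo s : i j / (i < j)%N} &
    forall g : Rn -> R, measurable_fun U g ->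
      {ae leb, forall x, U x -> `|g x| <= M} ->
      {ae leb, forall x (l : R), U x -> h (s k) x @[k --> \oo] --> l -> g x = l} ->
      [/\ cvg_L1loc mu U (h \o s) g, (BVnorm f U g < +oo)%E &
          (BVnorm f U g <= limn_einf (fun k => BVnorm f U (h k)))%E].
Proof.
move=> [f0 Lf /grad_weak_gradient fG _ muE] oU M0 mh hM hB.
have Bk k : (0 <= BVnorm f U (h k) <= B%:E)%E by rewrite BVnorm_ge0 hB.
have [c cE [s0 hs0 s0c]] := liminf_subsequence Bk.
have B0 : 0 <= B by have /andP[h1 h2] := Bk 0%N; rewrite -lee_fin (le_trans h1).
have [s1 hs1 cv] := selection f0 Lf oU fG (fun k => mh (s0 k)) (fun k => hM (s0 k))
  M0 B0 (fun k => hB (s0 k)).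
exists (s0 \o s1) => [i j ij|g mg gM glim]; first exact/hs0/hs1.
have hg : {ae leb, forall x, U x -> 0 < f x -> h ((s0 \o s1) k) x @[k --> \oo] --> g x}.
  apply: filterS2 glim cv => x gx cx Ux fx.
  have /cvg_ex[l cl] := cx Ux.
  suff cl' : h ((s0 \o s1) k) x @[k --> \oo] --> l / f x by rewrite (gx _ Ux cl').
  have cm : h (s0 (s1 k)) x * f x * (f x)^-1 @[k --> \oo] --> l / f x.
    exact: (cvgM cl (cvg_cst (f x)^-1)).
  by move: cm; under eq_fun do rewrite mulfK ?gt_eqF//.
have mhs k : measurable_fun U (h ((s0 \o s1) k)) by exact: mh.
have hsM k : {ae leb, forall x, U x -> `|h ((s0 \o s1) k) x| <= M} by exact: hM.
have s1k k : (k <= s1 k)%N.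
  by elim: k => // k IH; apply: leq_ltn_trans IH _; exact: hs1.
have Bc k : (BVnorm f U (h ((s0 \o s1) k)) <= (c + 1 / 2 ^+ k)%:E)%E.
  apply: le_trans (s0c (s1 k)) _; rewrite lee_fin lerD2l !div1r.
  by rewrite lef_pV2 ?posrE ?exprn_gt0// ler_weXn2l// ler1n.
have lsc := BVnorm_lsc f0 Lf oU fG mhs hsM mg gM M0 hg Bc.
split; last by rewrite cE.
- exact: (cvg_L1loc_of_ae f0 Lf oU muE mhs hsM mg hg).
- by apply: le_lt_trans lsc _; rewrite ltry.
Qed.

End compactness.

Definition clamp {R : realType} (M t : R) : R := Num.max (- M) (Num.min M t).

Lemma clamp_le {R : realType} (M t : R) : 0 <= M -> `|clamp M t| <= M.
Proof.
move=> M0; rewrite ler_norml /clamp le_max lexx/= ge_max ge_min lexx/= andbT.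
lra.
Qed.

Lemma clamp_id {R : realType} (M t : R) : `|t| <= M -> clamp M t = t.
Proof. by rewrite ler_norml /clamp => /andP[h1 h2]; rewrite min_r// max_r. Qed.

Theorem lemma2p7 (R : realType) (n : nat)
    (mu : {measure set 'rV[R]_n.+1 -> \bar R}) (f : 'rV[R]_n.+1 -> R)
    (U : set 'rV[R]_n.+1) :
  classW mu f -> open U -> lipschitz_boundary U ->
  (forall h : nat -> 'rV[R]_n.+1 -> R,
    (forall j, BV f U (h j)) ->
    (ereal_sup (range (fun j => BVnorm f U (h j))) < +oo)%E ->
    (ereal_sup (range (fun j => Linfnorm U (h j))) < +oo)%E ->
    exists (s : nat -> nat) (h_oo : 'rV[R]_n.+1 -> R),
      [/\ {homo s : i j / (i < j)%N},
          BV f U h_oo,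
          Linfty U h_oo,
          cvg_L1loc mu U (h \o s) h_oo &
          (BVnorm f U h_oo <= limn_einf (fun j => BVnorm f U (h j)))%E]) /\
  (forall E : nat -> set 'rV[R]_n.+1,
    (forall j, finite_perimeter f U (E j)) ->
    (ereal_sup (range (fun j => Per f U (E j))) < +oo)%E ->
    exists (s : nat -> nat) (E_oo : set 'rV[R]_n.+1),
      [/\ {homo s : i j / (i < j)%N},
          finite_perimeter f U E_oo,
          cvg_L1loc mu U (fun j => \1_(E (s j))) \1_E_oo &
          (Per f U E_oo <= limn_einf (fun j => Per f U (E j)))%E]).
Proof.
move=> Wf oU _; have mU := measurable_open oU; split.
  move=> h hBV /ereal_sup_bounded[B _ hB] /ereal_sup_bounded[M M0 hM].
  have mh j : measurable_fun U (h j) by have [] := hBV j.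
  have hMae j : {ae leb, forall x, U x -> `|h j x| <= M}.
    exact: Linfnorm_ae_le (hM j).
  have [s hs Hs] := BV_compactness Wf oU M0 mh hMae hB.
  (* Clamping keeps the bound [M] where the sequence diverges. *)
  pose g x := clamp M (upper_limit U (h \o s) x).
  have mg : measurable_fun setT g.
    apply: measurable_maxr; first exact: measurable_cst.
    apply: measurable_minr; first exact: measurable_cst.
    by apply: measurable_upper_limit => // k; exact: mh.
  have mgU : measurable_fun U g by exact: measurable_funTS.
  have gM : {ae leb, forall x, U x -> `|g x| <= M}.
    by apply: aeW => x _; exact: clamp_le.
  have [|cg gfin gle] := Hs g mgU gM.
    apply: filterS (ae_foralln hMae) => x hx l Ux cl.
    rewrite /g (upper_limit_cvg Ux cl) clamp_id//.
    by apply: (cvg_norm_le cl) => k; exact: hx.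
  exists s, g; split => //; split => //.
  by apply: le_lt_trans (ae_le_Linfnorm M0 gM) _; rewrite ltry.
move=> E EBV /ereal_sup_bounded[B _ EB].
have mE j : measurable (E j) by have [] := EBV j.
have mh j : measurable_fun U (\1_(E j) : _ -> R).
  by apply: measurable_funTS; exact: measurable_indic.
have hM j : {ae leb, forall x, U x -> `|\1_(E j) x : R| <= 1}.
  by apply: aeW => x _; exact: indic_norm_le1.
have [s hs Hs] := BV_compactness Wf oU ler01 mh hM EB.
pose u := upper_limit U (fun k => \1_(E (s k)) : _ -> R).
(* Where the indicators converge the limit is 0 or 1, and any threshold in between
   recovers it. *)
pose E_oo := [set x | 2^-1 < u x].
have mE_oo : measurable E_oo.
  rewrite (_ : E_oo = u @^-1` `]2^-1, +oo[); last first.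
    by apply/seteqP; split => x /=; rewrite in_itv/= andbT.
  rewrite -[X in measurable X]setTI; apply: measurable_upper_limit => // k.
have [|||cg gfin gle] := Hs \1_E_oo.
- by apply: measurable_funTS; exact: measurable_indic.
- by apply: aeW => x _; exact: indic_norm_le1.
- apply: aeW => x l Ux cl; have ul : u x = l by exact: (@upper_limit_cvg _ _ _ (fun k => \1_(E (s k))) _ _ Ux cl).
  have ll : l * l = l.
    apply: (@cvg_unique _ (@norm_hausdorff _ R^o) (\1_(E (s k)) x @[k --> \oo]) _ _ _ _ cl).
    have cm : \1_(E (s k)) x * \1_(E (s k)) x @[k --> \oo] --> l * l by exact: (cvgM cl cl).
    rewrite (_ : (fun k => \1_(E (s k)) x) = (fun k => \1_(E (s k)) x * \1_(E (s k)) x))//.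
    by apply/funext => k; rewrite indicE; case: (_ \in _); rewrite ?mulr1 ?mulr0.
  have /eqP : l * (l - 1) = 0 by rewrite mulrBr ll mulr1 subrr.
  rewrite mulf_eq0 subr_eq0 => /orP[] /eqP l01.
    by rewrite indic_out ?l01// /E_oo /= ul l01 => h; lra.
  by rewrite indic_in ?l01// /E_oo /= ul l01; lra.
by exists s, E_oo.
Qed.
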